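(* Let $\alpha\in\mathbb R$ be a badly approximable number, let $1\le p,\theta\le\infty$ and $s>1/p$, and let $d=2$. For $N\in\mathbb N$ let $\mathcal P_N(\alpha)=\{(n/N,\{n\alpha\}):n=0,1,\dots,N-1\}$. Then there are constants $0<c\le C<\infty$, independent of $N$, such that for all integers $N\ge2$ $$c\,\frac{(\log N)^{1-1/\theta}}{N^s}\;\le\;\mathrm{wce}\bigl(\mathcal P_N(\alpha),\mathring{\mathbf B}^s_{p,\theta}\bigr)\;\le\; C\,\frac{(\log N)^{1-1/\theta}}{N^s}.$$
   Context: Conventions: $\log$ is the logarithm to base $2$; $1/\infty:=0$; $\{x\}$ is the fractional part of $x$; $\langle x\rangle=\min_{m\in\mathbb Z}|x-m|$ is the distance of $x\in\mathbb R$ to the nearest integer. Badly approximable: $\alpha\in\mathbb R$ is badly approximable if there is $c_0=c_0(\alpha)>0$ with $k\langle k\alpha\rangle\ge c_0$ for all integers $k\ge1$. Function space (here $d=2$): for $f\in L_1(\mathbb R^d)$ let $\mathcal F f(\boldsymbol\xi)=\int_{\mathbb R^d}f(\boldsymbol y)e^{-2\pi \mathrm i\langle\boldsymbol\xi,\boldsymbol y\rangle}\,d\boldsymbol y$ (with $\langle\boldsymbol\xi,\boldsymbol y\rangle$ the inner product), extended to tempered distributions as usual. Let $\Psi_0\in C_0^\infty(\mathbb R)$ be the up-function, i.e. the function with support $[-1,1]$ and $\mathcal F\Psi_0(\xi)=\prod_{k=0}^\infty \mathrm{sinc}(2^{-k}\xi)$, $\mathrm{sinc}(\xi)=\sin(\pi\xi)/(\pi\xi)$.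 Fix a non-negative integer $L$ with $L+1>s$, and put $\Psi_1(x)=\frac{d^L}{dx^L}\bigl(2\Psi_0(2\,\cdot)-\Psi_0\bigr)(x)$, $\Psi_j(x)=2^{j-1}\Psi_1(2^{j-1}x)$ for $j\ge1$, and $\Psi_{\boldsymbol m}(\boldsymbol x)=\prod_{i=1}^d\Psi_{m_i}(x_i)$ for $\boldsymbol m\in\mathbb N_0^d$. The Besov space of dominating mixed smoothness $\mathbf B^s_{p,\theta}(\mathbb R^d)$ is the set of tempered distributions $f$ on $\mathbb R^d$ with $$\|f\|_{\mathbf B^s_{p,\theta}}=\Bigl(\sum_{\boldsymbol m\in\mathbb N_0^d}2^{s|\boldsymbol m|_1\theta}\|\Psi_{\boldsymbol m}*f\|_{L_p(\mathbb R^d)}^\theta\Bigr)^{1/\theta}<\infty$$ (supremum over $\boldsymbol m$ if $\theta=\infty$), where $|\boldsymbol m|_1=m_1+\dots+m_d$. Put $\mathring{\mathbf B}^s_{p,\theta}=\{f\in\mathbf B^s_{p,\theta}(\mathbb R^d):\mathrm{supp}(f)\subset[0,1]^d\}$ with the same norm. Since $s>1/p$, these functions are continuous. Worst-case error of a point set $\mathcal P=\{\boldsymbol x_0,\dots,\boldsymbol x_{N-1}\}\subset[0,1)^d$: $\mathrm{wce}(\mathcal P,\mathring{\mathbf B}^s_{p,\theta})=\sup\bigl\{\bigl|\int_{[0,1]^d}f(\boldsymbol x)\,d\boldsymbol x-\frac1N\sum_{n=0}^{N-1}f(\boldsymbol x_n)\bigr|: f\in\mathring{\mathbf B}^s_{p,\theta},\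 \|f\|_{\mathbf B^s_{p,\theta}}\le1\bigr\}$. *)

(* Defs.v *)
From HB Require Import structures.
From mathcomp Require Import all_boot all_order all_algebra.
From mathcomp Require Import all_classical all_reals all_analysis.
From mathcomp Require Import complex.
Set Implicit Arguments.
Unset Strict Implicit.
Unset Printing Implicit Defensive.
Import Order.TTheory GRing.Theory Num.Theory.
Import numFieldNormedType.Exports.
Local Open Scope classical_set_scope.
Local Open Scope ring_scope.
Local Open Scope complex_scope.

Section NumberTheory.
Variable R : realType.

Definition log2 (x : R) : R := ln x / ln 2.

Definition frac (x : R) : R := x - (Num.floor x)%:~R.

Definition dist_int (x : R) : R := inf [set `|x - m%:~R| | m in [set: int]].

Definition badly_approximable (a : R) : Prop :=
  exists2 c0 : R, 0 < c0 &
    forall k : nat, (0 < k)%N -> c0 <= k%:R * dist_int (k%:R * a).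

Definition kronecker_set (a : R) (N : nat) (n : 'I_N) : R * R :=
  (n%:R / N%:R, frac (n%:R * a)).

End NumberTheory.

Section ComplexIntegral.
Context d (T : measurableType d) (R : realType).
Variables (mu : {measure set T -> \bar R}) (D : set T).

Definition cintegral (f : T -> R[i]) : R[i] :=
  (\int[mu]_(x in D) complex.Re (f x)) +i* (\int[mu]_(x in D) complex.Im (f x)).

End ComplexIntegral.

Section UpFunction.
Variable R : realType.
Implicit Types (f g : R -> R).

Definition fourier (f : R -> R[i]) (xi : R) : R[i] :=
  cintegral (@lebesgue_measure R) setT
    (fun y => f y * (cos (2 * pi * xi * y) -i* sin (2 * pi * xi * y))).

Definition sinc (x : R) : R := if x == 0 then 1 else sin (pi * x) / (pi * x).

(* By injectivity of the Fourier transform this determines [f]; the infinite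
   product of cardinal sines is the limit of its partial products. *)
Definition up_function (f : R -> R) : Prop :=
  [/\ forall n x, derivable (derive1n n f) x 1,
      closure [set x | f x != 0] = `[-1, 1]%classic &
      forall xi : R, let F := fourier (fun x => (f x)%:C) xi in
        (fun n => \prod_(k < n) sinc (2 ^- k * xi)) @ \oo --> complex.Re F
        /\ complex.Im F = 0].

Definition Psi1 (Psi0 : R -> R) (L : nat) : R -> R :=
  derive1n L (fun x => 2 * Psi0 (2 * x) - Psi0 x).

Definition Psi (Psi0 : R -> R) (L j : nat) (x : R) : R :=
  if j is k.+1 then 2 ^+ k * Psi1 Psi0 L (2 ^+ k * x) else Psi0 x.

Definition Psi2 (Psi0 : R -> R) (L : nat) (m : nat * nat) (x : R * R) : R :=
  Psi Psi0 L m.1 x.1 * Psi Psi0 L m.2 x.2.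

End UpFunction.

Section Distributions.
Variable R : realType.
Implicit Types (phi f : R * R -> R[i]) (i : bool) (x : R * R).

(* Continuity and differentiability of complex-valued functions are stated for
   the real and imaginary parts; [false] and [true] name the two variables. *)
Definition ccontinuous phi : Prop :=
  continuous (fun x => complex.Re (phi x)) /\ continuous (fun x => complex.Im (phi x)).

Definition coord i x : R := if i then x.2 else x.1.

Definition slice i phi x (t : R) : R[i] :=
  phi (if i then (x.1, t) else (t, x.2)).

Definition pderivable i phi x : Prop :=
  derivable (fun t => complex.Re (slice i phi x t)) (coord i x) 1 /\
  derivable (fun t => complex.Im (slice i phi x t)) (coord i x) 1.

Definition pderive i phi x : R[i] :=
  derive1 (fun t => complex.Re (slice i phi x t)) (coord i x) +i*
  derive1 (fun t => complex.Im (slice i phi x t)) (coord i x).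

Definition pderives (w : seq bool) phi : R * R -> R[i] := foldr pderive phi w.

Definition smooth phi : Prop :=
  forall w, ccontinuous (pderives w phi) /\
            forall i x, pderivable i (pderives w phi) x.

Definition supp phi : set (R * R) := closure [set x | phi x != 0].

Definition test_function phi : Prop := smooth phi /\ compact (supp phi).

Definition weighted_derive (k l : nat) (w : seq bool) phi x : R :=
  Normc.normc ((x.1 ^+ k * x.2 ^+ l)%:C * pderives w phi x).

Definition schwartz phi : Prop :=
  smooth phi /\
  forall k l w, exists M : R, forall x, weighted_derive k l w phi x <= M.

(* A tempered distribution is represented by a functional on all functions;
   only its values on Schwartz functions are meaningful. *)
Definition distribution : Type := (R * R -> R[i]) -> R[i].
Implicit Type T : distribution.

Definition tempered T : Prop :=
  (forall (a : R[i]) phi psi, schwartz phi -> schwartz psi ->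
     T (fun x => a * phi x + psi x) = a * T phi + T psi) /\
  (exists (n : nat) (C : R), forall phi (M : R), schwartz phi ->
     (forall k l w x, (k <= n)%N -> (l <= n)%N -> (size w <= n)%N ->
        weighted_derive k l w phi x <= M) ->
     Normc.normc (T phi) <= C * M).

Definition vanishes_on T (U : set (R * R)) : Prop :=
  forall phi, test_function phi -> supp phi `<=` U -> T phi = 0.

Definition dsupp T : set (R * R) :=
  ~` \bigcup_(U in [set U | open U /\ vanishes_on T U]) U.

Definition leb2 :
    {measure set (measurableTypeR R * measurableTypeR R) -> \bar R} :=
  (@lebesgue_measure R \x @lebesgue_measure R)%E.

(* [T] is the regular distribution of [f]; as test functions are dense in the
   Schwartz space, this determines the tempered distribution [T]. *)
Definition represents f T : Prop :=
  forall phi, test_function phi ->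
    T phi = cintegral leb2 setT (fun x => f x * phi x).

Definition convolution (psi : R * R -> R) T (x : R * R) : R[i] :=
  T (fun y => (psi (x - y))%:C).

End Distributions.
Arguments leb2 : clear implicits.

Section Besov.
Variables (R : realType) (Psi0 : R -> R) (L : nat).
Variables (s : R) (p theta : \bar R).

Definition block_norm (T : distribution R) (m : nat * nat) : \bar R :=
  Lnorm (leb2 R) p
    (fun x => (Normc.normc (convolution (Psi2 Psi0 L m) T x))%:E).

Definition besov_norm (T : distribution R) : \bar R :=
  match theta with
  | t%:E => (\esum_(m in [set: nat * nat])
               ((2 `^ (s * (m.1 + m.2)%:R * t))%:E * block_norm T m `^ t))
            `^ t^-1
  | _ => ereal_sup
      [set (2 `^ (s * (m.1 + m.2)%:R))%:E * block_norm T m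
        | m in [set: nat * nat]]
  end%E.

Definition besov : set (distribution R) :=
  [set T | tempered T /\ (besov_norm T < +oo)%E].

Definition unit_square : set (R * R) := `[0, 1] `*` `[0, 1].

Definition besov0 : set (distribution R) :=
  [set T | besov T /\ dsupp T `<=` unit_square].

(* For [s > 1/p] the elements of [besov0] are continuous functions; point
   values are those of the continuous representative. *)
Definition besov0_ball : set (R * R -> R[i]) :=
  [set f | ccontinuous f /\
     exists T, [/\ besov0 T, represents f T & (besov_norm T <= 1)%E]].

End Besov.

Section WorstCaseError.
Variable R : realType.

Definition quadrature_error (N : nat) (P : 'I_N -> R * R)
    (f : R * R -> R[i]) : R :=
  Normc.normc (cintegral (leb2 R) (@unit_square R) f
         - N%:R^-1 * \sum_(n < N) f (P n)).

Definition wce (N : nat) (P : 'I_N -> R * R) (F : set (R * R -> R[i]))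
    : \bar R :=
  ereal_sup [set (quadrature_error P f)%:E | f in F].

End WorstCaseError.

(* Main.v *)
(* As [f] vanishes outside the unit square, the quadrature error is the error over the whole lattice
   of the points (n/N, n alpha - k).

   Upper bound. There are Lam_j, of compact support and scale 2^-j, such that the partial sums of
   sum_j Lam_j * Psi_j are the dilations of one smooth function of integral 1. Hence
   f = sum_m Lam_m * (Psi_m * f), and the error is the sum over m of the integrals of G_m (Psi_m * f),
   where G_m(y) is the error for the translate of Lam_m by y. Put tau = 2^|m| / N. If tau >= 1, a
   separation argument gives |G_m| <= C tau, while the L_1-norm of G_m is at most C; if tau <= 1,
   badly approximable alpha yields a lattice basis adapted to the box 2^-m1 x 2^-m2, and the
   trapezoidal rule gives |G_m| <= C tau^(L+1). By Hoelder's inequality the term m is at most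
   C |Psi_m * f|_p times tau^(L+1) or tau^(1/p), so that with the factor 2^(-s|m|) the weights decay
   geometrically away from |m| = log N. About log N indices m matter, which gives the power
   1 - 1/theta.

   Lower bound. Let 2N <= 2^n < 4N. For each m with |m| = n at least half of the dyadic boxes of
   format 2^-m1 x 2^-m2 contain no point. The sum over all these m of one bump in each of these boxes
   vanishes at all points, has integral at least c (n + 1) and norm at most C 2^(sn) (n + 1)^(1/theta). *)

Require Import Defs.
From mathcomp Require Import all_boot all_order all_algebra.
From mathcomp Require Import all_classical all_reals all_analysis.
From mathcomp Require Import complex ring lra zify.
From mathcomp Require Import measurable_realfun ess_sup_inf.
Import Order.TTheory GRing.Theory Num.Theory.
Import numFieldNormedType.Exports.
Set Implicit Arguments.
Unset Strict Implicit.
Unset Printing Implicit Defensive.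
Local Open Scope classical_set_scope.
Local Open Scope ring_scope.



(** * Integration of continuous functions of compact support *)

(** Rescaling a box of format [2^-m1 x 2^-m2] to the unit square turns the point lattice into one of
    covolume [tau]. Bad approximability provides a basis whose two vectors both have length of order
    [sqrt tau], so a trapezoidal rule of order [2 (L + 1)] gains [tau^(L+1)]; against the factor
    [2^(-s|m|)] this decays because [s < L + 1]. For [tau >= 1] there is no such gain: interpolation
    between the sup bound and the L_1 bound of [G_m] yields [tau^(1/p)], and [s > 1/p] makes it
    decay.

    Hoelder's inequality is replaced throughout by splitting at a threshold, which costs a factor 2
    and avoids conjugate exponents.

    The expansion of [f] is never summed to infinity: its partial sums are smoothed copies of [f]
    with the same integral, and they converge at the finitely many lattice points involved.

    The analysis takes place on real continuous functions of compact support, where integrability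
    and Fubini are automatic. The distribution enters only through its values on tensor products of
    smooth functions, and real and imaginary parts are treated separately. *)

Section Integral1.
Variable R : realType.
Implicit Types f g h F : R -> R.

Definition I1 f : R := \int[@lebesgue_measure R]_x f x.

Definition bsupp (A : R) f := forall x, A < `|x| -> f x = 0.

(** The class in which all integrands are kept: it is stable under the operations used below and
    makes integrability automatic. *)
Definition cc f := continuous f /\ exists A, bsupp A f.

Lemma bsuppW A B f : A <= B -> bsupp A f -> bsupp B f.
Proof. by move=> AB h x Bx; apply: h; apply: le_lt_trans Bx. Qed.

Lemma cc_bsupp f : cc f -> exists2 A, 0 < A & bsupp A f.
Proof.
move=> [_ [A fA]]; exists (`|A| + 1); first by rewrite ltr_wpDl.
apply: bsuppW fA; apply: le_trans (ler_norm _) _; lra.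
Qed.

Lemma bsupp_restrict A f : bsupp A f -> f \_ `[- A, A] = f.
Proof.
move=> fA; apply/funext => x; rewrite patchE; case: ifPn => //.
rewrite notin_setE /= in_itv /= => /negP; rewrite -ler_norml -ltNge => /fA.
by [].
Qed.

Lemma cc_integrable f : cc f -> (@lebesgue_measure R).-integrable setT (EFin \o f).
Proof.
move=> cf; have [A A0 fA] := cc_bsupp cf; case: cf => cf _.
rewrite -(bsupp_restrict fA) -restrict_EFin.
apply: (iffLR (integrable_mkcond _ _)) => //=.
apply: continuous_compact_integrable; first exact: segment_compact.
exact: continuous_subspaceT.
Qed.

Lemma I1_itv A f : bsupp A f -> I1 f = \int[@lebesgue_measure R]_(x in `[- A, A]) f x.
Proof. by move=> fA; rewrite [RHS]Rintegral_mkcond (bsupp_restrict fA). Qed.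

Lemma I1_FTC A f F : continuous f -> bsupp A f -> 0 < A ->
  (forall x, is_derive x (1 : R) F (f x)) -> I1 f = F A - F (- A).
Proof.
move=> cf fA A0 dF; rewrite (I1_itv fA) /Rintegral.
have dF' : forall x, derivable F x (1 : R) by move=> x; have [] := dF x.
have cF : continuous F.
  by move=> x; apply: differentiable_continuous; exact/derivable1_diffP.
rewrite (@continuous_FTC2 _ f F) //.
- lra.
- exact: continuous_subspaceT.
- split; first by move=> x _.
  + exact/cvg_at_right_filter/cF.
  + exact/cvg_at_left_filter/cF.
- by move=> x _; rewrite derive1E; apply: derive_val.
Qed.

Lemma eq_I1 f g : f =1 g -> I1 f = I1 g.
Proof. by move=> /funext ->. Qed.

Lemma bsupp_add A f g : bsupp A f -> bsupp A g -> bsupp A (fun x => f x + g x).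
Proof. by move=> fA gA x Ax; rewrite fA // gA // addr0. Qed.

Lemma ccD f g : cc f -> cc g -> cc (fun x => f x + g x).
Proof.
move=> ccf ccg; have [A A0 fA] := cc_bsupp ccf; have [B B0 gB] := cc_bsupp ccg.
split; first by move=> x; apply: cvgD; [exact: ccf.1|exact: ccg.1].
exists (A + B); apply: bsupp_add; [apply: bsuppW fA|apply: bsuppW gB]; lra.
Qed.

Lemma ccM f g : continuous f -> cc g -> cc (fun x => f x * g x).
Proof.
move=> cf [cg [A gA]]; split; first by move=> x; apply: cvgM; [exact: cf|exact: cg].
by exists A => x /gA ->; rewrite mulr0.
Qed.

Lemma ccZ r f : cc f -> cc (fun x => r * f x).
Proof. by move=> cf; apply: ccM => // x; exact: cvg_cst. Qed.

Lemma ccN f : cc f -> cc (fun x => - f x).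
Proof.
move=> [cf [A fA]]; split; first by move=> x; apply: cvgN; exact: cf.
by exists A => x /fA ->; rewrite oppr0.
Qed.

Lemma ccB f g : cc f -> cc g -> cc (fun x => f x - g x).
Proof. by move=> cf cg; exact: (ccD cf (ccN cg)). Qed.

Lemma cc0 : cc (fun=> 0 : R).
Proof. by split; [move=> x; exact: cvg_cst|exists 0]. Qed.

Lemma cc_norm f : cc f -> cc (fun x => `|f x|).
Proof.
move=> [cf [A fA]]; split; first by move=> x; apply: cvg_norm; exact: cf.
by exists A => x /fA ->; rewrite normr0.
Qed.

Lemma cc_sum (T : Type) (s : seq T) (F : T -> R -> R) :
  (forall i, cc (F i)) -> cc (fun x => \sum_(i <- s) F i x).
Proof.
move=> cF; elim: s => [|i s IH].
  by under eq_fun do rewrite big_nil; exact: cc0.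
by under eq_fun do rewrite big_cons; exact: ccD.
Qed.

Lemma I1D f g : cc f -> cc g -> I1 (fun x => f x + g x) = I1 f + I1 g.
Proof. by move=> cf cg; rewrite /I1 RintegralD //; exact: cc_integrable. Qed.

Lemma I1Z r f : cc f -> I1 (fun x => r * f x) = r * I1 f.
Proof. by move=> cf; rewrite /I1 RintegralZl //; exact: cc_integrable. Qed.

Lemma I1Zr r f : cc f -> I1 (fun x => f x * r) = I1 f * r.
Proof. by move=> cf; rewrite mulrC -I1Z //; apply: eq_I1 => x; rewrite mulrC. Qed.

Lemma I1N f : cc f -> I1 (fun x => - f x) = - I1 f.
Proof. by move=> cf; rewrite -mulN1r -I1Z //; apply: eq_I1 => x; rewrite mulN1r. Qed.

Lemma I1B f g : cc f -> cc g -> I1 (fun x => f x - g x) = I1 f - I1 g.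
Proof. by move=> cf cg; rewrite (I1D cf (ccN cg)) I1N. Qed.

Lemma I10 : I1 (fun=> 0) = 0.
Proof. transitivity (I1 (fun=> 0 * 0)); first by apply: eq_I1 => x; rewrite mul0r.
by rewrite I1Z ?mul0r //; exact: cc0. Qed.

Lemma I1_sum (T : Type) (s : seq T) (F : T -> R -> R) :
  (forall i, cc (F i)) -> I1 (fun x => \sum_(i <- s) F i x) = \sum_(i <- s) I1 (F i).
Proof.
move=> cF; elim: s => [|i s IH].
  by under eq_I1 do rewrite big_nil; rewrite big_nil I10.
under eq_I1 do rewrite big_cons.
by rewrite I1D ?IH ?big_cons //; exact: cc_sum.
Qed.

Lemma le_I1 f g : cc f -> cc g -> (forall x, f x <= g x) -> I1 f <= I1 g.
Proof. by move=> cf cg fg; apply: le_Rintegral => //; exact: cc_integrable. Qed.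

Lemma I1_ge0 f : (forall x, 0 <= f x) -> 0 <= I1 f.
Proof. by move=> f0; apply: Rintegral_ge0 => x _; exact: f0. Qed.

Lemma I1_norm f : cc f -> `|I1 f| <= I1 (fun x => `|f x|).
Proof. by move=> cf; apply: le_normr_Rintegral => //; exact: cc_integrable. Qed.

Lemma I1_bound f (a b M : R) : a <= b -> cc f ->
  (forall x, x < a -> f x = 0) -> (forall x, b < x -> f x = 0) ->
  (forall x, `|f x| <= M) -> `|I1 f| <= M * (b - a).
Proof.
move=> ab cf fa fb fM.
have fE : f \_ `[a, b] = f.
  apply/funext => x; rewrite patchE; case: ifPn => //.
  rewrite notin_setE /= in_itv /= => /negP; rewrite negb_and -!ltNge.
  by move=> /orP[/fa|/fb].
have intf := cc_integrable cf.
have -> : I1 f = \int[@lebesgue_measure R]_(x in `[a, b]) f x.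
  by rewrite [RHS]Rintegral_mkcond fE.
have intf' : (@lebesgue_measure R).-integrable `[a, b] (EFin \o f).
  by apply: integrableS intf.
apply: le_trans (le_normr_Rintegral _ _) _ => //.
apply: (@le_trans _ _ (\int[@lebesgue_measure R]_(x in `[a, b]) M)).
  apply: le_Rintegral => //.
  + have /= := integrable_abse intf'; apply: eq_integrable => //.
  + apply: measurable_bounded_integrable => //.
    * exact: (compact_finite_measure (@segment_compact R a b)).
    * exists M; split; first exact: num_real.
      move=> y My z _ /=.
      apply: ltW; apply: le_lt_trans My. by rewrite ger0_norm //; apply: le_trans (fM 0).
have -> : \int[@lebesgue_measure R]_(x in `[a, b]) M = M * fine (@lebesgue_measure R `[a, b]%classic).
  by rewrite -Rintegral_cst.
have -> : @lebesgue_measure R `[a, b]%classic = if (a%:E < b%:E)%E then (b%:E - a%:E)%E else 0%E.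
  exact: (@lebesgue_measure_itv R `[a, b]).
rewrite lte_fin; case: ltP => //= ba.
have -> : a = b by apply/le_anti; rewrite ab ba.
by rewrite subrr.
Qed.

Lemma cc_bounded f : cc f -> exists2 M, 0 < M & forall x, `|f x| <= M.
Proof.
move=> cf; have [A A0 fA] := cc_bsupp cf.
have := @continuous_compact _ _ f `[-A, A] (continuous_subspaceT cf.1) (@segment_compact R _ _).
move=> /compact_bounded [M [_ HM]].
exists (`|M| + 1); first by rewrite ltr_wpDl.
move=> x; case: (ltP A `|x|) => [/fA ->|xA].
  by rewrite normr0 addr_ge0.
apply: HM; last by exists x => //=; rewrite in_itv /= -ler_norml.
by apply: le_lt_trans (ler_norm _) _; rewrite ltrDl.
Qed.

Lemma antiderivative f : cc f -> exists F, forall x, is_derive x (1 : R) F (f x).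
Proof.
move=> cf; exists (fun x => \int[@lebesgue_measure R]_(t in [set` `]-oo, x]]) f t) => x.
have x1 : x < x + 1 by lra.
have ix : (@lebesgue_measure R).-integrable [set` `]-oo, x + 1]] (EFin \o f).
  by apply: integrableS (cc_integrable cf).
have [d1 d2] := continuous_FTC1 x1 ix (ltNyr _) (cf.1 x).
by apply: (DeriveDef d1); rewrite -derive1E.
Qed.

Lemma antiderivative_const A f F : bsupp A f -> 0 < A ->
  (forall x, is_derive x (1 : R) F (f x)) ->
  (forall y, A <= y -> F y = F A) /\ (forall y, y <= - A -> F y = F (- A)).
Proof.
move=> fA A0 dF.
have cF u v : {within `[u, v], continuous F}.
  apply: continuous_subspaceT => z; apply: differentiable_continuous.
  by apply/derivable1_diffP; have [] := dF z.
split=> y; rewrite le_eqVlt => /orP[/eqP -> //|Ay].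
  have [c] := MVT Ay (fun x _ => dF x) (cF _ _).
  rewrite in_itv /= => /andP[Ac cy]; rewrite fA ?mul0r.
    by move/eqP; rewrite subr_eq0 => /eqP.
  by rewrite gtr0_norm ?(lt_trans A0).
have [c] := MVT Ay (fun x _ => dF x) (cF _ _).
rewrite in_itv /= => /andP[Ac cy]; rewrite fA ?mul0r.
  by move/eqP; rewrite subr_eq0 => /eqP ->.
by rewrite ltr0_norm; lra.
Qed.

(** Substitution by way of an antiderivative [F] of [f]: [F (a x + b) / a] is one of the new
    integrand, and [F] is constant on either side of the support. [B] is so large that [a B + b] and
    [- a B + b] lie beyond [A] and [- A], in the order given by the sign of [a]. *)
Lemma I1_affine a b f : a != 0 -> cc f -> I1 (fun x => f (a * x + b)) = `|a|^-1 * I1 f.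
Proof.
move=> a0 cf; have [A A0 fA] := cc_bsupp cf; have [F dF] := antiderivative cf.
have aff : continuous (fun x : R => a * x + b).
  by move=> x; apply: cvgD; [apply: cvgM; [exact: cvg_cst|exact: cvg_id]|exact: cvg_cst].
have cfa : continuous (fun x => f (a * x + b)).
  by move=> x; apply: (@continuous_comp _ _ _ (fun x : R => a * x + b) f); [exact: aff|exact: cf.1].
pose B := (A + `|b|) / `|a| + 1.
have a0' : 0 < `|a| by rewrite normr_gt0.
have B0 : 0 < B by rewrite ltr_wpDl // divr_ge0 //; apply: addr_ge0 => //; lra.
have aB : A + `|b| < `|a| * B.
  by rewrite /B mulrDr mulrCA divff ?gt_eqF // !mulr1 ltrDl.
have sB : bsupp B (fun x => f (a * x + b)).
  move=> x Bx; apply: fA.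
  have : `|a * x| - `|b| <= `|a * x + b|.
    by rewrite lerBlDr -[X in `|X| <= _](addrK b) (le_trans (ler_normB _ _)).
  apply: lt_le_trans; rewrite ltrBrDr normrM (lt_trans aB) // ltr_pM2l //.
have dG x : is_derive x (1 : R) (fun x => a^-1 * F (a * x + b)) (f (a * x + b)).
  have -> : f (a * x + b) = a^-1 *: (a * f (a * x + b)).
    by rewrite /GRing.scale /= mulrA mulVf // mul1r.
  apply: (@is_deriveZ _ _ _ (fun x => F (a * x + b))).
  have h1 : is_derive x 1 (fun x : R => a * x + b) a.
    apply: is_derive_eq; rewrite addr0 /GRing.scale /=; by rewrite ?mulr1 ?mulr0 ?addr0.
  rewrite mulrC; exact: (@is_derive1_comp R F (fun x : R => a * x + b) x _ _ (dF _) h1).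
rewrite (I1_FTC cfa sB B0 dG) -mulrBr.
have [FC FC'] := antiderivative_const fA A0 dF.
rewrite (I1_FTC cf.1 fA A0 dF).
have bb := ler_norm b; have bb' := ler_norm (- b); rewrite normrN in bb'.
case: (ltgtP a 0) a0 => // [a_lt0|a_gt0] _.
- rewrite (ltr0_norm a_lt0) in aB *.
  rewrite (FC' (a * B + b)); last by lra.
  rewrite (FC (a * - B + b)); last by lra.
  rewrite invrN mulNr -mulrN opprB //.
- rewrite (gtr0_norm a_gt0) in aB *.
  rewrite (FC (a * B + b)); last by lra.
  by rewrite (FC' (a * - B + b)); last by lra.
Qed.

End Integral1.

(** * Integrals with a parameter, measurability and Fubini in the plane *)

Section Integral2.
Variable R : realType.
Implicit Types f g : R -> R.
Implicit Types h k : R -> R -> R.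

(** By compactness of [[- B, B]], joint continuity becomes uniform in the integration variable near
    [u0]. A deviation below [d = e / (4 B)] on an interval of length [2 B] changes the integral by
    at most [e / 2]. *)
Lemma I1_param_continuous (U : topologicalType) (H : U -> R -> R) (A : R) :
  continuous (fun z : U * R => H z.1 z.2) -> (forall u, bsupp A (H u)) ->
  continuous (fun u => I1 (H u)).
Proof.
move=> cH sH u0.
pose B := `|A| + 1.
have B0 : 0 < B by rewrite ltr_wpDl.
have sB u : bsupp B (H u).
  apply: bsuppW (sH u); rewrite /B; apply: le_trans (ler_norm A) _; lra.
have cHu u : continuous (H u).
  by move=> t; have := @continuous2_cvg _ _ _ _ (nbhs t) _ (fun=> u) id H u t (cH (u, t)) (cvg_cst u) cvg_id; exact.
have ccH u : cc (H u) by split; [exact: cHu|exists B].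
apply/cvgrPdist_lt => e e0.
pose d := e / (4 * B).
have d0 : 0 < d by rewrite divr_gt0 // mulr_gt0.
have cov : \forall u \near u0, `[- B, B] `<=` (fun t => `|H u0 t - H u t| < d).
  apply: (iffLR (compact_near_coveringP _) (@segment_compact R _ _)).
  move=> t _.
  have /cvgrPdist_lt/(_ (d / 2)) h1 := cH (u0, t).
  have /cvgrPdist_lt/(_ (d / 2)) h2 := cHu u0 t.
  have d20 : 0 < d / 2 by rewrite divr_gt0.
  have [[P Q] /= [nP nQ] PQ] := h1 d20.
  exists (Q `&` [set t' | `|H u0 t - H u0 t'| < d / 2], P) => /=.
    by split => //; apply: filterI => //; exact: h2.
  move=> -[t' u] /= [[Qt' {}h2] Pu]; have {}h1 := PQ (u, t') (conj Pu Qt').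
  have -> : H u0 t' - H u t' = (H u0 t - H u t') - (H u0 t - H u0 t') by ring.
  by apply: le_lt_trans (ler_normB _ _) _; rewrite [ltRHS](splitr d); exact: ltrD.
near=> u.
have covu t : `|t| <= B -> `|H u0 t - H u t| < d.
  by move=> tB; have : `[- B, B] `<=` (fun t => `|H u0 t - H u t| < d); [by near: u|apply; rewrite /= in_itv /= -ler_norml].
rewrite -I1B //.
apply: (@le_lt_trans _ _ (d * (B - - B))).
  apply: I1_bound => //.
  - lra.
  - exact: ccB.
  - by move=> x xB; rewrite !sB ?subrr // ltr0_norm; lra.
  - by move=> x xB; rewrite !sB ?subrr // gtr0_norm; lra.
  - move=> t; case: (leP `|t| B) => [tB|Bt].
      exact/ltW/covu.
    by rewrite !sB // subrr normr0 ltW.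
rewrite /d (_ : _ * _ = e / 2); last by field; rewrite gt_eqF.
lra.
Unshelve. all: by end_near. Qed.

(** The sigma-algebra here is the product one, so open sets of the plane must be shown measurable:
    each is the countable union of the rational squares that it contains. *)
Lemma cont2_measurable (F : R * R -> R) : continuous F ->
  measurable_fun (setT : set (measurableTypeR R * measurableTypeR R)) (F : measurableTypeR R * measurableTypeR R -> R).
Proof.
move=> cF.
have openM (U : set (R * R)) : open U -> measurable (U : set (measurableTypeR R * measurableTypeR R)).
  move=> oU.
  pose G (q : rat * rat * rat) : set (R * R) :=
    let B := ball (ratr q.1.1 : R) (ratr q.2 : R) `*` ball (ratr q.1.2 : R) (ratr q.2 : R) in
    if `[< B `<=` U >] then B else set0.
  have -> : U = \bigcup_q G q.
    apply/seteqP; split => [[x y] Uxy|z [q _]]; last first.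
      by rewrite /G; case: asboolP => // qU /qU.
    have /nbhs_ballP[e /= e0 eU] : nbhs (x, y) U by exact: open_nbhs_nbhs.
    have /rat_in_itvoo[r] : 0 < e / 2 by rewrite divr_gt0.
    rewrite in_itv /= => /andP[r0 re].
    have near_rat (t : R) : exists q : rat, `|ratr q - t| < ratr r.
      have /rat_in_itvoo[q] : t - ratr r < t + ratr r by lra.
      by rewrite in_itv /= => /andP[? ?]; exists q; rewrite ltr_norml; apply/andP; split; lra.
    have [q1 q1x] := near_rat x; have [q2 q2y] := near_rat y.
    have tri (a : rat) (b t : R) : `|ratr a - t| < ratr r -> `|ratr a - b| < ratr r -> `|t - b| < e.
      rewrite !ltr_norml => /andP[? ?] /andP[? ?]; apply/andP; split; lra.
    exists (q1, q2, r) => //; rewrite /G /=; case: asboolP => [_ //|[]].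
    move=> [a b] [/= ha hb]; apply: eU; split => /=; rewrite /ball /=.
    - exact: (tri q1).
    - exact: (tri q2).
  apply: countable_bigcupT_measurable; first exact: countableP.
  move=> q; rewrite /G /=; case: ifP => // _.
  by apply: measurableX; exact: measurable_ball.
apply: (measurability _ (RGenOInfty.measurableE R)).
move=> /= _ [_ [a ->]] <-; apply: measurableI; first exact: measurableT.
apply: openM; apply: open_comp; first by move=> x _; exact: cF.
exact: interval_open.
Qed.

Definition bsupp2 (A : R) h := forall x y, (A < `|x|) || (A < `|y|) -> h x y = 0.

Definition cont2 h := continuous (fun z : R * R => h z.1 z.2).

Definition cc2 h := cont2 h /\ exists A, bsupp2 A h.

Lemma cc2_bsupp h : cc2 h -> exists2 A, 0 < A & bsupp2 A h.
Proof.
move=> [_ [A hA]]; exists (`|A| + 1); first by rewrite ltr_wpDl.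
move=> x y xy; apply: hA; have := ler_norm A.
by move=> ?; case/orP: xy => ?; apply/orP; [left|right]; lra.
Qed.

Lemma cont2_comp (T : topologicalType) h (u v : T -> R) :
  cont2 h -> continuous u -> continuous v -> continuous (fun t => h (u t) (v t)).
Proof.
move=> ch cu cv t.
have := @continuous2_cvg _ _ _ _ (nbhs t) _ u v h (u t) (v t) (ch (u t, v t)) (cu t) (cv t); exact.
Qed.

Lemma continuous_fstR : continuous (fun z : R * R => z.1).
Proof. by move=> z; exact: cvg_fst. Qed.

Lemma continuous_sndR : continuous (fun z : R * R => z.2).
Proof. by move=> z; exact: cvg_snd. Qed.

Lemma cont2_swap h : cont2 h -> cont2 (fun x y => h y x).
Proof. by move=> ch; apply: (cont2_comp ch); [exact: continuous_sndR|exact: continuous_fstR]. Qed.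

Lemma cont2_l h x : cont2 h -> continuous (h x).
Proof. by move=> ch; apply: (cont2_comp ch) => t; [exact: cvg_cst|exact: cvg_id]. Qed.

Lemma cont2_r h y : cont2 h -> continuous (h^~ y).
Proof. by move=> /cont2_swap /cont2_l; exact. Qed.

Lemma cc2_swap h : cc2 h -> cc2 (fun x y => h y x).
Proof. by move=> [ch [A hA]]; split; [exact: cont2_swap|exists A => x y; rewrite orbC; exact: hA]. Qed.

Lemma cc2_l h x : cc2 h -> cc (h x).
Proof. by move=> [ch [A hA]]; split; [exact: cont2_l|exists A => y Ay; rewrite hA // Ay orbT]. Qed.

Lemma cc2_r h y : cc2 h -> cc (h^~ y).
Proof. by move=> /cc2_swap /cc2_l; exact. Qed.

Lemma cc2_I1 h : cc2 h -> cc (fun x => I1 (h x)).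
Proof.
move=> [ch [A hA]]; split.
  by apply: (@I1_param_continuous _ _ A ch) => x y Ay; rewrite hA // Ay orbT.
by exists A => x Ax; rewrite -[RHS](I10 R); apply: eq_I1 => y; rewrite hA // Ax.
Qed.

Lemma cc2M h k : cont2 h -> cc2 k -> cc2 (fun x y => h x y * k x y).
Proof.
move=> ch [ck [A kA]]; split; first by move=> z; apply: cvgM; [exact: ch|exact: ck].
by exists A => x y /kA ->; rewrite mulr0.
Qed.

Lemma cc2D h k : cc2 h -> cc2 k -> cc2 (fun x y => h x y + k x y).
Proof.
move=> cch cck; have [A A0 hA] := cc2_bsupp cch; have [B B0 kB] := cc2_bsupp cck.
split; first by move=> z; apply: cvgD; [exact: cch.1|exact: cck.1].
by exists (A + B) => x y xy; rewrite hA ?kB ?addr0 //; case/orP: xy => ?; apply/orP; ((left; lra) || (right; lra)).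
Qed.

Lemma cc2_norm h : cc2 h -> cc2 (fun x y => `|h x y|).
Proof.
move=> [ch [A hA]]; split; first by move=> z; apply: cvg_norm; exact: ch.
by exists A => x y /hA ->; rewrite normr0.
Qed.

Lemma cc2_tensor f g : cc f -> cc g -> cc2 (fun x y => f x * g y).
Proof.
move=> ccf ccg; have [A A0 fA] := cc_bsupp ccf; have [B B0 gB] := cc_bsupp ccg.
split.
  move=> z; apply: cvgM.
    by apply: (@continuous_comp _ _ _ (fun z : R * R => z.1) f); [exact: cvg_fst|exact: ccf.1].
  by apply: (@continuous_comp _ _ _ (fun z : R * R => z.2) g); [exact: cvg_snd|exact: ccg.1].
exists (A + B) => x y /orP[?|?]; [rewrite fA ?mul0r //|rewrite gB ?mulr0 //]; lra.
Qed.

Lemma cc2_bounded h : cc2 h -> exists2 M, 0 < M & forall x y, `|h x y| <= M.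
Proof.
move=> ch; have [A A0 hA] := cc2_bsupp ch.
have cK : compact (`[- A, A] `*` `[- A, A] : set (R * R)).
  by apply: compact_setX; exact: segment_compact.
have := @continuous_compact _ _ (fun z : R * R => h z.1 z.2) _ (continuous_subspaceT ch.1) cK.
move=> /compact_bounded [M [_ HM]].
exists (`|M| + 1); first by rewrite ltr_wpDl.
move=> x y; case: (boolP ((A < `|x|) || (A < `|y|))) => [/hA ->|].
  by rewrite normr0 addr_ge0.
rewrite negb_or -!leNgt => /andP[xA yA].
apply: HM; first by apply: le_lt_trans (ler_norm _) _; rewrite ltrDl.
by exists (x, y) => //=; split; rewrite /= in_itv /= -ler_norml.
Qed.

Definition I2 h : R := I1 (fun x => I1 (h x)).

Lemma cc2_integrable h : cc2 h -> (leb2 R).-integrable setT (fun z => (h z.1 z.2)%:E).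
Proof.
move=> cch; have [A A0 hA] := cc2_bsupp cch.
have [M M0 hM] := cc2_bounded cch.
have mf := cont2_measurable cch.1.
pose K : set (measurableTypeR R * measurableTypeR R) := `[- A, A] `*` `[- A, A].
have mK : measurable K by apply: measurableX.
have -> : (fun z : measurableTypeR R * measurableTypeR R => (h z.1 z.2)%:E) = (fun z => (h z.1 z.2)%:E) \_ K.
  apply/funext => -[x y]; rewrite patchE; case: ifPn => //.
  rewrite notin_setE /= => /not_andP /=; rewrite !in_itv /= -!ler_norml => xy.
  rewrite hA //; apply/orP; case: xy => /negP; rewrite -ltNge; [by left|by right].
apply: (iffLR (integrable_mkcond _ _)) => //=.
apply: measurable_bounded_integrable => //.
- have -> : leb2 R K = (@lebesgue_measure R `[(- A)%R, A]%classic * @lebesgue_measure R `[(- A)%R, A]%classic)%E.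
    by rewrite -(@product_measure1E _ _ _ _ _ (@lebesgue_measure R) (@lebesgue_measure R)).
  have fin : (@lebesgue_measure R `[(- A)%R, A]%classic < +oo)%E by exact: (compact_finite_measure (@segment_compact R _ _)).
  by rewrite lte_mul_pinfty // ge0_fin_numE.
- exact: measurable_funTS.
- exists M; split; first exact: num_real.
  move=> y My z _ /=; apply: ltW; apply: le_lt_trans (hM _ _) My.
Qed.

Lemma I2_leb2 h : cc2 h -> \int[leb2 R]_z h z.1 z.2 = I2 h.
Proof.
move=> cch; rewrite /Rintegral /I2 -(integral12_prod_meas1 (cc2_integrable cch)).
congr fine; apply: eq_integral => x _; rewrite /fubini_F /= /I1 /Rintegral fineK //.
have /= := integrable_fin_num _ (cc_integrable (cc2_l x cch)); exact.
Qed.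

Lemma I2_swap h : cc2 h -> I2 h = I2 (fun x y => h y x).
Proof.
move=> cch; rewrite -I2_leb2 // /Rintegral -(integral21_prod_meas1 (cc2_integrable cch)).
congr fine; apply: eq_integral => x _; rewrite /fubini_G /= /I1 /Rintegral fineK //.
have /= := integrable_fin_num _ (cc_integrable (cc2_r x cch)); exact.
Qed.

End Integral2.

(** * Smooth functions, convolution and the reproducing formula *)

Section Smooth.
Variable R : realType.
Implicit Types f g h : R -> R.

Lemma continuous_compR (T : topologicalType) f (u : T -> R) :
  continuous f -> continuous u -> continuous (fun t => f (u t)).
Proof. by move=> cf cu t; exact: (@continuous_comp _ _ _ u f _ (cu t) (cf _)). Qed.

Lemma continuous_aff (a b : R) : continuous (fun x : R => a * x + b).
Proof.
by move=> x; apply: cvgD; [apply: cvgM; [exact: cvg_cst|exact: cvg_id]|exact: cvg_cst].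
Qed.

Lemma cc_affine a b f : a != 0 -> cc f -> cc (fun x => f (a * x + b)).
Proof.
move=> a0 ccf; have [A A0 fA] := cc_bsupp ccf.
split; first by apply: continuous_compR; [exact: ccf.1|exact: continuous_aff].
exists ((A + `|b|) / `|a|) => x; rewrite ltr_pdivrMr ?normr_gt0 // => h.
apply: fA; rewrite -(ltrD2r `|b|); apply: lt_le_trans h _.
by rewrite mulrC -normrM -[X in `|X| <= _](addrK b) ler_normB.
Qed.

Definition sm f := forall n (x : R), derivable (derive1n n f) x 1.

(** Smoothness by coinduction: a class of differentiable functions closed under derivation consists
    of smooth functions. It spares closed formulas for higher derivatives of sums, dilates and
    convolutions. *)
Lemma sm_coind (P : (R -> R) -> Prop) :
  (forall f, P f -> (forall x : R, derivable f x 1) /\ P (derive1 f)) ->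
  forall f, P f -> sm f.
Proof.
move=> H f Pf n.
have Pn : P (derive1n n f) by elim: n => // n IH; rewrite derive1nS; exact: (H _ IH).2.
exact: (H _ Pn).1.
Qed.

Lemma sm_derive f : sm f -> sm (derive1 f).
Proof. by move=> sf n; rewrite -derive1Sn; exact: sf. Qed.

Lemma sm_derivable f (x : R) : sm f -> derivable f x 1.
Proof. by move=> /(_ 0). Qed.

Lemma sm_is_derive f (x : R) : sm f -> is_derive x (1 : R) f ((derive1 f) x).
Proof. by move=> sf; apply: DeriveDef; [exact: sm_derivable|rewrite derive1E]. Qed.

Lemma is_derive_derive1 f (x l : R) : is_derive x (1 : R) f l -> (derive1 f) x = l.
Proof. by move=> [_ <-]; rewrite derive1E. Qed.

Lemma derivable_cont f : (forall x : R, derivable f x 1) -> continuous f.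
Proof. by move=> df x; apply: differentiable_continuous; exact/derivable1_diffP. Qed.

Lemma sm_continuous f : sm f -> continuous f.
Proof. by move=> sf; apply: derivable_cont => x; exact: sm_derivable. Qed.

Lemma sm_intro f f' : (forall x, is_derive x (1 : R) f (f' x)) -> sm f' -> sm f.
Proof.
move=> df sf'.
have E : (derive1 f) = f' by apply/funext => x; exact: is_derive_derive1.
move=> [x|n]; first by have [] := df x.
by rewrite derive1Sn E; exact: sf'.
Qed.

Lemma is_derive_affine f (a b x l : R) : is_derive (a * x + b) (1 : R) f l ->
  is_derive x (1 : R) (fun x => f (a * x + b)) (a * l).
Proof.
move=> h.
have h1 : is_derive x (1 : R) (fun x : R => a * x + b) a.
  by apply: is_derive_eq; rewrite addr0 /GRing.scale /= ?mulr1 ?mulr0 ?addr0.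
by rewrite mulrC; exact: (@is_derive1_comp R f (fun x : R => a * x + b) x _ _ h h1).
Qed.

Lemma is_deriveDR f g (x a b : R) : is_derive x (1 : R) f a -> is_derive x (1 : R) g b ->
  is_derive x (1 : R) (fun x => f x + g x) (a + b).
Proof. by move=> h1 h2; exact: (is_deriveD h1 h2). Qed.

Lemma is_deriveZR f (c x a : R) : is_derive x (1 : R) f a ->
  is_derive x (1 : R) (fun x => c * f x) (c * a).
Proof. by move=> h1; exact: (is_deriveZ c h1). Qed.

Lemma is_deriveMR f g (x a b : R) : is_derive x (1 : R) f a -> is_derive x (1 : R) g b ->
  is_derive x (1 : R) (fun x => f x * g x) (a * g x + f x * b).
Proof.
move=> h1 h2; have := is_deriveM h1 h2; rewrite /GRing.scale /=.
by have -> : a * g x + f x * b = f x * b + g x * a by ring.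
Qed.

Lemma smD f g : sm f -> sm g -> sm (fun x => f x + g x).
Proof.
move=> sf sg.
apply: (@sm_coind (fun h => exists f g, [/\ sm f, sm g & h = fun x => f x + g x])); last by exists f, g.
move=> _ [f' [g' [sf' sg' ->]]].
have d x := is_deriveDR (sm_is_derive x sf') (sm_is_derive x sg').
split; first by move=> x; have [] := d x.
exists (derive1 f'), (derive1 g'); split; [exact: sm_derive|exact: sm_derive|].
by apply/funext => x; exact: is_derive_derive1.
Qed.

Lemma smZ c f : sm f -> sm (fun x => c * f x).
Proof.
move=> sf.
apply: (@sm_coind (fun h => exists2 f, sm f & h = fun x => c * f x)); last by exists f.
move=> _ [f' sf' ->].
have d x := is_deriveZR c (sm_is_derive x sf').
split; first by move=> x; have [] := d x.
exists (derive1 f'); first exact: sm_derive.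
by apply/funext => x; exact: is_derive_derive1.
Qed.

Lemma sm_affine a b f : sm f -> sm (fun x => f (a * x + b)).
Proof.
move=> sf.
apply: (@sm_coind (fun h => exists2 f, sm f & h = fun x => f (a * x + b))); last by exists f.
move=> _ [f' sf' ->].
have d x := is_derive_affine (sm_is_derive (a * x + b) sf').
split; first by move=> x; have [] := d x.
exists (fun x => a * (derive1 f') x); first exact/smZ/sm_derive.
by apply/funext => x; exact: is_derive_derive1.
Qed.

Definition sc f := sm f /\ exists A, bsupp A f.

Lemma sc_cc f : sc f -> cc f.
Proof. by move=> [sf bf]; split => //; exact: sm_continuous. Qed.

Lemma bsupp_is_derive A f f' : (forall x, is_derive x (1 : R) f (f' x)) ->
  bsupp A f -> bsupp A f'.
Proof.
move=> df fA x Ax.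
have fx0 : \forall y \near x, f y = 0.
  have : open [set y : R | A < `|y|].
    apply: (@open_comp _ _ (fun y : R => `|y|) [set y | A < y]).
      by move=> y _; exact: norm_continuous.
    exact: open_gt.
  move=> oA; have /= : nbhs x [set y : R | A < `|y|] by exact: open_nbhs_nbhs.
  by apply: filterS => y; exact: fA.
rewrite -(is_derive_derive1 (df x)).
apply: is_derive_derive1; apply: (@near_eq_is_derive _ _ _ (cst 0)) => //.
by apply: filterS fx0 => y ->.
Qed.

Lemma bsupp_derive A f : sm f -> bsupp A f -> bsupp A (derive1 f).
Proof. by move=> sf; apply: bsupp_is_derive => x; exact: sm_is_derive. Qed.

Lemma sc_derive f : sc f -> sc (derive1 f).
Proof. by move=> [sf [A fA]]; split; [exact: sm_derive|exists A; exact: bsupp_derive]. Qed.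

Lemma scD f g : sc f -> sc g -> sc (fun x => f x + g x).
Proof.
move=> sf sg; split; first exact: smD sf.1 sg.1.
exact: (ccD (sc_cc sf) (sc_cc sg)).2.
Qed.

Lemma scZ c f : sc f -> sc (fun x => c * f x).
Proof.
move=> sf; split; first exact: smZ sf.1.
exact: (ccZ c (sc_cc sf)).2.
Qed.

Lemma sc_affine a b f : a != 0 -> sc f -> sc (fun x => f (a * x + b)).
Proof.
move=> a0 sf; split; first exact: sm_affine sf.1.
exact: (cc_affine b a0 (sc_cc sf)).2.
Qed.

(** The constant values of an antiderivative to the left and to the right of the support differ by
    the integral; if that is 0, one subtraction makes both vanish. *)
Lemma sc_antiderivative f : sc f -> I1 f = 0 -> exists2 F, sc F & (derive1 F) = f.
Proof.
move=> sf f0; have [A A0 fA] := cc_bsupp (sc_cc sf).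
have [F0 dF0] := antiderivative (sc_cc sf).
have [FC FC'] := antiderivative_const fA A0 dF0.
pose F x := F0 x + - F0 (- A).
have dF x : is_derive x (1 : R) F (f x).
  have := is_deriveDR (dF0 x) (is_derive_cst (- F0 (- A)) x (1 : R)).
  by rewrite addr0.
exists F; last by apply/funext => x; exact: is_derive_derive1.
split; first exact: (sm_intro dF sf.1).
have FA : F0 A = F0 (- A).
  by apply/eqP; rewrite -subr_eq0 -(I1_FTC (sc_cc sf).1 fA A0 dF0) f0.
exists A => x; rewrite /F; case: (leP 0 x) => x0.
  by rewrite ger0_norm // => /ltW /FC ->; rewrite FA subrr.
by rewrite ltr0_norm // => xA; rewrite FC' ?subrr //; lra.
Qed.

End Smooth.

(** * Convolution and dilation on the line *)

Section Convolution.
Variable R : realType.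
Implicit Types f g h : R -> R.

Definition conv f g x : R := I1 (fun y => f (x - y) * g y).

Lemma cc_reflect f x : cc f -> cc (fun y => f (x - y)).
Proof.
have m1 : (-1 : R) != 0 by rewrite oppr_eq0 oner_neq0.
move=> cf; have := cc_affine x m1 cf.
by under eq_fun do rewrite mulN1r addrC.
Qed.

Lemma I1_reflect f x : cc f -> I1 (fun y => f (x - y)) = I1 f.
Proof.
have m1 : (-1 : R) != 0 by rewrite oppr_eq0 oner_neq0.
move=> cf; have := I1_affine x m1 cf; rewrite normrN normr1 invr1 mul1r => <-.
by apply: eq_I1 => y; rewrite mulN1r addrC.
Qed.

Lemma cc_shift f x : cc f -> cc (fun y => f (y - x)).
Proof. by move=> cf; have := cc_affine (- x) (oner_neq0 R) cf; under eq_fun do rewrite mul1r. Qed.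

Lemma I1_shift f x : cc f -> I1 (fun y => f (y - x)) = I1 f.
Proof.
move=> cf; have := I1_affine (- x) (oner_neq0 R) cf; rewrite normr1 invr1 mul1r => <-.
by apply: eq_I1 => y; rewrite mul1r.
Qed.

Lemma cc_conv_integrand f g x : cc f -> cc g -> cc (fun y => f (x - y) * g y).
Proof. by move=> cf cg; apply: ccM => //; exact: (cc_reflect x cf).1. Qed.

Lemma continuous_sub (z : R * R) : {for z, continuous (fun z : R * R => z.1 - z.2)}.
Proof. by apply: cvgB; [exact: cvg_fst|exact: cvg_snd]. Qed.

Lemma cont2_sub f : continuous f -> cont2 (fun x y => f (x - y)).
Proof. by move=> cf; apply: continuous_compR => // z; exact: continuous_sub. Qed.

Lemma conv_support A B f g : bsupp A f -> bsupp B g ->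
  forall x y, A + B < `|x| -> f (x - y) * g y = 0.
Proof.
move=> fA gB x y xAB; case: (ltP B `|y|) => [/gB ->|yB]; first by rewrite mulr0.
rewrite fA ?mul0r //.
have := lerB_dist x y; lra.
Qed.

Lemma bsupp_conv A B f g : bsupp A f -> bsupp B g -> bsupp (A + B) (conv f g).
Proof.
move=> fA gB x xAB; rewrite -[RHS](I10 R); apply: eq_I1 => y.
exact: (conv_support fA gB).
Qed.

Lemma cc2_conv f g : cc f -> cc g -> cc2 (fun x y => f (x - y) * g y).
Proof.
move=> cf cg; have [A A0 fA] := cc_bsupp cf; have [B B0 gB] := cc_bsupp cg.
split.
  move=> z; apply: cvgM; first exact: (cont2_sub cf.1).
  by apply: (continuous_compR cg.1); exact: continuous_sndR.
exists (A + B) => x y /orP[|yB]; first exact: (conv_support fA gB).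
rewrite gB ?mulr0 //; lra.
Qed.

Lemma cc_conv f g : cc f -> cc g -> cc (conv f g).
Proof. by move=> cf cg; exact: (cc2_I1 (cc2_conv cf cg)). Qed.

Lemma convC f g : cc f -> cc g -> conv f g = conv g f.
Proof.
move=> cf cg; apply/funext => x.
rewrite /conv -(I1_reflect x (cc_conv_integrand x cf cg)).
by apply: eq_I1 => y; rewrite opprB addrC subrK mulrC.
Qed.

Lemma I1_conv f g : cc f -> cc g -> I1 (conv f g) = I1 f * I1 g.
Proof.
move=> cf cg; have := I2_swap (cc2_conv cf cg); rewrite /I2 => ->.
rewrite -I1Z //; apply: eq_I1 => y.
by rewrite I1Zr ?I1_shift //; exact: cc_shift.
Qed.

Lemma convA f g h : cc f -> cc g -> cc h -> conv (conv f g) h = conv f (conv g h).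
Proof.
move=> cf cg ch; apply/funext => x.
have c2 : cc2 (fun w y => f (x - w) * g (w - y) * h y).
  have := cc2M (cont2_sub cg.1) (cc2_tensor (cc_reflect x cf) ch).
  by congr cc2; apply/funext => w; apply/funext => y; ring.
transitivity (I2 (fun w y => f (x - w) * g (w - y) * h y)); last first.
  apply: eq_I1 => w; rewrite -I1Z; last exact: cc_conv_integrand.
  by apply: eq_I1 => y; rewrite mulrA.
rewrite I2_swap //; apply: eq_I1 => y.
rewrite I1Zr; last first.
  by apply: ccM; [exact: (cc_reflect x cf).1|exact: cc_shift].
congr (_ * _).
have cs : cc (fun w => f (x - w) * g (w - y)).
  by apply: ccM; [exact: (cc_reflect x cf).1|exact: cc_shift].
rewrite -(I1_shift (- y) cs); apply: eq_I1 => z.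
by congr (f _ * g _); ring.
Qed.

Lemma convDl f g h : cc f -> cc g -> cc h ->
  conv (fun x => f x + g x) h = fun x => conv f h x + conv g h x.
Proof.
move=> cf cg ch; apply/funext => x; rewrite /conv -I1D; try exact: cc_conv_integrand.
by apply: eq_I1 => y; rewrite mulrDl.
Qed.

Lemma convZl c f g : cc f -> cc g -> conv (fun x => c * f x) g = fun x => c * conv f g x.
Proof.
move=> cf cg; apply/funext => x; rewrite /conv -I1Z; try exact: cc_conv_integrand.
by apply: eq_I1 => y; rewrite mulrA.
Qed.

Lemma convDr f g h : cc f -> cc g -> cc h ->
  conv h (fun x => f x + g x) = fun x => conv h f x + conv h g x.
Proof. by move=> cf cg ch; rewrite convC ?convDl ?(convC ch) //; exact: ccD. Qed.

Lemma convZr c f g : cc f -> cc g -> conv f (fun x => c * g x) = fun x => c * conv f g x.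
Proof. by move=> cf cg; rewrite convC ?convZl ?(convC cf) //; exact: ccZ. Qed.

Definition dil c f x : R := c * f (c * x).

Lemma dilE c f : dil c f = fun x => c * f (c * x + 0).
Proof. by apply/funext => x; rewrite /dil addr0. Qed.

Lemma cc_dil c f : c != 0 -> cc f -> cc (dil c f).
Proof. by move=> c0 cf; rewrite dilE; apply: ccZ; exact: cc_affine. Qed.

Lemma sc_dil c f : c != 0 -> sc f -> sc (dil c f).
Proof. by move=> c0 cf; rewrite dilE; apply: scZ; exact: sc_affine. Qed.

Lemma I1_dil c f : 0 < c -> cc f -> I1 (dil c f) = I1 f.
Proof.
move=> c0 cf; have cn0 : c != 0 by rewrite gt_eqF.
rewrite dilE I1Z ?I1_affine //; last exact: cc_affine.
by rewrite gtr0_norm // mulrA divff // mul1r.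
Qed.

Lemma dil_conv c f g : 0 < c -> cc f -> cc g -> conv (dil c f) (dil c g) = dil c (conv f g).
Proof.
move=> c0 cf cg; apply/funext => x; rewrite /conv /dil.
rewrite -(I1_dil c0 (cc_conv_integrand (c * x) cf cg)) -I1Z; last first.
  by apply: cc_dil; [rewrite gt_eqF|exact: cc_conv_integrand].
by apply: eq_I1 => y; rewrite /dil mulrBr; ring.
Qed.

Lemma dil_dil c d f : dil c (dil d f) = dil (c * d) f.
Proof. by apply/funext => x; rewrite /dil !mulrA [d * c]mulrC. Qed.

(** Differentiation under the integral sign with majorant [M |g|]. Only one derivative of [f] and
    continuity of [g] enter, so that it applies to functions of finite order convolved with the
    piecewise linear [hat]. *)
Lemma is_derive_conv_gen f f' g x : (forall z, is_derive z (1 : R) f (f' z)) ->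
  cc f -> cc f' -> cc g -> is_derive x (1 : R) (conv f g) (conv f' g x).
Proof.
move=> df0 cf cf' cg.
have [M M0 fM] := cc_bounded cf'.
have df y z : is_derive z (1 : R) (fun z => f (z - y) * g y) (f' (z - y) * g y).
  have h : is_derive z (1 : R) (fun z => f (z - y)) (f' (z - y)).
    have := @is_derive_affine R f 1 (- y) z (f' (z - y)).
    by rewrite !mul1r => h; under eq_fun do rewrite -[X in X - _]mul1r; apply: h; exact: df0.
  have := is_deriveMR h (is_derive_cst (g y) z (1 : R)).
  by rewrite mulr0 addr0.
have p1 z y : partial1of2 (fun z y => f (z - y) * g y) z y = f' (z - y) * g y.
  by rewrite /partial1of2; exact: is_derive_derive1.
have xI : `]x - 1, x + 1[%classic x by rewrite /= in_itv /=; apply/andP; split; lra.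
have H1 z : `]x - 1, x + 1[%classic z ->
    (@lebesgue_measure R).-integrable setT (EFin \o (fun y => f (z - y) * g y)).
  by move=> _; apply: cc_integrable; exact: (cc_conv_integrand z cf).
have H2 z y : `]x - 1, x + 1[%classic z -> setT y -> derivable (fun z => f (z - y) * g y) z (1 : R).
  by move=> _ _; have [] := df y z.
have H3 y : 0 <= M * `|g y| by rewrite mulr_ge0 // ltW.
have H4 : (@lebesgue_measure R).-integrable setT (EFin \o (fun y => M * `|g y|)).
  by apply: cc_integrable; apply: ccZ; exact: cc_norm.
have H5 z y : `]x - 1, x + 1[%classic z -> setT y ->
    `|partial1of2 (fun z y => f (z - y) * g y) z y| <= M * `|g y|.
  by move=> _ _; rewrite p1 normrM ler_wpM2r.
have d1 := derivable_under_integral measurableT xI H1 H2 H3 H4 H5.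
have d2 := differentiation_under_integral measurableT xI H1 H2 H3 H4 H5.
apply: DeriveDef; first exact: d1.
rewrite -derive1E; apply: (etrans d2).
by apply: eq_I1 => y; exact: p1.
Qed.

Lemma is_derive_conv f g x : sc f -> cc g ->
  is_derive x (1 : R) (conv f g) (conv (derive1 f) g x).
Proof.
move=> sf cg; apply: is_derive_conv_gen => //; last exact/sc_cc/sc_derive.
  by move=> z; exact: sm_is_derive sf.1.
exact: sc_cc.
Qed.

Lemma derive_conv f g : sc f -> cc g -> derive1 (conv f g) = conv (derive1 f) g.
Proof. by move=> sf cg; apply/funext => x; apply: is_derive_derive1; exact: is_derive_conv. Qed.

Lemma sc_conv f g : sc f -> cc g -> sc (conv f g).
Proof.
move=> sf cg; split; last exact: (cc_conv (sc_cc sf) cg).2.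
apply: (@sm_coind _ (fun h => exists2 f, sc f & h = conv f g)); last by exists f.
move=> _ [f' sf' ->]; split.
  by move=> x; have [] := is_derive_conv x sf' cg.
by exists (derive1 f'); [exact: sc_derive|exact: derive_conv].
Qed.

Lemma derive_convC f g : sc f -> sc g -> conv (derive1 f) g = conv f (derive1 g).
Proof.
move=> sf sg; rewrite -(derive_conv sf (sc_cc sg)) convC; try exact: sc_cc.
rewrite (derive_conv sg (sc_cc sf)) convC //; [|exact: sc_cc].
exact/sc_cc/sc_derive.
Qed.

Lemma sc_derive1n f L : sc f -> sc (derive1n L f).
Proof. by move=> sf; elim: L => // L IH; rewrite derive1nS; exact: sc_derive. Qed.

(* The step from [L] to [L + 1] replaces [zeta] by [2 zeta - zeta * zeta]; then [lam] becomes
   [2 lam - lam * (dil 2 zeta + zeta)], which has integral [0] and hence is a derivative. *)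
Lemma reproducing (u : R -> R) (L : nat) : sc u -> I1 u = 1 ->
  exists lam0 lam zeta, [/\ sc lam0, sc lam & sc zeta] /\
   [/\ I1 zeta = 1, zeta = conv lam0 u &
    (fun x => dil 2 zeta x - zeta x) = conv lam (derive1n L (fun x => 2 * u (2 * x) - u x))].
Proof.
move=> su u1; have cu := sc_cc su.
have n2 : (2 : R) != 0 by rewrite gt_eqF.
have sN f : sc f -> sc (fun x => - f x).
  by move=> sf; have := scZ (-1) sf; under eq_fun do rewrite mulN1r.
have sw : sc (fun x => 2 * u (2 * x) - u x).
  by apply: (scD (sc_dil n2 su)); exact: sN.
elim: L => [|L [lam0 [lam [z [[s0 sl sz] [z1 zE dE]]]]]].
  exists u, (fun x => dil 2 u x + u x), (conv u u); split.
    by split => //; [exact: (scD (sc_dil n2 su))|exact: sc_conv].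
  split => //; first by rewrite I1_conv // u1 mulr1.
  have cd : cc (dil 2 u) by exact: cc_dil.
  have -> : derive1n 0 (fun x => 2 * u (2 * x) - u x) = (fun x => dil 2 u x + (-1) * u x).
    by apply/funext => x /=; rewrite mulN1r.
  move: (dil 2 u) (dil_conv (ltr0n R 2) cu cu) cd => d2 <- cd.
  rewrite convDl //; last by apply: ccD => //; exact: ccZ.
  rewrite !convDr ?convZr //; try exact: ccZ.
  apply/funext => x; by rewrite (convC cu cd); ring.
have cz := sc_cc sz; have cl := sc_cc sl; have c0 := sc_cc s0.
have cdz : cc (dil 2 z) by exact: cc_dil.
set D := (X in conv _ X) in dE; have sD : sc D by exact: sc_derive1n.
have cD := sc_cc sD.
pose l1 x := 2 * lam x + (-1) * conv lam (fun x => dil 2 z x + z x) x.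
have cdzz : cc (fun x => dil 2 z x + z x) by exact: ccD.
have sl1 : sc l1 by apply: scD; apply: scZ => //; exact: sc_conv.
have l10 : I1 l1 = 0.
  rewrite I1D; try (apply: ccZ => //; exact: cc_conv).
  rewrite !I1Z //; last exact: cc_conv.
  by rewrite I1_conv // I1D // I1_dil // z1; ring.
have [l2 sl2 l2E] := sc_antiderivative sl1 l10.
exists (fun x => 2 * lam0 x + (-1) * conv lam0 z x), l2, (fun x => 2 * z x + (-1) * conv z z x).
have czz : cc (conv z z) by exact: cc_conv.
split.
  by split => //; (apply: scD; apply: scZ => //; exact: sc_conv).
split.
- rewrite I1D; try exact: ccZ.
  by rewrite !I1Z // I1_conv // z1; ring.
- rewrite convDl //; try (apply: ccZ => //; exact: cc_conv).
  rewrite !convZl //; last exact: cc_conv.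
  rewrite convA // (convC cz cu) -convA // -zE.
  by [].
- rewrite derive1nS -/D -derive_convC // l2E /l1.
  rewrite convDl //; try (apply: ccZ => //; exact: cc_conv).
  rewrite !convZl //; last exact: cc_conv.
  rewrite convA // (convC cdzz cD) -convA // -dE.
  have -> : (fun x => dil 2 z x - z x) = (fun x => dil 2 z x + (-1) * z x).
    by apply/funext => x; rewrite mulN1r.
  have cNz : cc (fun x => (-1) * z x) by exact: ccZ.
  have E : dil 2 (fun x => 2 * z x + (-1) * conv z z x) = fun x => 2 * dil 2 z x + (-1) * conv (dil 2 z) (dil 2 z) x.
    by rewrite dil_conv //; apply/funext => x; rewrite /dil; ring.
  rewrite E; move: (dil 2 z) cdz => d2 cd2.
  have cdz2 := ccD cd2 cz.
  rewrite (convDl cd2 cNz cdz2) (convZl _ cz cdz2) (convDr cd2 cz cd2) (convDr cd2 cz cz).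
  by apply/funext => x; rewrite (convC cz cd2); ring.
Qed.

End Convolution.

(** * Convolution in two variables *)

Section I2theory.
Variable R : realType.
Implicit Types f g : R -> R.
Implicit Types h k : R -> R -> R.

Lemma cc2Z (r : R) h : cc2 h -> cc2 (fun x y => r * h x y).
Proof. by move=> ch; apply: cc2M => // z; exact: cvg_cst. Qed.

Lemma cc2B h k : cc2 h -> cc2 k -> cc2 (fun x y => h x y - k x y).
Proof.
move=> ch ck; have := cc2D ch (cc2Z (-1) ck).
by congr cc2; apply/funext => x; apply/funext => y; rewrite mulN1r.
Qed.

Lemma I2D h k : cc2 h -> cc2 k -> I2 (fun x y => h x y + k x y) = I2 h + I2 k.
Proof.
move=> ch ck; rewrite /I2 -I1D; try exact: cc2_I1.
by apply: eq_I1 => x; rewrite I1D //; exact: cc2_l.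
Qed.

Lemma I2Z r h : cc2 h -> I2 (fun x y => r * h x y) = r * I2 h.
Proof.
move=> ch; rewrite /I2 -I1Z; last exact: cc2_I1.
by apply: eq_I1 => x; rewrite I1Z //; exact: cc2_l.
Qed.

Lemma eq_I2 h k : (forall x y, h x y = k x y) -> I2 h = I2 k.
Proof. by move=> hk; apply: eq_I1 => x; apply: eq_I1 => y. Qed.

Lemma I2B h k : cc2 h -> cc2 k -> I2 (fun x y => h x y - k x y) = I2 h - I2 k.
Proof.
move=> ch ck.
have -> : I2 (fun x y => h x y - k x y) = I2 (fun x y => h x y + (-1) * k x y).
  by apply: eq_I2 => x y; rewrite mulN1r.
by rewrite (I2D ch (cc2Z (-1) ck)) (I2Z _ ck) mulN1r.
Qed.

Lemma cc2_0 : cc2 (fun _ _ => 0 : R).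
Proof. by split; [move=> z; exact: cvg_cst|exists 0]. Qed.

Lemma cc2_sum (T : Type) (s : seq T) (G : T -> R -> R -> R) :
  (forall i, cc2 (G i)) -> cc2 (fun x y => \sum_(i <- s) G i x y).
Proof.
move=> cG; elim: s => [|i s IH].
  have -> : (fun x y => \sum_(i <- [::]) G i x y) = fun _ _ => 0.
    by apply/funext => x; apply/funext => y; rewrite big_nil.
  exact: cc2_0.
have -> : (fun x y => \sum_(j <- i :: s) G j x y) = fun x y => G i x y + \sum_(j <- s) G j x y.
  by apply/funext => x; apply/funext => y; rewrite big_cons.
exact: cc2D.
Qed.

Lemma I2_sum (T : Type) (s : seq T) (G : T -> R -> R -> R) :
  (forall i, cc2 (G i)) -> I2 (fun x y => \sum_(i <- s) G i x y) = \sum_(i <- s) I2 (G i).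
Proof.
move=> cG; rewrite /I2 -I1_sum; last by move=> i; exact: cc2_I1.
by apply: eq_I1 => x; rewrite I1_sum // => i; exact: cc2_l.
Qed.

Lemma le_I2 h k : cc2 h -> cc2 k -> (forall x y, h x y <= k x y) -> I2 h <= I2 k.
Proof.
move=> ch ck hk; apply: le_I1; [exact: cc2_I1|exact: cc2_I1|move=> x].
by apply: le_I1; [exact: cc2_l|exact: cc2_l|exact: hk].
Qed.

Lemma I2_norm h : cc2 h -> `|I2 h| <= I2 (fun x y => `|h x y|).
Proof.
move=> ch; apply: le_trans (I1_norm (cc2_I1 ch)) _.
apply: le_I1; [exact: cc_norm (cc2_I1 ch)|exact: cc2_I1 (cc2_norm ch)|move=> x].
exact: I1_norm (cc2_l x ch).
Qed.

Lemma I2_ge0 h : (forall x y, 0 <= h x y) -> 0 <= I2 h.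
Proof. by move=> h0; apply: I1_ge0 => x; exact: I1_ge0. Qed.

Lemma I2_tensor f g : cc f -> cc g -> I2 (fun x y => f x * g y) = I1 f * I1 g.
Proof. by move=> cf cg; rewrite -I1Zr //; apply: eq_I1 => x; rewrite I1Z. Qed.

Lemma cont2M h k : cont2 h -> cont2 k -> cont2 (fun x y => h x y * k x y).
Proof. by move=> ch ck z; apply: cvgM; [exact: ch|exact: ck]. Qed.

Lemma cont2D h k : cont2 h -> cont2 k -> cont2 (fun x y => h x y + k x y).
Proof. by move=> ch ck z; apply: cvgD; [exact: ch|exact: ck]. Qed.

Lemma cont2_cst (r : R) : cont2 (fun _ _ => r).
Proof. by move=> z; exact: cvg_cst. Qed.

Lemma cont2_norm h : cont2 h -> cont2 (fun x y => `|h x y|).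
Proof. by move=> ch z; apply: cvg_norm; exact: ch. Qed.

Lemma cont2_sum (T : Type) (s : seq T) (G : T -> R -> R -> R) :
  (forall i, cont2 (G i)) -> cont2 (fun x y => \sum_(i <- s) G i x y).
Proof.
move=> cG; elim: s => [|i s IH].
  have -> : (fun x y => \sum_(i <- [::]) G i x y) = fun _ _ => 0.
    by apply/funext => x; apply/funext => y; rewrite big_nil.
  exact: cont2_cst.
have -> : (fun x y => \sum_(j <- i :: s) G j x y) = fun x y => G i x y + \sum_(j <- s) G j x y.
  by apply/funext => x; apply/funext => y; rewrite big_cons.
exact: cont2D.
Qed.

Lemma cont2_tensor f g : continuous f -> continuous g -> cont2 (fun x y => f x * g y).
Proof.
move=> cf cg; apply: cont2M; apply: continuous_compR => //;
  [exact: continuous_fstR|exact: continuous_sndR].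
Qed.

End I2theory.

Section Convolution2.
Variable R : realType.
Implicit Types k l : R -> R.
Implicit Types h g : R -> R -> R.

(** Convolution in one variable only; the tensor kernel of [k] and [l] acts as [C1 k] after
    [C2 l]. *)
Definition C1 k h x y : R := conv (h^~ y) k x.
Definition C2 k h x y : R := conv (h x) k y.

Lemma C2E k h : C2 k h = fun x y => C1 k (fun y x => h x y) y x.
Proof. by []. Qed.

Lemma cont2_C1 k h : cc k -> cont2 h -> cont2 (C1 k h).
Proof.
move=> ck ch; have [A A0 kA] := cc_bsupp ck.
apply: (@I1_param_continuous R (R * R)%type (fun z t => h (z.1 - t) z.2 * k t) A); last first.
  by move=> u t At; rewrite kA ?mulr0.
have c1 : continuous (fun w : R * R * R => w.1.1 - w.2).
  move=> z; apply: cvgB; last exact: cvg_snd.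
  by apply: (@continuous_comp _ _ _ (fun w : R * R * R => w.1) (fun v : R * R => v.1)); [exact: cvg_fst|exact: cvg_fst].
have c2 : continuous (fun w : R * R * R => w.1.2).
  by move=> z; apply: (@continuous_comp _ _ _ (fun w : R * R * R => w.1) (fun v : R * R => v.2)); [exact: cvg_fst|exact: cvg_snd].
have c3 := cont2_comp ch c1 c2.
move=> z; apply: cvgM; first exact: c3.
by apply: (continuous_compR ck.1) => {}z; exact: cvg_snd.
Qed.

Lemma bsupp2_C1 A B k h : 0 < A -> 0 < B -> bsupp B k -> bsupp2 A h -> bsupp2 (A + B) (C1 k h).
Proof.
move=> A0 B0 kB hA x y /orP[xAB|yAB].
  apply: (@bsupp_conv _ A B) => // z Az; apply: hA; by rewrite Az.
rewrite /C1 /conv -[RHS](I10 R); apply: eq_I1 => t; rewrite hA ?mul0r //.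
by apply/orP; right; lra.
Qed.

Lemma cc2_C1 k h : cc k -> cc2 h -> cc2 (C1 k h).
Proof.
move=> ck ch; have [A A0 hA] := cc2_bsupp ch; have [B B0 kB] := cc_bsupp ck.
by split; [exact: cont2_C1 ch.1|exists (A + B); exact: bsupp2_C1].
Qed.

Lemma bsupp2_C2 A B k h : 0 < A -> 0 < B -> bsupp B k -> bsupp2 A h -> bsupp2 (A + B) (C2 k h).
Proof.
move=> A0 B0 kB hA x y; rewrite orbC C2E; apply: bsupp2_C1 => // {}x {}y.
by rewrite orbC; exact: hA.
Qed.

Lemma cc2_C2 k h : cc k -> cc2 h -> cc2 (C2 k h).
Proof. by move=> ck ch; rewrite C2E; apply: cc2_swap; apply: cc2_C1 => //; exact: cc2_swap. Qed.

Lemma C1_conv k l h : cc k -> cc l -> cc2 h -> C1 k (C1 l h) = C1 (conv l k) h.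
Proof.
move=> ck cl ch; apply/funext => x; apply/funext => y.
rewrite /C1 -convA //; exact: cc2_r.
Qed.

Lemma C2_conv k l h : cc k -> cc l -> cc2 h -> C2 k (C2 l h) = C2 (conv l k) h.
Proof.
move=> ck cl ch; apply/funext => x; apply/funext => y.
rewrite /C2 -convA //; exact: cc2_l.
Qed.

Lemma C1C2 k l h : cc k -> cc l -> cc2 h -> C1 k (C2 l h) = C2 l (C1 k h).
Proof.
move=> ck cl ch; apply/funext => x; apply/funext => y.
have c2 : cc2 (fun t s => h (x - t) (y - s) * (k t * l s)).
  apply: cc2M; last exact: cc2_tensor.
  apply: (cont2_comp ch.1) => z; apply: cvgB; try exact: cvg_cst.
    exact: cvg_fst.
  exact: cvg_snd.
transitivity (I2 (fun t s => h (x - t) (y - s) * (k t * l s))).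
  apply: eq_I1 => t; rewrite -I1Zr; last exact: (cc_conv_integrand _ (cc2_l _ ch)).
  by apply: eq_I1 => s; ring.
rewrite I2_swap //; apply: eq_I1 => s; rewrite -I1Zr; last first.
  exact: (cc_conv_integrand x (cc2_r (y - s) ch)).
by apply: eq_I1 => t; ring.
Qed.

Lemma I2_C1 k h : cc k -> cc2 h -> I2 (C1 k h) = I1 k * I2 h.
Proof.
move=> ck ch; rewrite (I2_swap (cc2_C1 ck ch)) (I2_swap ch) mulrC -I1Zr; last first.
  exact: (cc2_I1 (cc2_swap ch)).
by apply: eq_I1 => y; rewrite -I1_conv //; exact: cc2_r.
Qed.

Lemma I2_C2 k h : cc k -> cc2 h -> I2 (C2 k h) = I1 k * I2 h.
Proof.
move=> ck ch; rewrite mulrC -I1Zr; last exact: cc2_I1.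
by apply: eq_I1 => y; rewrite -I1_conv //; exact: cc2_l.
Qed.

Lemma C1_sum (T : Type) (s : seq T) (K : T -> R -> R) h x y :
  (forall i, cc (K i)) -> cc2 h ->
  C1 (fun t => \sum_(i <- s) K i t) h x y = \sum_(i <- s) C1 (K i) h x y.
Proof.
move=> cK ch; rewrite /C1 /conv -I1_sum; last by move=> i; exact: (cc_conv_integrand _ (cc2_r _ ch)).
by apply: eq_I1 => t; rewrite mulr_sumr.
Qed.

Lemma C2_sum (T : Type) (s : seq T) (K : T -> R -> R) h x y :
  (forall i, cc (K i)) -> cc2 h ->
  C2 (fun t => \sum_(i <- s) K i t) h x y = \sum_(i <- s) C2 (K i) h x y.
Proof. by move=> cK ch; rewrite C2E C1_sum //; exact: cc2_swap. Qed.

Lemma C1C2E k l h x y : cc k -> cc l -> cc2 h ->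
  C1 k (C2 l h) x y = I2 (fun t s => k (x - t) * l (y - s) * h t s).
Proof.
move=> ck cl ch; rewrite /C1 convC //; last exact: (cc2_r _ (cc2_C2 cl ch)).
apply: eq_I1 => t; rewrite /C2 convC //; last exact: cc2_l.
rewrite -I1Z; last exact: (cc_conv_integrand _ cl (cc2_l _ ch)).
by apply: eq_I1 => s; rewrite mulrA.
Qed.

(* The quadrature error of a convolution with the kernel [k (x) l] is the integral of the convolved
   function against this weight. *)
Definition dual_weight (N : R) (pts : seq (R * R)) k l y1 y2 : R :=
  I1 k * I1 l - N^-1 * \sum_(z <- pts) k (z.1 - y1) * l (z.2 - y2).

Lemma cont2_weight N pts k l : continuous k -> continuous l -> cont2 (dual_weight N pts k l).
Proof.
move=> ck cl z; apply: cvgB; first exact: cvg_cst.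
apply: cvgM; first exact: cvg_cst.
apply: (@cont2_sum _ _ pts (fun w x y => k (w.1 - x) * l (w.2 - y))) => w.
by apply: cont2_tensor; apply: continuous_compR => // x; apply: cvgB; [exact: cvg_cst|exact: cvg_id|exact: cvg_cst|exact: cvg_id].
Qed.

Lemma error_dual N pts k l g : cc k -> cc l -> cc2 g ->
  I2 (C1 k (C2 l g)) - N^-1 * \sum_(z <- pts) C1 k (C2 l g) z.1 z.2 =
  I2 (fun y1 y2 => dual_weight N pts k l y1 y2 * g y1 y2).
Proof.
move=> ck cl cg.
pose G (z : R * R) t s := k (z.1 - t) * l (z.2 - s) * g t s.
have cG z : cc2 (G z).
  apply: cc2M => //; apply: cont2_tensor; apply: continuous_compR; try exact: ck.1; try exact: cl.1;
  by move=> x; apply: cvgB; [exact: cvg_cst|exact: cvg_id].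
rewrite I2_C1 ?I2_C2 //; last exact: cc2_C2.
have -> : \sum_(z <- pts) C1 k (C2 l g) z.1 z.2 = \sum_(z <- pts) I2 (G z).
  by apply: eq_bigr => z _; rewrite C1C2E.
have cS := cc2_sum pts cG.
rewrite -I2_sum // -(I2Z _ cS) mulrA -(I2Z _ cg) -(I2B (cc2Z _ cg) (cc2Z _ cS)).
by apply: eq_I2 => x y; rewrite /dual_weight mulrBl -!mulrA mulr_suml.
Qed.

(** The dilates live in a box of side of order [A / 2^J], on which [h] differs from [h x y] by less
    than [e1]. As [z] may change sign, the L_1-norm [M] enters, once per variable, whence
    [e1 = e / M^2]. *)
Lemma approximate_identity (z : R -> R) h x y (e : R) : cc z -> I1 z = 1 -> cont2 h -> 0 < e ->
  exists J0 : nat, forall J, (J0 <= J)%N ->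
    `|I2 (fun t s => dil (2 ^+ J) z t * dil (2 ^+ J) z s * h (x - t) (y - s)) - h x y| <= e.
Proof.
move=> cz z1 ch e0; have [A A0 zA] := cc_bsupp cz.
pose M := I1 (fun x => `|z x|).
have M0 : 0 < M by apply: lt_le_trans (I1_norm cz); rewrite z1 normr1.
pose e1 := e / M ^+ 2.
have e10 : 0 < e1 by rewrite divr_gt0 // exprn_gt0.
have /cvgrPdist_lt/(_ _ e10)/nbhs_ballP[d /= d0 hd] := ch (x, y).
have [J0 J0P] : exists J0 : nat, A < d * 2 ^+ J0.
  exists (Num.bound (A / d)).
  rewrite mulrC -ltr_pdivrMr //.
  have := archi_boundP (ltW (divr_gt0 A0 d0)); move/lt_le_trans; apply.
  by rewrite -natrX ler_nat ltnW // ltn_expl.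
exists J0 => J JJ.
have j0 : (0 : R) < 2 ^+ J by rewrite exprn_gt0.
have jn0 : (2 : R) ^+ J != 0 by rewrite gt_eqF.
have cJ : cc (dil (2 ^+ J) z) by exact: cc_dil.
have zJ : bsupp (A / 2 ^+ J) (dil (2 ^+ J) z).
  move=> t; rewrite ltr_pdivrMr // => h1; rewrite /dil zA ?mulr0 //.
  by rewrite normrM gtr0_norm // mulrC.
have AJ : A / 2 ^+ J < d.
  rewrite ltr_pdivrMr //; apply: lt_le_trans J0P _.
  by rewrite ler_pM2l // ler_weXn2l // ler1n.
have ch' : cont2 (fun t s => h (x - t) (y - s)).
  apply: (cont2_comp ch) => w; apply: cvgB; try exact: cvg_cst.
    exact: cvg_fst.
  exact: cvg_snd.
have c2 := cc2_tensor cJ cJ.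
have c2h : cc2 (fun t s => dil (2 ^+ J) z t * dil (2 ^+ J) z s * h (x - t) (y - s)).
  have := cc2M ch' c2; congr cc2; apply/funext => t; apply/funext => s; by rewrite mulrC.
have -> : h x y = I2 (fun t s => h x y * (dil (2 ^+ J) z t * dil (2 ^+ J) z s)).
  by rewrite I2Z // I2_tensor // I1_dil // z1 !mulr1.
rewrite -I2B //; last exact: cc2Z.
apply: le_trans (I2_norm _) _; first by apply: cc2B => //; exact: cc2Z.
have cn := cc2_tensor (cc_norm cJ) (cc_norm cJ).
have -> : e = I2 (fun t s => e1 * (`|dil (2 ^+ J) z t| * `|dil (2 ^+ J) z s|)).
  rewrite I2Z // I2_tensor; try exact: cc_norm.
  have -> : I1 (fun t => `|dil (2 ^+ J) z t|) = M.
    rewrite /M -(I1_dil j0 (cc_norm cz)); apply: eq_I1 => t.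
    by rewrite /dil normrM gtr0_norm.
  by rewrite /e1 -expr2 divfK // gt_eqF // exprn_gt0.
apply: le_I2; [|exact: cc2Z|].
  by apply: cc2_norm; apply: cc2B => //; exact: cc2Z.
move=> t s; rewrite [h x y * _]mulrC -mulrBr normrM mulrC normrM.
case: (ltP (A / 2 ^+ J) `|t|) => [/zJ ->|tA]; first by rewrite normr0 !(mul0r, mulr0).
case: (ltP (A / 2 ^+ J) `|s|) => [/zJ ->|sA]; first by rewrite normr0 !(mul0r, mulr0).
apply: ler_wpM2r; first exact: mulr_ge0.
rewrite distrC; apply/ltW/(hd (x - t, y - s)); split; rewrite /ball /= opprB addrC subrK.
  exact: le_lt_trans tA AJ.
exact: le_lt_trans sA AJ.
Qed.

End Convolution2.

(** * Pairing with functions of bounded L_p-norm *)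

Section LpBounds.
Variable R : realType.
Implicit Types W q : R -> R -> R.

Lemma measurable_uncurry q : cont2 q ->
  measurable_fun (setT : set (measurableTypeR R * measurableTypeR R)) (fun z => q z.1 z.2).
Proof. exact: cont2_measurable. Qed.

Lemma integral_EFin_I2 q : cc2 q -> (\int[leb2 R]_z (q z.1 z.2)%:E)%E = (I2 q)%:E.
Proof.
move=> cq; rewrite -(I2_leb2 cq) /Rintegral fineK //.
exact: integrable_fin_num (cc2_integrable cq).
Qed.

Lemma leb2_box (A : R) : 0 < A ->
  leb2 R (`[- A, A]%classic `*` `[- A, A]%classic) = ((2 * A) ^+ 2)%:E.
Proof.
move=> A0.
have -> : leb2 R (`[- A, A]%classic `*` `[- A, A]%classic) = (@lebesgue_measure R `[(- A)%R, A]%classic * @lebesgue_measure R `[(- A)%R, A]%classic)%E.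
  by rewrite -(@product_measure1E _ _ _ _ _ (@lebesgue_measure R) (@lebesgue_measure R)).
have -> : @lebesgue_measure R `[- A, A]%classic = if ((- A)%:E < A%:E)%E then (A%:E - (- A)%:E)%E else 0%E.
  exact: (@lebesgue_measure_itv R `[- A, A]).
have -> : ((- A)%:E < A%:E)%E by rewrite lte_fin; lra.
by rewrite -EFinB -EFinM; congr EFin; ring.
Qed.

Lemma leb2T_gt0 : (0 < leb2 R setT)%E.
Proof.
have mK : measurable (`[- 1, 1]%classic `*` `[- 1, 1]%classic : set (measurableTypeR R * measurableTypeR R)).
  by apply: measurableX.
apply: (@lt_le_trans _ _ (leb2 R (`[- 1, 1]%classic `*` `[- 1, 1]%classic))).
  by rewrite leb2_box // lte_fin; lra.
by apply: le_measure => //; rewrite inE //; exact: measurableT.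
Qed.

Lemma inve_EFin (r : R) : 1 <= r -> (r%:E)^-1%E = (r^-1)%:E.
Proof. by move=> r1; rewrite inver; case: eqP => // r0; move: r1; rewrite r0 ler10. Qed.

(** A substitute for Hoelder's inequality. Where [q <= a], bound [W q] by [a W]; where [q > a], use
    [W <= V tau] and [q <= a (q / a)^r]. The threshold [a = b tau^(1/r)] balances the two: after
    integration either contributes at most [V b tau^(1/r)]. For [p = +oo] the essential bound of [q]
    and the integral of [W] suffice, and the exponent of [tau] is 0. *)
Lemma Lp_young W q (p : \bar R) (V tau b : R) : (1 <= p)%E ->
  cc2 W -> cc2 q -> (forall x y, 0 <= W x y) -> (forall x y, 0 <= q x y) ->
  0 < tau -> 0 < b -> (forall x y, W x y <= V * tau) -> I2 W <= V ->
  (Lnorm (leb2 R) p (fun z => (q z.1 z.2)%:E) <= b%:E)%E ->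
  I2 (fun x y => W x y * q x y) <= 2 * V * b * tau `^ (fine (p^-1)%E).
Proof.
move=> p1 cW cq W0 q0 tau0 b0 Wt WV.
have V0 : 0 <= V by apply: le_trans WV; exact: I2_ge0.
have cWq : cc2 (fun x y => W x y * q x y) by apply: cc2M => //; exact: cW.1.
have mW := measurable_uncurry cW.1; have mq := measurable_uncurry cq.1.
rewrite -lee_fin -integral_EFin_I2 //.
case: p p1 => [r| |//].
- rewrite lee_fin => r1 hL.
  have r0 : 0 < r by lra.
  have rn0 : r != 0 by rewrite gt_eqF.
  rewrite inve_EFin //=.
  set a := b * tau `^ r^-1.
  have a0 : 0 < a by rewrite mulr_gt0 // powR_gt0.
  have aE : a = b * tau `^ r^-1 by [].
  clearbody a.
  set S := V * tau * (a * a^-1 `^ r).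
  have S0 : 0 <= S by rewrite !mulr_ge0 // ?powR_ge0 // ltW.
  have pt (z : R * R) : W z.1 z.2 * q z.1 z.2 <= S * q z.1 z.2 `^ r + a * W z.1 z.2.
    case: z => x y /=.
    case: (leP (q x y) a) => qa.
      apply: (@le_trans _ _ (a * W x y)); first by rewrite mulrC ler_wpM2r.
      by rewrite lerDr mulr_ge0 // powR_ge0.
    apply: (@le_trans _ _ (S * q x y `^ r)); last by rewrite lerDl mulr_ge0 // ltW.
    rewrite /S -!mulrA [X in _ <= X]mulrA; apply: ler_pM => //.
    have h1 : 1 <= a^-1 * q x y by rewrite ler_pdivlMl // mulr1 ltW.
    rewrite -powRM ?invr_ge0 ?(ltW a0) //.
    apply: (@le_trans _ _ (a * (a^-1 * q x y))); first by rewrite mulVKf // gt_eqF.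
    by rewrite ler_pM2l // le1r_powR.
  have mqr : measurable_fun setT (fun z : measurableTypeR R * measurableTypeR R => q z.1 z.2 `^ r).
    by apply: (measurableT_comp (measurable_powR r)).
  apply: (@le_trans _ _ (\int[leb2 R]_z (S%:E * (q z.1 z.2 `^ r)%:E + a%:E * (W z.1 z.2)%:E))%E).
    apply: ge0_le_integral => //=.
    - by move=> z _; rewrite lee_fin mulr_ge0.
    - by apply/measurable_EFinP; apply: measurable_funM.
    - by apply: emeasurable_funD; apply: emeasurable_funM => //; apply/measurable_EFinP.
    - by move=> z _; rewrite -!EFinM -EFinD lee_fin; exact: pt.
  rewrite ge0_integralD //=; last first.
  - by apply: emeasurable_funM => //; apply/measurable_EFinP.
  - by move=> z _; rewrite mule_ge0 // lee_fin // ltW.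
  - by apply: emeasurable_funM => //; apply/measurable_EFinP.
  - by move=> z _; rewrite mule_ge0 // lee_fin // powR_ge0.
  rewrite ge0_integralZl_EFin //=; last first.
  - by apply/measurable_EFinP.
  - by move=> z _; rewrite lee_fin powR_ge0.
  rewrite ge0_integralZl_EFin //=; last first.
  - exact: ltW.
  - by apply/measurable_EFinP.
  - by move=> z _; rewrite lee_fin.
  rewrite integral_EFin_I2 //.
  have -> : (\int[leb2 R]_z (q z.1 z.2 `^ r)%:E = Lnorm (leb2 R) r%:E (fun z => (q z.1 z.2)%:E) `^ r)%E.
    rewrite (poweR_Lnorm _ _ rn0); apply: eq_integral => z _.
    by rewrite /= ger0_norm.
  have hL' : (Lnorm (leb2 R) r%:E (fun z => (q z.1 z.2)%:E) `^ r <= (b `^ r)%:E)%E.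
    rewrite -poweR_EFin; apply: gt0_ler_poweR => //; first exact: ltW.
      by rewrite in_itv /= Lnorm_ge0 leey.
    by rewrite in_itv /= lee_fin leey ltW.
  apply: (@le_trans _ _ (S%:E * (b `^ r)%:E + a%:E * V%:E)%E).
    by apply: leeD; [apply: lee_wpmul2l; rewrite ?lee_fin|apply: lee_wpmul2l; rewrite lee_fin // ltW].
  rewrite -!EFinM -EFinD lee_fin.
  have E : a^-1 `^ r * b `^ r = tau^-1.
    rewrite -powRM ?invr_ge0 ?ltW // aE invfM mulrAC mulVf ?gt_eqF // mul1r.
    by rewrite -powRN -powRrM mulNr mulVf // powR_inv1 // ltW.
  rewrite /S -!mulrA E [a * _]mulrC (mulrA tau) divff ?gt_eqF // mul1r aE.
  by have -> : V * (b * tau `^ r^-1) + b * tau `^ r^-1 * V = 2 * (V * (b * tau `^ r^-1)) by ring.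
- move=> _; rewrite unlock /Lnorm leb2T_gt0 => /ess_supP hq.
  rewrite invey /= powRr0 mulr1.
  apply: (@le_trans _ _ (\int[leb2 R]_z (b%:E * (W z.1 z.2)%:E))%E).
    apply: ae_ge0_le_integral => //=.
    - by move=> z _; rewrite lee_fin mulr_ge0.
    - by apply/measurable_EFinP; apply: measurable_funM.
    - by move=> z _; rewrite mule_ge0 // lee_fin // ltW.
    - by apply: emeasurable_funM => //; apply/measurable_EFinP.
    - apply: filterS hq => z /= + _; rewrite ger0_norm // !lee_fin => h.
      by rewrite mulrC ler_wpM2r.
  rewrite ge0_integralZl_EFin //=; last first.
  - exact: ltW.
  - by apply/measurable_EFinP.
  - by move=> z _; rewrite lee_fin.
  rewrite (_ : (\int[_]_x _)%E = (I2 W)%:E); last exact: integral_EFin_I2.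
  rewrite -EFinM lee_fin [2 * V * b]mulrC.
  apply: ler_wpM2l; first exact: ltW.
  apply: le_trans WV _; lra.
Qed.

(** The threshold in [Lp_young] must be positive; [b = 0] is reached by enlarging [b] by a small [d]
    and letting the resulting error [e] tend to 0. *)
Lemma Lp_weight W q (p : \bar R) (V tau b : R) : (1 <= p)%E ->
  cc2 W -> cc2 q -> (forall x y, 0 <= W x y) -> (forall x y, 0 <= q x y) ->
  0 < tau -> 0 <= b -> (forall x y, W x y <= V * tau) -> I2 W <= V ->
  (Lnorm (leb2 R) p (fun z => (q z.1 z.2)%:E) <= b%:E)%E ->
  I2 (fun x y => W x y * q x y) <= 2 * V * b * tau `^ (fine (p^-1)%E).
Proof.
move=> p1 cW cq W0 q0 tau0 b0 Wt WV hL.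
have V0 : 0 <= V by apply: le_trans WV; exact: I2_ge0.
apply/ler_addgt0Pr => e e0.
set t := tau `^ _; have t0 : 0 < t by rewrite powR_gt0.
pose d := e / (2 * V * t + 1).
have D0 : 0 < 2 * V * t + 1 by rewrite ltr_wpDl // !mulr_ge0 // ltW.
have d0 : 0 < d by rewrite divr_gt0.
have bd : 0 < b + d by rewrite ltr_wpDl.
have := @Lp_young W q p V tau (b + d) p1 cW cq W0 q0 tau0 bd Wt WV.
move=> /(_ (le_trans hL _)); rewrite lee_fin lerDl (ltW d0) => /(_ isT).
move=> /le_trans; apply; rewrite -/t mulrDr mulrDl lerD2l.
rewrite /d mulrAC mulrA ler_pdivrMr // mulrC ler_pM2l //; lra.
Qed.

(** The support has measure at most [(2 A)^2], which is at least 1, so its power with exponent [1/r]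
    is bounded by the measure itself and one bound serves every [p]. *)
Lemma Lnorm_bound q (p : \bar R) (A B : R) : (1 <= p)%E -> cc2 q ->
  (forall x y, 0 <= q x y) -> (forall x y, q x y <= B) -> 1 <= A -> bsupp2 A q ->
  (Lnorm (leb2 R) p (fun z => (q z.1 z.2)%:E) <= (B * (2 * A) ^+ 2)%:E)%E.
Proof.
move=> p1 cq q0 qB A1 qA.
have B0 : 0 <= B by apply: le_trans (qB 0 0).
have A21 : 1 <= (2 * A) ^+ 2 by rewrite exprn_ege1 //; lra.
have mq := measurable_uncurry cq.1.
case: p p1 => [r| |//]; last first.
  move=> _; rewrite unlock /Lnorm leb2T_gt0; apply/ess_supP.
  apply: filterE => z /=; rewrite ger0_norm // lee_fin.
  by apply: le_trans (qB _ _) _; rewrite ler_peMr.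
rewrite lee_fin => r1; rewrite unlock /Lnorm.
have r0 : 0 < r by lra.
pose K : set (measurableTypeR R * measurableTypeR R) := `[- A, A]%classic `*` `[- A, A]%classic.
have mK : measurable K by apply: measurableX.
have int : (\int[leb2 R]_z (`|(q z.1 z.2)%:E| `^ r) <= (B `^ r * (2 * A) ^+ 2)%:E)%E.
  apply: (@le_trans _ _ (\int[leb2 R]_(z in K) (B `^ r)%:E)%E); last first.
    rewrite integral_cst // EFinM; apply: lee_wpmul2l; first by rewrite lee_fin powR_ge0.
    by rewrite leb2_box //; lra.
  rewrite [leRHS]integral_mkcond; apply: ge0_le_integral => //=.
  - by apply/measurable_EFinP; apply: (measurableT_comp (measurable_powR r)); apply: measurableT_comp.
  - by apply/(measurable_restrictT _ mK); exact: measurable_cst.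
  - move=> [x y] _; rewrite patchE; case: ifPn => [_|].
      rewrite lee_fin; apply: ge0_ler_powR; rewrite ?nnegrE // ?normr_ge0 // ?(ltW r0) //.
      by rewrite ger0_norm.
    rewrite notin_setE /= => /not_andP /=; rewrite !in_itv /= -!ler_norml => xy.
    rewrite qA ?normr0 ?powR0 ?gt_eqF //; apply/orP; case: xy => /negP; rewrite -ltNge; [by left|by right].
apply: (@le_trans _ _ ((B `^ r * (2 * A) ^+ 2)%:E `^ r^-1)%E).
  apply: gt0_ler_poweR => //; first by rewrite invr_ge0 ltW.
    rewrite in_itv /= leey andbT; apply: integral_ge0 => z _; rewrite lee_fin; exact: powR_ge0.
  by rewrite in_itv /= leey andbT lee_fin mulr_ge0 ?powR_ge0 // sqr_ge0.
rewrite poweR_EFin lee_fin powRM ?powR_ge0 ?sqr_ge0 // -powRrM divff ?gt_eqF // powRr1 //.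
apply: ler_wpM2l => //; apply: ler1_powR => //.
by rewrite invf_le1.
Qed.

End LpBounds.

(** * The trapezoidal rule *)

Section Counting.
Variable R : realType.

(** Pigeonhole principle: cut [[a, b]] into cells of length [d]; separated points lie in different
    cells, so the cell number is injective. *)
Lemma size_separated (T : eqType) (s : seq T) (phi : T -> R) (a b d : R) :
  uniq s -> 0 < d -> a <= b -> {in s, forall x, a <= phi x <= b} ->
  {in s &, forall x y, x != y -> d <= `|phi x - phi y|} ->
  (size s)%:R <= (b - a) / d + 1.
Proof.
move=> us d0 ab hs sep.
pose F x := Num.truncn ((phi x - a) / d).
have F0 x : x \in s -> 0 <= (phi x - a) / d.
  by move=> /hs /andP[h _]; rewrite divr_ge0 ?subr_ge0 // ltW.
pose m := Num.truncn ((b - a) / d).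
have mb : m%:R <= (b - a) / d by rewrite truncn_le divr_ge0 ?subr_ge0 // ltW.
have uF : uniq (map F s).
  rewrite map_inj_in_uniq // => x y xs ys Fxy.
  apply/eqP; apply: contraT => xy; have := sep x y xs ys xy.
  have /andP[x1 x2] := truncn_itv (F0 x xs); have /andP[y1 y2] := truncn_itv (F0 y ys).
  rewrite -/(F x) in x1 x2; rewrite -/(F y) -Fxy in y1 y2.
  rewrite -natr1 in x2 y2.
  have : `|(phi x - a) / d - (phi y - a) / d| < 1.
    rewrite ltr_norml; apply/andP; split; lra.
  rewrite -mulrBl opprB addrA subrK normrM normfV [X in _ / X]gtr0_norm // ltr_pdivrMr // mul1r => h1 h2.
  by have := le_lt_trans h2 h1; rewrite ltxx.
have sF : {subset map F s <= iota 0 m.+1}.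
  move=> _ /mapP[x xs ->]; rewrite mem_iota /= add0n ltnS.
  apply: le_truncn; rewrite ler_pM2r ?invr_gt0 // lerD2r.
  by have /andP[] := hs x xs.
have := uniq_leq_size uF sF; rewrite size_map size_iota => sz.
apply: (@le_trans _ _ m.+1%:R); first by rewrite ler_nat.
by rewrite -natr1 lerD2r.
Qed.

Lemma sum_bound_supp (T : eqType) (s : seq T) (P : pred T) (f : T -> R) (M n : R) :
  0 <= M -> {in s, forall x, `|f x| <= M} -> (forall x, x \in s -> ~~ P x -> f x = 0) ->
  (size (seq.filter P s))%:R <= n -> `|\sum_(x <- s) f x| <= n * M.
Proof.
move=> M0 fM f0 sn.
rewrite (bigID P) /= [X in _ + X]big_seq_cond [X in _ + X]big1 ?addr0; last first.
  by move=> x /andP[xs Px]; exact: f0.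
rewrite -big_filter.
apply: le_trans (ler_norm_sum _ _ _) _.
apply: (@le_trans _ _ (\sum_(x <- seq.filter P s) M)).
  by rewrite big_seq [leRHS]big_seq; apply: ler_sum => x; rewrite mem_filter => /andP[_ /fM].
rewrite big_const_seq count_predT iter_addr_0 -mulr_natl.
exact: ler_wpM2r.
Qed.

(** The integers from [- D] to [D]: a finite substitute for sums over all integers, exact once [D]
    exceeds the support. *)
Definition zr (D : nat) : seq int := [seq i%:Z - D%:Z | i <- iota 0 (D + D).+1].

Lemma uniq_zr D : uniq (zr D).
Proof. by rewrite map_inj_uniq ?iota_uniq // => i j /addIr []. Qed.

Lemma mem_zr D (z : int) : (z \in zr D) = (`|z| <= D%:Z).
Proof.
apply/idP/idP => [/mapP[k]|h].
  by rewrite mem_iota => /andP[_ h] ->; lia.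
apply/mapP; exists (absz (z + D%:Z)%R); last by lia.
by rewrite mem_iota; lia.
Qed.

Lemma telescope_zr (F : R -> R) D :
  \sum_(n <- zr D) (F n%:~R - F (n%:~R - 1)) = F D%:R - F (- D%:R - 1).
Proof.
rewrite big_map.
rewrite (eq_bigr (fun i : nat => F (i.+1%:R - D%:R - 1) - F (i%:R - D%:R - 1))); last first.
  move=> i _; rewrite rmorphB /= -!pmulrn -natr1.
  by congr (F _ - F _); ring.
have := @telescope_sumr R 0%N (D + D).+1 (fun i => F (i%:R - D%:R - 1)) (leq0n _).
rewrite /index_iota subn0 => ->.
by congr (F _ - F _); rewrite -?natr1 ?natrD; ring.
Qed.

Lemma sum_int_bound (s : seq int) (f : int -> R) (a b M : R) : 0 <= M -> uniq s -> a <= b ->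
  (forall n, n%:~R < a -> f n = 0) -> (forall n, b < n%:~R -> f n = 0) ->
  (forall n, `|f n| <= M) -> `|\sum_(n <- s) f n| <= (b - a + 1) * M.
Proof.
move=> M0 us ab fa fb fM.
apply: (@sum_bound_supp _ _ (fun n : int => a <= n%:~R <= b)) => //.
  move=> n _; rewrite negb_and -!ltNge => /orP[/fa|/fb] //.
have := @size_separated _ (seq.filter (fun n : int => a <= n%:~R <= b) s) (fun n : int => n%:~R) a b 1.
rewrite divr1; apply => //.
- exact: filter_uniq.
- by move=> n; rewrite mem_filter => /andP[].
- move=> m n _ _ mn; rewrite -rmorphB -intr_norm ler1z.
  by rewrite -gtz0_ge1 normr_gt0 subr_eq0.
Qed.

End Counting.

(** * The trapezoidal rule on the line *)

Section Trapezoid.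
Variable R : realType.
Implicit Types f g h : R -> R.

(* [CK K a A h]: [h] is of class C^K and [|h^(i)| <= a^i A] for all [i <= K]. *)
Fixpoint CK (K : nat) (a A : R) h : Prop :=
  (forall x, `|h x| <= A) /\
  if K is K'.+1 then
    exists2 h', (forall x, is_derive x (1 : R) h (h' x)) & CK K' a (a * A) h'
  else continuous h.

Lemma CK_bound K a A h x : CK K a A h -> `|h x| <= A.
Proof. by case: K => [|K] []. Qed.

Lemma CK_continuous K a A h : CK K a A h -> continuous h.
Proof. by case: K => [|K] [_] // [h' dh _]; apply: derivable_cont => x; have [] := dh x. Qed.

Lemma CK_ge0 K a A h : CK K a A h -> 0 <= A.
Proof. by move=> hK; apply: le_trans (CK_bound 0 hK). Qed.

Lemma CK_le K a A a' A' h : 0 <= a -> a <= a' -> A <= A' -> CK K a A h -> CK K a' A' h.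
Proof.
elim: K A A' h => [|K IH] A A' h a0 aa AA.
  by move=> [hA ch]; split => // x; apply: le_trans AA.
move=> hK; have A0 := CK_ge0 hK; case: hK => [hA [h' dh hK]].
split; first by move=> x; apply: le_trans AA.
exists h' => //; apply: IH hK => //.
by apply: ler_pM.
Qed.

Lemma CK_S K a A h : CK K.+1 a A h -> CK K a A h.
Proof.
elim: K A h => [|K IH] A h.
  by move=> hK; split; [move=> x; exact: CK_bound hK|exact: CK_continuous hK].
by move=> [hA [h' dh hK]]; split => //; exists h' => //; exact: IH.
Qed.

Lemma CK_add K a A B f g : CK K a A f -> CK K a B g -> CK K a (A + B) (fun x => f x + g x).
Proof.
elim: K A B f g => [|K IH] A B f g.
  move=> [fA cf] [gB cg]; split.
    by move=> x; apply: le_trans (ler_normD _ _) _; exact: lerD.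
  by move=> x; apply: cvgD; [exact: cf|exact: cg].
move=> [fA [f' df fK]] [gB [g' dg gK]]; split.
  by move=> x; apply: le_trans (ler_normD _ _) _; exact: lerD.
exists (fun x => f' x + g' x); first by move=> x; exact: is_deriveDR.
by rewrite mulrDr; exact: IH.
Qed.

Lemma CK_scale K a A c f : CK K a A f -> CK K a (`|c| * A) (fun x => c * f x).
Proof.
elim: K A f => [|K IH] A f.
  move=> [fA cf]; split; first by move=> x; rewrite normrM ler_wpM2l.
  by move=> x; apply: cvgM; [exact: cvg_cst|exact: cf].
move=> [fA [f' df fK]]; split; first by move=> x; rewrite normrM ler_wpM2l.
exists (fun x => c * f' x); first by move=> x; exact: is_deriveZR.
by rewrite mulrCA; exact: IH.
Qed.

(** Leibniz' rule in the form of the binomial theorem: the rates [a] and [b] add and the amplitudes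
    multiply. *)
Lemma CK_mul K a b A B f g : 0 <= a -> 0 <= b -> CK K a A f -> CK K b B g ->
  CK K (a + b) (A * B) (fun x => f x * g x).
Proof.
move=> a0 b0; elim: K A B f g => [|K IH] A B f g.
  move=> [fA cf] [gB cg]; split; first by move=> x; rewrite normrM ler_pM.
  by move=> x; apply: cvgM; [exact: cf|exact: cg].
move=> fK gK; have := CK_S fK; have := CK_S gK.
case: fK gK => [fA [f' df fK]] [gB [g' dg gK]] gS fS.
split; first by move=> x; rewrite normrM ler_pM.
exists (fun x => f' x * g x + f x * g' x); first by move=> x; exact: is_deriveMR.
have -> : (a + b) * (A * B) = a * A * B + A * (b * B) by ring.
by apply: CK_add; exact: IH.
Qed.

Lemma CK_affine K a A c d f : CK K a A f -> CK K (`|c| * a) A (fun x => f (c * x + d)).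
Proof.
elim: K A f => [|K IH] A f.
  move=> [fA cf]; split => //; apply: continuous_compR => //; exact: continuous_aff.
move=> [fA [f' df fK]]; split => //.
exists (fun x => c * f' (c * x + d)); first by move=> x; exact: is_derive_affine.
by rewrite -mulrA; apply: CK_scale; exact: IH.
Qed.

Lemma sc_CK K f : sc f -> exists2 A, 0 < A & CK K 1 A f.
Proof.
elim: K f => [|K IH] f sf; have [M M0 fM] := cc_bounded (sc_cc sf).
  by exists M => //; split => //; exact: (sc_cc sf).1.
have [A A0 fA] := IH _ (sc_derive sf).
exists (M + A); first exact: addr_gt0.
split; first by move=> x; apply: le_trans (fM x) _; rewrite lerDl ltW.
exists (derive1 f); first by move=> x; exact: sm_is_derive sf.1.
by apply: CK_le fA => //; rewrite mul1r lerDr ltW.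
Qed.

(** The tent function [max 0 (1 - |x|)], written as half the second difference of the absolute
    value: sums of its translates telescope and its antiderivative is explicit. *)
Definition hat (x : R) : R := (`|x + 1| - `|x| - (`|x| - `|x - 1|)) / 2.

Lemma hat_supp : bsupp 1 hat.
Proof.
move=> x; rewrite /hat lter_normr => /orP[x1|x1].
  by rewrite !ger0_norm; lra.
by rewrite !ler0_norm; lra.
Qed.

Lemma hat_ge0 x : 0 <= hat x.
Proof.
rewrite /hat.
have : `|x + x| <= `|x + 1| + `|x - 1|.
  have -> : x + x = (x + 1) + (x - 1) by ring.
  exact: ler_normD.
by rewrite -mulr2n normrMn mulr2n; lra.
Qed.

Lemma cc_hat : cc hat.
Proof.
split; last by exists 1; exact: hat_supp.
have cn : continuous (fun x : R => `|x|) by exact: norm_continuous.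
have c1 c : continuous (fun x : R => `|x + c|).
  apply: (continuous_compR cn) => x; apply: cvgD; [exact: cvg_id|exact: cvg_cst].
move=> x; apply: cvgM; last exact: cvg_cst.
by apply: cvgB; apply: cvgB; [exact: c1|exact: cn|exact: cn|exact: c1].
Qed.

(** Away from 0 the function is a polynomial near the point; at 0 the difference quotient is
    [|h| / 2]. This supplies the antiderivative of [hat]. *)
Lemma is_derive_absquare x : is_derive x (1 : R) (fun x : R => x * `|x| / 2) `|x|.
Proof.
have d2 (c : R) : is_derive x (1 : R) (fun x : R => c * (x * x)) (c * (x + x)).
  apply: is_deriveZR; have := is_deriveMR (is_derive_id x (1 : R)) (is_derive_id x (1 : R)).
  by rewrite mul1r mulr1.
case: (ltgtP x 0) => x0.
- have -> : `|x| = - 2^-1 * (x + x) by rewrite ltr0_norm //; field.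
  apply: near_eq_is_derive (d2 _).
  have : \forall y \near x, y < 0 by exact: lt_nbhsl.
  by apply: filterS => y y0; rewrite ltr0_norm //; field.
- have -> : `|x| = 2^-1 * (x + x) by rewrite gtr0_norm //; field.
  apply: near_eq_is_derive (d2 _).
  have : \forall y \near x, 0 < y by exact: lt_nbhsr.
  by apply: filterS => y y0; rewrite gtr0_norm //; field.
- rewrite x0 normr0.
  have L : (fun h : R => h^-1 * (((h * 1 + 0) * `|h * 1 + 0| / 2) - (0 * `|0 : R| / 2))) @ (0 : R)^' --> (0 : R).
    apply: (@cvg_trans _ ((fun h : R => `|h| / 2) @ (0 : R)^')); last first.
      have h0 : (fun h : R => `|h| / 2) @ (0 : R) --> (`|0 : R| / 2).
        by apply: cvgM; [exact: norm_continuous|exact: cvg_cst].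
      by rewrite normr0 mul0r in h0; exact: cvg_within_filter h0.
    apply: near_eq_cvg; near=> h.
    have h0 : h != 0 by near: h; exact: nbhs_dnbhs_neq.
    by rewrite addr0 mulr1 !mul0r subr0 mulrA mulrA mulVf // mul1r.
  apply: DeriveDef; first by apply/cvg_ex; exists 0.
  exact: cvg_lim L.
Unshelve. all: by end_near. Qed.

Lemma I1_hat : I1 hat = 1.
Proof.
pose S x : R := x * `|x| / 2.
pose F x := (S (x + 1) + (- 2) * S x + S (x - 1)) / 2.
have dS c x : is_derive x (1 : R) (fun x => S (x + c)) `|x + c|.
  have := @is_derive_affine R S 1 c x `|x + c|; rewrite !mul1r.
  by under eq_fun do rewrite mul1r; apply; exact: is_derive_absquare.
have dF x : is_derive x (1 : R) F (hat x).
  have dS0 := is_derive_absquare x.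
  have := is_deriveZR 2^-1 (is_deriveDR (is_deriveDR (dS 1 x) (is_deriveZR (-2) dS0)) (dS (-1) x)).
  have -> : 2^-1 * (`|x + 1| + -2 * `|x| + `|x - 1|) = hat x by rewrite /hat; field.
  by congr (is_derive _ _ _ _); apply/funext => y; rewrite mulrC.
rewrite (I1_FTC cc_hat.1 (bsuppW _ hat_supp) _ dF (A := 2)) //; last by lra.
rewrite /F /S.
have -> : `|- 2 + 1 : R| = 1 by rewrite ler0_norm; lra.
have -> : `|- 2 - 1 : R| = 3 by rewrite ler0_norm; lra.
have -> : `|- 2 : R| = 2 by rewrite ler0_norm; lra.
have -> : `|2 + 1 : R| = 3 by rewrite ger0_norm; lra.
have -> : `|2 - 1 : R| = 1 by rewrite ger0_norm; lra.
have -> : `|2 : R| = 2 by rewrite ger0_norm; lra.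
by field.
Qed.

(** [hat] is the backward difference of [d], so the sum telescopes; [d] equals [1/2] far to the
    right and [-1/2] far to the left. *)
Lemma sum_hat (D : nat) (s : R) : `|s| + 1 <= D%:R -> \sum_(n <- zr D) hat (n%:~R - s) = 1.
Proof.
move=> sD.
pose d x : R := (`|x + 1| - `|x|) / 2.
transitivity (\sum_(n <- zr D) (d (n%:~R - s) - d (n%:~R - 1 - s))).
  apply: eq_bigr => n _; rewrite /hat /d.
  have -> : n%:~R - 1 - s + 1 = n%:~R - s :> R by ring.
  have -> : n%:~R - 1 - s = n%:~R - s - 1 :> R by ring.
  by field.
rewrite (telescope_zr (fun x => d (x - s))) /d.
have := ler_norm s; have := ler_norm (- s); rewrite normrN => s1 s2.
rewrite (ger0_norm (x := D%:R - s + 1)); last by lra.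
rewrite (ger0_norm (x := D%:R - s)); last by lra.
rewrite (ler0_norm (x := - D%:R - 1 - s + 1)); last by lra.
rewrite (ler0_norm (x := - D%:R - 1 - s)); last by lra.
by field.
Qed.

Lemma sum_conv_hat (D : nat) h : cc h -> bsupp (D%:R - 1) h ->
  \sum_(n <- zr D) conv h hat n%:~R = I1 h.
Proof.
move=> ch hD; rewrite convC //; last exact: cc_hat.
rewrite /conv -I1_sum; last by move=> n; exact: (cc_conv_integrand _ cc_hat ch).
apply: eq_I1 => s; rewrite -mulr_suml.
case: (leP `|s| (D%:R - 1)) => sD; last by rewrite hD ?mulr0.
by rewrite sum_hat ?mul1r //; lra.
Qed.

Lemma CK_lipschitz K a A h x y : 0 <= a -> CK K.+1 a A h -> `|h x - h y| <= a * A * `|x - y|.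
Proof.
move=> a0 hK; have A0 := CK_ge0 hK; have ch := CK_continuous hK; case: hK => _ [h' dh hK].
have W z w : w < z -> `|h z - h w| <= a * A * `|z - w|.
  move=> wz; have [c _ ->] := MVT wz (fun x _ => dh x) (continuous_subspaceT ch).
  rewrite normrM; apply: ler_wpM2r => //; exact: CK_bound hK.
case: (ltgtP x y) => [xy|yx|->]; last by rewrite !subrr normr0 mulr0.
  by rewrite distrC [`|x - y|]distrC; exact: W.
exact: W.
Qed.

(** As [hat] is nonnegative with integral 1 and support in [[-1, 1]], the difference is an average
    of [h x - h (x - y)] over [|y| <= 1], and [h] has Lipschitz constant [a A]. *)
Lemma sub_conv_bound K a A h x : 0 <= a -> cc h -> CK K.+1 a A h ->
  `|h x - conv h hat x| <= a * A.
Proof.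
move=> a0 ch hK; have A0 := CK_ge0 hK; have c1 := ccZ (h x) cc_hat.
have c2 := cc_conv_integrand x ch cc_hat.
have -> : h x - conv h hat x = I1 (fun y => h x * hat y - h (x - y) * hat y).
  by rewrite (I1B c1 c2) (I1Z _ cc_hat) I1_hat mulr1.
apply: le_trans (I1_norm (ccB c1 c2)) _.
have -> : a * A = I1 (fun y => a * A * hat y) by rewrite (I1Z _ cc_hat) I1_hat mulr1.
apply: le_I1; [exact: cc_norm (ccB c1 c2)|exact: ccZ cc_hat|move=> y].
rewrite -mulrBl normrM (ger0_norm (hat_ge0 y)).
case: (ltP 1 `|y|) => [/hat_supp ->|y1]; first by rewrite !mulr0.
apply: ler_wpM2r; first exact: hat_ge0.
apply: le_trans (CK_lipschitz _ _ a0 hK) _.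
rewrite opprB addrC subrK -[leRHS]mulr1; apply: ler_wpM2l => //.
exact: mulr_ge0.
Qed.

(** Convolution commutes with differentiation, so the previous bound applies to every derivative.
    One order of smoothness is spent for one factor [a]. *)
Lemma CK_sub_conv K a A h : 0 <= a -> cc h -> CK K.+1 a A h ->
  CK K a (a * A) (fun x => h x - conv h hat x).
Proof.
move=> a0; elim: K A h => [|K IH] A h ch hK.
  split; first by move=> x; exact: sub_conv_bound hK.
  by move=> x; apply: cvgB; [exact: ch.1|exact: (cc_conv ch cc_hat).1].
split; first by move=> x; exact: sub_conv_bound hK.
case: hK => hA [h' dh hK0].
have hK : CK K.+1 a (a * A) h' by exact: hK0.
have ch' : cc h'.
  split; first exact: CK_continuous hK.
  by have [B hB] := ch.2; exists B; exact: bsupp_is_derive hB.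
exists (fun x => h' x - conv h' hat x); last exact: IH.
move=> x; have := is_deriveDR (dh x) (is_deriveZR (-1) (is_derive_conv_gen x dh ch ch' cc_hat)).
by rewrite mulN1r; congr (is_derive _ _ _ _); apply/funext => y; rewrite mulN1r.
Qed.

(* The integer samples of [h * hat] sum to the integral of [h], so that the error is the sum of the
   samples of [h - h * hat], a function of integral [0]; each such step trades a derivative for a
   factor [a]. *)
Lemma trapezoid K a A h (u v : R) (D : nat) : 0 <= a -> u <= v -> CK K.+1 a A h ->
  (forall x, x < u -> h x = 0) -> (forall x, v < x -> h x = 0) ->
  `|u| + K.+2%:R <= D%:R -> `|v| + K.+2%:R <= D%:R ->
  `|\sum_(n <- zr D) h n%:~R - I1 h| <= (v - u + (K + K + 3)%:R) * (a ^+ K.+1 * A).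
Proof.
move=> a0; elim: K A h u v => [|K IH] A h u v uv hK hu hv uD vD.
all: have A0 := CK_ge0 hK.
all: have := ler_norm (- u); have := ler_norm u; rewrite normrN => u1 u2.
all: have := ler_norm (- v); have := ler_norm v; rewrite normrN => v1 v2.
all: rewrite -!natr1 in uD vD.
2: have k0 : (0 : R) <= K%:R by exact: ler0n.
all: have hD : bsupp (D%:R - 1) h by move=> x; rewrite lter_normr => /orP[?|?]; [apply: hv|apply: hu]; lra.
all: have ch : cc h by split; [exact: CK_continuous hK|exists (D%:R - 1)].
all: have gK := CK_sub_conv a0 ch hK.
all: have sub0 : (forall x, x < u - 1 -> h x - conv h hat x = 0) /\ (forall x, v + 1 < x -> h x - conv h hat x = 0).
1,3: split => x xu; [rewrite hu; last lra|rewrite hv; last lra]; rewrite sub0r; apply/eqP; rewrite oppr_eq0; apply/eqP; rewrite /conv -[RHS](I10 R); apply: eq_I1 => y;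
  (case: (ltP 1 `|y|) => [/hat_supp ->|]; [by rewrite mulr0|rewrite ler_norml => /andP[y1 y2]]); [rewrite hu ?mul0r //; lra|rewrite hv ?mul0r //; lra].
all: case: sub0 => su sv.
all: rewrite -(sum_conv_hat ch hD) -sumrB.
(* Convolution with [hat] widens the support by 1 at each end, and an interval of length [l]
   contains at most [l + 1] integers: hence 3 here, and 2 more for each further step. *)
- rewrite expr1; have -> : v - u + (0 + 0 + 3)%:R = (v + 1) - (u - 1) + 1 by rewrite !add0n; ring.
  apply: sum_int_bound => //; first exact: mulr_ge0.
  + exact: uniq_zr.
  + lra.
  + by move=> n; exact: su.
  + by move=> n; exact: sv.
  + by move=> n; exact: CK_bound gK.
- have I0 : I1 (fun x => h x - conv h hat x) = 0.
    rewrite (I1B ch (cc_conv ch cc_hat)) (I1_conv ch cc_hat) I1_hat mulr1 subrr //.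
  have := IH _ _ (u - 1) (v + 1) _ gK su sv; rewrite I0 subr0 => IH'.
  apply: le_trans (IH' _ _ _) _.
  + lra.
  + have : `|u - 1| <= `|u| + 1 by apply: le_trans (ler_normB _ _) _; rewrite normr1.
    rewrite -!natr1; lra.
  + have : `|v + 1| <= `|v| + 1 by apply: le_trans (ler_normD _ _) _; rewrite normr1.
    rewrite -!natr1; lra.
  + rewrite [a ^+ K.+2]exprSr -mulrA; apply: ler_wpM2r.
      by rewrite !mulr_ge0 // exprn_ge0.
    rewrite !natrD -!natr1; lra.
Qed.

End Trapezoid.

(** * Badly approximable numbers and the lattice *)

Section Diophantine.
Variable R : realType.

Lemma dist_int_le (x : R) (m : int) : dist_int x <= `|x - m%:~R|.
Proof.
apply: ge_inf; last by exists m.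
by exists 0 => _ [k _ <-].
Qed.

Definition badly_approximable_by (c0 alpha : R) :=
  forall q p : int, q != 0 -> c0 <= `|q%:~R| * `|q%:~R * alpha - p%:~R|.

(** Passage to all nonzero integers and arbitrary numerators, without the infimum. The cap at 1
    makes [4 / c0] an upper bound also for the absolute constants from Dirichlet's theorem. *)
Lemma badly_approximableP (alpha : R) : badly_approximable alpha ->
  exists c0, [/\ 0 < c0, c0 <= 1 & badly_approximable_by c0 alpha].
Proof.
move=> [c c_gt0 hc]; exists (Num.min c 1); split.
- by rewrite lt_min c_gt0 ltr01.
- by rewrite ge_min lexx orbT.
move=> q p q0; rewrite ge_min; apply/orP; left.
have k0 : (0 < absz q)%N by rewrite absz_gt0.
apply: le_trans (hc _ k0) _.
have -> : `|q%:~R| = (absz q)%:R :> R by rewrite -intr_norm pmulrn abszE.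
apply: ler_wpM2l => //.
case: (intP q) q0 k0 => [//|n|n] _ _.
  by apply: le_trans (dist_int_le _ p) _; rewrite absz_nat pmulrn.
apply: le_trans (dist_int_le _ (- p)) _.
rewrite abszN absz_nat -normrN.
have -> : - (n.+1%:R * alpha - (- p)%:~R) = (- n.+1%:Z)%:~R * alpha - p%:~R.
  by rewrite !rmorphN /= -pmulrn; ring.
by [].
Qed.

(** Pigeonhole principle: among the fractional parts of [i alpha] for [i = 0, ..., n], two fall into
    the same of [n] intervals of length [1/n]. *)
Lemma dirichlet (alpha : R) (n : nat) : (0 < n)%N ->
  exists q p : int, [/\ 0 < q, q <= n%:Z & `|q%:~R * alpha - p%:~R| <= n%:R^-1].
Proof.
move=> n0.
pose fr (i : nat) : R := i%:R * alpha - (Num.floor (i%:R * alpha))%:~R.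
have fr01 i : 0 <= fr i < 1.
  have /andP[h1 h2] := floor_itv (i%:R * alpha).
  by rewrite rmorphD /= in h2; apply/andP; split; rewrite /fr; lra.
have n0R : (0 : R) < n%:R by rewrite ltr0n.
have nfr0 i : 0 <= n%:R * fr i by have /andP[? ?] := fr01 i; rewrite mulr_ge0 // ltW.
have lt i : (Num.truncn (n%:R * fr i) < n)%N.
  rewrite -(prednK n0) ltnS truncn_le_nat prednK //.
  by have /andP[_ ?] := fr01 i; rewrite gtr_pMr.
have main (i j : nat) : (i < j)%N -> (j <= n)%N ->
    Num.truncn (n%:R * fr i) = Num.truncn (n%:R * fr j) ->
    exists q p : int, [/\ 0 < q, q <= n%:Z & `|q%:~R * alpha - p%:~R| <= n%:R^-1].
  move=> ij jn tE; exists (j%:Z - i%:Z), (Num.floor (j%:R * alpha) - Num.floor (i%:R * alpha)).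
  split; [lia|lia|].
  have -> : (j%:Z - i%:Z)%:~R * alpha - (Num.floor (j%:R * alpha) - Num.floor (i%:R * alpha))%:~R = fr j - fr i.
    by rewrite /fr !rmorphB /= -!pmulrn; ring.
  have /andP[i1 i2] := truncn_itv (nfr0 i); have /andP[j1 j2] := truncn_itv (nfr0 j).
  rewrite -tE -natr1 in j1 j2; rewrite -natr1 in i2.
  rewrite -(ler_pM2l n0R) divff ?gt_eqF // -[X in X * `|_|](gtr0_norm n0R) -normrM.
  by rewrite ler_norml mulrBr; apply/andP; split; lra.
pose f (i : 'I_n.+1) : 'I_n := Ordinal (lt i).
case: (boolP (injectiveb f)) => [/injectiveP /leq_card|/injectivePn[i [j ij fij]]].
  by rewrite !card_ord ltnn.
have tE : Num.truncn (n%:R * fr i) = Num.truncn (n%:R * fr j) by exact: (congr1 val fij).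
case: (ltngtP i j) => [ltij|ltji|E].
- by apply: main ltij _ tE; rewrite -ltnS.
- by apply: main ltji _ (esym tE); rewrite -ltnS.
- by move: ij; rewrite -val_eqE /= E eqxx.
Qed.

(* Dirichlet's theorem gives [(q, p)], and Bezout's identity completes it to a unimodular matrix. *)
Lemma reduced_basis (alpha c0 Q : R) : 0 < c0 -> badly_approximable_by c0 alpha -> 1 <= Q ->
  exists q p q' p' : int, [/\ q * p' - q' * p = 1, 0 < q,
    `|q%:~R| <= Q, `|q'%:~R| <= Q & 
     `|q%:~R * alpha - p%:~R| <= 2 / Q /\ `|q'%:~R * alpha - p'%:~R| <= 4 / (c0 * Q)].
Proof.
move=> c0_gt0 hb Q1.
pose n := Num.truncn Q.
have /andP[nQ Qn] : n%:R <= Q < n.+1%:R by apply: truncn_itv; lra.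
have n0 : (0 < n)%N by rewrite truncn_gt_nat.
have n0R : (1 : R) <= n%:R by rewrite ler1n.
have [q0 [p0 [q0_gt0 q0n e0]]] := dirichlet alpha n0.
pose d := gcdz q0 p0.
have d0 : 0 < d by rewrite lt_neqAle eq_sym gcdz_eq0 negb_and gt_eqF.
have [q qE] := dvdzP (dvdz_gcdl q0 p0).
have [p pE] := dvdzP (dvdz_gcdr q0 p0).
rewrite -/d in qE pE.
have q_gt0 : 0 < q by rewrite qE pmulr_lgt0 in q0_gt0.
have d1 : 1 <= d by lia.
have qn : q <= n%:Z by apply: le_trans q0n; rewrite qE; nia.
have d1R : (1 : R) <= d%:~R by rewrite ler1z.
have e : `|q%:~R * alpha - p%:~R| <= n%:R^-1.
  apply: le_trans e0; rewrite qE pE !rmorphM /=.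
  have -> : q%:~R * d%:~R * alpha - p%:~R * d%:~R = (q%:~R * alpha - p%:~R) * d%:~R by ring.
  by rewrite normrM ler_peMr // (le_trans d1R) // ler_norm.
have [u [v uv]] : exists u v : int, u * q - v * p = 1.
  have [u [v uvd]] := Bezoutz q0 p0.
  exists u, (- v); apply: (mulIf (x := d)); first by rewrite gt_eqF.
  by rewrite mul1r -/d -[RHS]uvd [in RHS]qE [in RHS]pE; ring.
(* A multiple of the first vector is subtracted from the second: the determinant is kept, and
   [0 <= q' < q] bounds the new first coordinate by [Q]. *)
pose q' := (v %% q)%Z; pose p' := u - (v %/ q)%Z * p.
have qE' : q' = v - (v %/ q)%Z * q by rewrite /q' {2}(divz_eq v q); ring.
have q'0 : 0 <= q' by apply: modz_ge0; rewrite gt_eqF.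
have q'q : q' < q by apply: ltz_pmod.
have det : q * p' - q' * p = 1 by rewrite qE' /p' -uv; ring.
exists q, p, q', p'.
have qnR : q%:~R <= n%:R :> R by rewrite pmulrn ler_int.
have q'qR : q'%:~R <= q%:~R :> R by rewrite ler_int ltW.
have q0R : (0 : R) < q%:~R by rewrite ltr0z.
have q'0R : (0 : R) <= q'%:~R by rewrite ler0z.
have detR : q%:~R * p'%:~R - q'%:~R * p%:~R = 1 :> R.
  by rewrite -!rmorphM -rmorphB /= det.
split => //.
- by rewrite gtr0_norm //; lra.
- by rewrite ger0_norm //; lra.
have Q0 : 0 < Q by lra.
rewrite -natr1 in Qn.
have nQ2 : n%:R^-1 <= 2 / Q.
  by rewrite ler_pdivlMr // mulrC ler_pdivrMr; lra.
split; first exact: le_trans e nQ2.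
have h1 := hb q p (lt0r_neq0 q_gt0); rewrite gtr0_norm // in h1.
set ee := `|q%:~R * alpha - p%:~R| in e h1 *.
have ee0 : 0 <= ee by exact: normr_ge0.
have en : ee * n%:R <= 1 by rewrite -ler_pdivlMr ?mul1r //; lra.
(* Bad approximability forbids a small denominator with an error as small as [1/n]. *)
have qc : c0 * n%:R <= q%:~R.
  apply: (@le_trans _ _ (q%:~R * ee * n%:R)).
    by apply: ler_wpM2r => //; lra.
  by rewrite -mulrA ler_piMr // ltW.
(* The determinant 1 expresses [q (q' alpha - p')] as [q' (q alpha - p) - 1]; since [q] is at least
   [c0 n], the second error is again of order [1 / Q]. *)
have : q%:~R * `|q'%:~R * alpha - p'%:~R| <= 2.
  have -> : q%:~R * `|q'%:~R * alpha - p'%:~R| = `|q'%:~R * (q%:~R * alpha - p%:~R) - 1|.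
    rewrite -{1}(gtr0_norm q0R) -normrM; congr `|_|.
    by rewrite -[X in _ = _ - X]detR; ring.
  apply: le_trans (ler_normB _ _) _; rewrite normr1 normrM (ger0_norm q'0R) -/ee.
  have : q'%:~R * ee <= 1.
    by apply: le_trans en; rewrite mulrC; apply: ler_wpM2l => //; lra.
  lra.
set e' := `|q'%:~R * alpha - p'%:~R| => h2.
have e'0 : 0 <= e' by exact: normr_ge0.
rewrite ler_pdivlMr; last by rewrite mulr_gt0.
apply: (@le_trans _ _ (e' * (2 * q%:~R))); last by lra.
apply: ler_wpM2l => //.
apply: (@le_trans _ _ (c0 * (2 * n%:R))); last by lra.
by apply: ler_wpM2l; [exact: ltW|lra].
Qed.

End Diophantine.

(** * The trapezoidal rule in the plane and linear substitutions *)

Section PlaneLattice.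
Variable R : realType.

Lemma big_supp_eq (T : eqType) (s s' : seq T) (F : T -> R) : uniq s -> uniq s' ->
  (forall x, F x != 0 -> x \in s) -> (forall x, F x != 0 -> x \in s') ->
  \sum_(x <- s) F x = \sum_(x <- s') F x.
Proof.
move=> us us' hs hs'.
have E t : \sum_(x <- t) F x = \sum_(x <- seq.filter (fun x => F x != 0) t) F x.
  rewrite big_filter [LHS](bigID (fun x => F x != 0)) /= [X in _ + X]big1 ?addr0 //.
  by move=> x; rewrite negbK => /eqP.
rewrite E [RHS]E; apply: perm_big; apply: uniq_perm; try exact: filter_uniq.
by move=> x; rewrite !mem_filter; case: eqP => //= /eqP Fx; rewrite hs ?hs'.
Qed.

(** The error splits into a sum over [i] of errors in the second variable and an integral over [t]
    of errors in the first. The sum has at most [2 rho + 1] nonzero terms and the integral runs over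
    length [2 rho], which gives [4 rho + 1] times the error on the line. *)
Lemma plane_trapezoid K (a A s0 t0 rho : R) (G : R -> R -> R) (D : nat) :
  0 <= a -> 0 <= rho -> cc2 G ->
  (forall t, CK K.+1 a A (G^~ t)) -> (forall s, CK K.+1 a A (G s)) ->
  (forall s t, G s t != 0 -> `|s - s0| <= rho /\ `|t - t0| <= rho) ->
  `|s0| + rho + K.+2%:R <= D%:R -> `|t0| + rho + K.+2%:R <= D%:R ->
  `|\sum_(i <- zr D) \sum_(j <- zr D) G i%:~R j%:~R - I2 G| <=
    (4 * rho + 1) * ((2 * rho + (K + K + 3)%:R) * (a ^+ K.+1 * A)).
Proof.
move=> a0 rho0 cG C1 C2 supp sD tD.
set B := (2 * rho + (K + K + 3)%:R) * (a ^+ K.+1 * A).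
have A0 := CK_ge0 (C1 0).
have B0 : 0 <= B by rewrite !mulr_ge0 // ?exprn_ge0 // addr_ge0 // mulr_ge0.
have G0s s t : rho < `|s - s0| -> G s t = 0.
  by move=> h; apply/eqP; apply: contraT => /supp[]; rewrite leNgt h.
have G0t s t : rho < `|t - t0| -> G s t = 0.
  by move=> h; apply/eqP; apply: contraT => /supp[_]; rewrite leNgt h.
have far (x x0 : R) : (x < x0 - rho) || (x0 + rho < x) -> rho < `|x - x0|.
  by rewrite lter_normr => /orP[?|?]; apply/orP; [right|left]; lra.
have nb (x0 : R) : `|x0| + rho + K.+2%:R <= D%:R ->
  `|x0 - rho| + K.+2%:R <= D%:R /\ `|x0 + rho| + K.+2%:R <= D%:R.
  move=> h; split.
    by have := ler_normB x0 rho; rewrite (ger0_norm rho0); lra.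
  by have := ler_normD x0 rho; rewrite (ger0_norm rho0); lra.
have T1 t : `|\sum_(i <- zr D) G i%:~R t - I1 (G^~ t)| <= B.
  have [h1 h2] := nb _ sD.
  have -> : B = ((s0 + rho) - (s0 - rho) + (K + K + 3)%:R) * (a ^+ K.+1 * A).
    by rewrite /B; congr (_ * _); ring.
  apply: trapezoid (C1 t) _ _ h1 h2 => //; first by lra.
    by move=> x hx; apply: G0s; apply: far; rewrite hx.
  by move=> x hx; apply: G0s; apply: far; rewrite hx orbT.
have T2 s : `|\sum_(i <- zr D) G s i%:~R - I1 (G s)| <= B.
  have [h1 h2] := nb _ tD.
  have -> : B = ((t0 + rho) - (t0 - rho) + (K + K + 3)%:R) * (a ^+ K.+1 * A).
    by rewrite /B; congr (_ * _); ring.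
  apply: trapezoid (C2 s) _ _ h1 h2 => //; first by lra.
    by move=> x hx; apply: G0t; apply: far; rewrite hx.
  by move=> x hx; apply: G0t; apply: far; rewrite hx orbT.
have cS : cc (fun t => \sum_(i <- zr D) G i%:~R t).
  by apply: cc_sum => i; exact: cc2_l.
have cI : cc (fun t => I1 (G^~ t)) by exact: (cc2_I1 (cc2_swap cG)).
have -> : \sum_(i <- zr D) \sum_(j <- zr D) G i%:~R j%:~R - I2 G =
  \sum_(i <- zr D) (\sum_(j <- zr D) G i%:~R j%:~R - I1 (G i%:~R)) +
  I1 (fun t => \sum_(i <- zr D) G i%:~R t - I1 (G^~ t)).
  rewrite (I1B cS cI) I1_sum; last by move=> i; exact: cc2_l.
  rewrite sumrB (I2_swap cG) /I2; ring.
apply: le_trans (ler_normD _ _) _.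
have -> : (4 * rho + 1) * B = (s0 + rho - (s0 - rho) + 1) * B + B * (t0 + rho - (t0 - rho)) by ring.
apply: lerD.
  apply: sum_int_bound => //; [exact: uniq_zr|lra| |].
  - move=> n hn; rewrite big1 ?sub0r; last by move=> j _; rewrite G0s // far // hn.
    apply/eqP; rewrite oppr_eq0; apply/eqP; rewrite -[RHS](I10 R).
    by apply: eq_I1 => t; rewrite G0s // far // hn.
  - move=> n hn; rewrite big1 ?sub0r; last by move=> j _; rewrite G0s // far // hn orbT.
    apply/eqP; rewrite oppr_eq0; apply/eqP; rewrite -[RHS](I10 R).
    by apply: eq_I1 => t; rewrite G0s // far // hn orbT.
apply: I1_bound => //; [lra|exact: ccB| |].
- move=> t ht; rewrite big1 ?sub0r; last by move=> j _; rewrite G0t // far // ht.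
  apply/eqP; rewrite oppr_eq0; apply/eqP; rewrite -[RHS](I10 R).
  by apply: eq_I1 => s; rewrite G0t // far // ht.
- move=> t ht; rewrite big1 ?sub0r; last by move=> j _; rewrite G0t // far // ht orbT.
  apply/eqP; rewrite oppr_eq0; apply/eqP; rewrite -[RHS](I10 R).
  by apply: eq_I1 => s; rewrite G0t // far // ht orbT.
Qed.

(** Cramer's rule: if both linear forms are bounded, so are [s] and [t]. *)
Lemma cc2_linear (f g : R -> R) (x1 x2 z1 z2 : R) : cc f -> cc g ->
  x1 * z2 - x2 * z1 != 0 ->
  cc2 (fun s t => f (x1 * s + x2 * t) * g (z1 * s + z2 * t)).
Proof.
move=> cf cg; set d := x1 * z2 - x2 * z1 => d0.
have [A A0 fA] := cc_bsupp cf; have [B B0 gB] := cc_bsupp cg.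
have cl (x y : R) : continuous (fun z : R * R => x * z.1 + y * z.2).
  move=> z; apply: cvgD; (apply: cvgM; first exact: cvg_cst); [exact: cvg_fst|exact: cvg_snd].
split.
  have c1 := continuous_compR cf.1 (cl x1 x2); have c2 := continuous_compR cg.1 (cl z1 z2).
  by move=> z; apply: cvgM; [exact: c1|exact: c2].
pose C := (`|z1| + `|z2| + `|x1| + `|x2|) * (A + B) / `|d|.
have d0' : 0 < `|d| by rewrite normr_gt0.
exists C => s t st; apply/eqP; apply: contraT; rewrite mulf_eq0 negb_or => /andP[f0 g0].
have h1 : `|x1 * s + x2 * t| <= A by rewrite leNgt; apply: contra f0 => /fA ->.
have h2 : `|z1 * s + z2 * t| <= B by rewrite leNgt; apply: contra g0 => /gB ->.
set u := x1 * s + x2 * t in h1; set w := z1 * s + z2 * t in h2.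
have key (x y v : R) : v * d = x * u - y * w -> `|x| + `|y| <= `|z1| + `|z2| + `|x1| + `|x2| -> `|v| <= C.
  move=> E xy; rewrite /C ler_pdivlMr // -normrM E.
  apply: le_trans (ler_normB _ _) _; rewrite !normrM.
  apply: (@le_trans _ _ (`|x| * (A + B) + `|y| * (A + B))).
    by apply: lerD; apply: ler_wpM2l => //; lra.
  by rewrite -mulrDl; apply: ler_wpM2r => //; lra.
have n1 := normr_ge0 z1; have n2 := normr_ge0 z2; have n3 := normr_ge0 x1; have n4 := normr_ge0 x2.
have hs : `|s| <= C by apply: (key z2 x2); [rewrite /d /u /w; ring|lra].
have ht : `|t| <= C by apply: (key (- z1) (- x1)); [rewrite /d /u /w; ring|rewrite !normrN; lra].
by move: st; rewrite !ltNge hs ht.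
Qed.

(** Two substitutions on the line: [r = x1 s + x2 t] for fixed [t], then, after exchanging the
    integrals, one in [t] with slope [dl], the determinant divided by [x1]. *)
Lemma I2_linear (f g : R -> R) (x1 x2 z1 z2 : R) : cc f -> cc g -> x1 != 0 ->
  x1 * z2 - x2 * z1 != 0 ->
  I2 (fun s t => f (x1 * s + x2 * t) * g (z1 * s + z2 * t)) =
  `|x1 * z2 - x2 * z1|^-1 * (I1 f * I1 g).
Proof.
move=> cf cg x10 d0; have c2 := cc2_linear cf cg d0.
rewrite (I2_swap c2).
pose dl := z2 - z1 / x1 * x2.
have dlE : dl * x1 = x1 * z2 - x2 * z1 by rewrite /dl; field.
have dl0 : dl != 0 by apply: contra d0 => /eqP dl0; rewrite -dlE dl0 mul0r.
have c3 : cc2 (fun r t => f (1 * r + 0 * t) * g (z1 / x1 * r + dl * t)).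
  by apply: cc2_linear => //; rewrite mul1r mul0r subr0.
have cf' t : cc (fun r => f r * g (z1 / x1 * r + dl * t)).
  have := cc2_r t c3; congr cc; apply/funext => r; by rewrite mul1r mul0r addr0.
have E t : I1 (fun s => f (x1 * s + x2 * t) * g (z1 * s + z2 * t)) =
   `|x1|^-1 * I1 (fun r => f r * g (z1 / x1 * r + dl * t)).
  rewrite -(I1_affine (x2 * t) x10 (cf' t)); apply: eq_I1 => s.
  by congr (_ * g _); rewrite /dl; field.
rewrite /I2 (eq_I1 E).
rewrite I1Z; last first.
  have := cc2_I1 (cc2_swap c3); congr cc; apply/funext => t.
  by apply: eq_I1 => r; rewrite mul1r mul0r addr0.
have -> : I1 (fun t => I1 (fun r => f r * g (z1 / x1 * r + dl * t))) =
   I2 (fun t r => f (1 * r + 0 * t) * g (z1 / x1 * r + dl * t)).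
  by apply: eq_I2 => t r; rewrite mul1r mul0r addr0.
rewrite -(I2_swap c3) -dlE normrM invfM [X in _ = X * _]mulrC -mulrA; congr (_ * _).
have -> : `|dl|^-1 * (I1 f * I1 g) = I1 f * (`|dl|^-1 * I1 g) by ring.
rewrite -I1Zr //; apply: eq_I1 => r.
rewrite -(I1_affine (z1 / x1 * r) dl0 cg) -I1Z; last exact: cc_affine.
by apply: eq_I1 => t; rewrite mul1r mul0r addr0 addrC.
Qed.

End PlaneLattice.

(** * Lattice sums against a product of two kernels *)

Section LatticeSums.
Variable R : realType.

(** The lattice spanned by [(1/N, alpha)] and [(0, -1)], of covolume [1/N]; its points in the
    half-open unit square are those of [kronecker_set]. *)
Definition lat (alpha : R) (N : nat) (z : int * int) : R * R :=
  (z.1%:~R / N%:R, z.1%:~R * alpha - z.2%:~R).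

(** Let [h^2 = a1 a2 / N <= 1]. In coordinates of a reduced basis, the product of the kernels varies
    at rate of order [h] and is supported in a square of side of order [1/h]. The trapezoidal rule
    in the plane costs [h^-2] and gains [h^(K+1)]; with the factor [1/N] the cost becomes
    [1 / (a1 a2)]. *)
Lemma lattice_low (alpha c0 r : R) (K : nat) : 0 < c0 -> c0 <= 1 ->
  badly_approximable_by c0 alpha -> 0 < r -> exists2 C, 0 < C &
  forall (N : nat) (a1 a2 A1 A2 : R) (f1 f2 : R -> R) (y1 y2 : R) (idx : seq (int * int)),
    (0 < N)%N -> 1 <= a1 -> 1 <= a2 -> a1 * a2 <= N%:R ->
    CK K.+1 a1 A1 f1 -> CK K.+1 a2 A2 f2 -> bsupp (r / a1) f1 -> bsupp (r / a2) f2 ->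
    uniq idx ->
    (forall z, f1 ((lat alpha N z).1 - y1) * f2 ((lat alpha N z).2 - y2) != 0 -> z \in idx) ->
    `|I1 f1 * I1 f2 - N%:R^-1 * \sum_(z <- idx) f1 ((lat alpha N z).1 - y1) * f2 ((lat alpha N z).2 - y2)|
      <= C * (A1 * A2 / (a1 * a2)) * (Num.sqrt (a1 * a2 / N%:R)) ^+ K.+1.
Proof.
move=> c0_gt0 c01 hba r0.
pose Cb : R := 4 / c0; pose c2 := r * (1 + Cb).
have Cb4 : 4 <= Cb by rewrite /Cb ler_pdivlMr //; lra.
have c20 : 0 < c2 by rewrite mulr_gt0 //; lra.
pose C := (4 * c2 + 1) * (2 * c2 + (K + K + 3)%:R) * (1 + Cb) ^+ K.+1.
have k0 : (0 : R) <= (K + K + 3)%:R by exact: ler0n.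
exists C; first by rewrite !mulr_gt0 ?exprn_gt0 //; lra.
move=> N a1 a2 A1 A2 f1 f2 y1 y2 idx N0 a11 a21 aN f1K f2K f1r f2r uidx cov.
have NR0 : (0 : R) < N%:R by rewrite ltr0n.
have a10 : 0 < a1 by lra.
have a20 : 0 < a2 by lra.
set h := Num.sqrt (a1 * a2 / N%:R).
have h2 : h ^+ 2 = a1 * a2 / N%:R by rewrite sqr_sqrtr // divr_ge0 ?mulr_ge0 // ltW.
have h0 : 0 < h by rewrite sqrtr_gt0 divr_gt0 // mulr_gt0.
have h1 : h <= 1.
  rewrite -(@ler_pXn2r _ 2) ?nnegrE ?(ltW h0) // h2 expr1n ler_pdivrMr // mul1r //.
(* Balances the two components of the basis vectors: relative to the box they are of size [a1 Q / N]
   and [a2 / Q], and both equal [h]. *)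
pose Q := N%:R * h / a1.
have QE : a1 * Q / N%:R = h by rewrite /Q; field; rewrite !gt_eqF.
have a2Q : a2 / Q = h.
  rewrite /Q; apply: (mulIf (x := h)); first by rewrite gt_eqF.
  by rewrite -[RHS]expr2 h2; field; rewrite !gt_eqF.
have Q0 : 0 < Q by rewrite divr_gt0 // mulr_gt0.
have Q1 : 1 <= Q.
  have : h <= a2 by lra.
  by rewrite -a2Q ler_pdivrMr // -{1}[a2]mulr1 ler_pM2l.
have [q [p [q' [p' [det q0 qQ q'Q [eQ e'Q]]]]]] := reduced_basis c0_gt0 hba Q1.
pose x1 : R := q%:~R / N%:R; pose x2 : R := q'%:~R / N%:R.
pose z1 : R := q%:~R * alpha - p%:~R; pose z2 : R := q'%:~R * alpha - p'%:~R.
have detR : x1 * z2 - x2 * z1 = - N%:R^-1.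
  have dR : q%:~R * p'%:~R - q'%:~R * p%:~R = 1 :> R by rewrite -!rmorphM -rmorphB /= det.
  rewrite /x1 /x2 /z1 /z2.
  transitivity (- (q%:~R * p'%:~R - q'%:~R * p%:~R) / N%:R : R); last by rewrite dR mulN1r.
  by field; rewrite gt_eqF.
have x10 : x1 != 0 by rewrite mulf_neq0 ?invr_eq0 ?gt_eqF // ?ltr0z.
have det0 : x1 * z2 - x2 * z1 != 0 by rewrite detR oppr_eq0 invr_eq0 gt_eqF.
have bx1 : `|x1| * a1 <= h.
  rewrite -QE normrM normfV (gtr0_norm NR0) mulrAC ler_pM2r ?invr_gt0 // mulrC ler_pM2l //.
have bx2 : `|x2| * a1 <= h.
  rewrite -QE normrM normfV (gtr0_norm NR0) mulrAC ler_pM2r ?invr_gt0 // mulrC ler_pM2l //.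
have bz (z : R) : `|z| <= Cb / Q -> `|z| * a2 <= Cb * h.
  by move=> hz; rewrite -a2Q mulrA mulrAC ler_pM2r.
have bz1 : `|z1| * a2 <= Cb * h.
  apply: bz; apply: le_trans eQ _; rewrite ler_pM2r ?invr_gt0 //; clear -Cb4; lra.
have bz2 : `|z2| * a2 <= Cb * h.
  apply: bz; apply: le_trans e'Q _; rewrite /Cb invfM mulrA //.
pose G s t := f1 (x1 * s + x2 * t - y1) * f2 (z1 * s + z2 * t - y2).
have cf1 : cc f1 by split; [exact: CK_continuous f1K|exists (r / a1)].
have cf2 : cc f2 by split; [exact: CK_continuous f2K|exists (r / a2)].
have cG : cc2 G := cc2_linear (cc_shift y1 cf1) (cc_shift y2 cf2) det0.
have IG : I2 G = N%:R * (I1 f1 * I1 f2).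
  have := I2_linear (cc_shift y1 cf1) (cc_shift y2 cf2) x10 det0.
  by rewrite detR normrN normfV invrK (gtr0_norm NR0) !I1_shift.
pose a := (1 + Cb) * h.
have a0 : 0 <= a by rewrite mulr_ge0 ?(ltW h0) //; clear -Cb4; lra.
have A10 := CK_ge0 f1K; have A20 := CK_ge0 f2K.
have CKG (u v w z : R) : `|u| * a1 <= h -> `|w| * a2 <= Cb * h ->
  CK K.+1 a (A1 * A2) (fun s => f1 (u * s + v) * f2 (w * s + z)).
  move=> hu hw.
  have := @CK_mul R K.+1 _ _ _ _ _ _ _ _ (CK_affine u v f1K) (CK_affine w z f2K).
  move=> /(_ (mulr_ge0 (normr_ge0 _) (ltW a10)) (mulr_ge0 (normr_ge0 _) (ltW a20))).
  apply: CK_le => //; first by rewrite addr_ge0 // mulr_ge0 // ltW.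
  by rewrite /a mulrDl mul1r; exact: lerD.
have G1 t : CK K.+1 a (A1 * A2) (G^~ t).
  have := CKG x1 (x2 * t - y1) z1 (z2 * t - y2) bx1 bz1.
  by congr CK; apply/funext => s; rewrite /G !addrA.
have G2 s : CK K.+1 a (A1 * A2) (G s).
  have := CKG x2 (x1 * s - y1) z2 (z1 * s - y2) bx2 bz2.
  by congr CK; apply/funext => t; rewrite /G; congr (f1 _ * f2 _); ring.
(* Radius of the support in lattice coordinates. By Cramer's rule these are [N] times a combination
   of offsets of size [r / a1], [r / a2] with basis components of size [h / a2], [h / a1], hence of
   order [N h / (a1 a2) = 1 / h]. *)
pose rho := c2 / h.
have rho0 : 0 <= rho by rewrite divr_ge0 // ltW.
pose s0 := N%:R * (x2 * y2 - z2 * y1); pose t0 := N%:R * (z1 * y1 - x1 * y2).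
have rhoE (u w x z : R) : `|u| <= r / a1 -> `|w| <= r / a2 -> `|x| * a1 <= h -> `|z| * a2 <= Cb * h ->
   `|N%:R * (x * w - z * u)| <= rho.
  move=> hu hw hx hz.
  have hx' : `|x| <= h / a1 by rewrite ler_pdivlMr.
  have hz' : `|z| <= Cb * h / a2 by rewrite ler_pdivlMr.
  rewrite normrM (gtr0_norm NR0).
  apply: (@le_trans _ _ (N%:R * (h / a1 * (r / a2) + Cb * h / a2 * (r / a1)))).
    rewrite ler_pM2l //; apply: le_trans (ler_normB _ _) _; rewrite !normrM.
    by apply: lerD; apply: ler_pM.
  rewrite le_eqVlt; apply/orP; left; apply/eqP.
  rewrite /rho /c2; apply: (mulIf (x := h * (a1 * a2) / N%:R)).
    by rewrite !mulf_neq0 ?invr_eq0 // gt_eqF.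
  transitivity (h ^+ 2 * (r * (1 + Cb))); first by field; rewrite !gt_eqF.
  by rewrite h2; field; rewrite !gt_eqF.
have supp s t : G s t != 0 -> `|s - s0| <= rho /\ `|t - t0| <= rho.
  rewrite /G mulf_eq0 negb_or => /andP[g1 g2].
  set u := x1 * s + x2 * t - y1 in g1; set w := z1 * s + z2 * t - y2 in g2.
  have hu : `|u| <= r / a1 by rewrite leNgt; apply: contra g1 => /f1r ->.
  have hw : `|w| <= r / a2 by rewrite leNgt; apply: contra g2 => /f2r ->.
  have dN : N%:R * (x1 * z2 - x2 * z1) = -1 by rewrite detR mulrN divff // gt_eqF.
  split.
    have -> : s - s0 = N%:R * (x2 * w - z2 * u).
      rewrite /s0 /u /w; transitivity (- (N%:R * (x1 * z2 - x2 * z1)) * s - N%:R * (x2 * y2 - z2 * y1)); last by ring.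
      by rewrite dN opprK mul1r.
    exact: rhoE.
  have -> : t - t0 = - (N%:R * (x1 * w - z1 * u)).
    rewrite /t0 /u /w; transitivity (- (N%:R * (x1 * z2 - x2 * z1)) * t - N%:R * (z1 * y1 - x1 * y2)); last by ring.
    by rewrite dN opprK mul1r.
  by rewrite normrN; exact: rhoE.
pose D := Num.truncn (`|s0| + `|t0| + rho + K.+2%:R + 1).
have k20 : (0 : R) <= K.+2%:R by exact: ler0n.
have nn1 := normr_ge0 s0; have nn2 := normr_ge0 t0.
have DD : `|s0| + `|t0| + rho + K.+2%:R <= D%:R.
  have := truncnS_gt (`|s0| + `|t0| + rho + K.+2%:R + 1); rewrite -/D -natr1; clear; lra.
have E := plane_trapezoid a0 rho0 cG G1 G2 supp.
have {}E : `|\sum_(i <- zr D) \sum_(j <- zr D) G i%:~R j%:~R - I2 G| <=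
    (4 * rho + 1) * ((2 * rho + (K + K + 3)%:R) * (a ^+ K.+1 * (A1 * A2))).
  by apply: E; clear -DD nn1 nn2 k20 rho0; lra.
pose F (z : int * int) := f1 ((lat alpha N z).1 - y1) * f2 ((lat alpha N z).2 - y2).
(* Change of index to coordinates with respect to the reduced basis, a bijection of the integer
   pairs because the determinant is 1. *)
pose lc (w : int * int) : int * int := (w.1 * q + w.2 * q', w.1 * p + w.2 * p').
have lcF w : F (lc w) = G w.1%:~R w.2%:~R.
  rewrite /F /G /lat /lc /= /x1 /x2 /z1 /z2 !rmorphD !rmorphM /=.
  by congr (f1 _ * f2 _); ring.
have lcK z : lc (z.1 * p' - z.2 * q', z.2 * q - z.1 * p) = z.
  case: z => n k; rewrite /lc /=.
  have e1 : (n * p' - k * q') * q + (k * q - n * p) * q' = n * (q * p' - q' * p) by ring.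
  have e2 : (n * p' - k * q') * p + (k * q - n * p) * p' = k * (q * p' - q' * p) by ring.
  by rewrite e1 e2 det !mulr1.
have lc_inj : injective lc.
  pose lci (z : int * int) := (z.1 * p' - z.2 * q', z.2 * q - z.1 * p).
  have K' : cancel lc lci.
    move=> [i j]; rewrite /lc /lci /=.
    have e1 : (i * q + j * q') * p' - (i * p + j * p') * q' = i * (q * p' - q' * p) by ring.
    have e2 : (i * p + j * p') * q - (i * q + j * q') * p = j * (q * p' - q' * p) by ring.
    by rewrite e1 e2 det !mulr1.
  exact: can_inj K'.
pose L := [seq (i, j) | i <- zr D, j <- zr D].
have uL : uniq L by apply: allpairs_uniq; [exact: uniq_zr|exact: uniq_zr|move=> [? ?] [? ?]].
(* Both index lists contain all nonzero terms, so the box [idx] may be exchanged for a square in the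
   new coordinates. *)
have SE : \sum_(z <- idx) F z = \sum_(i <- zr D) \sum_(j <- zr D) G i%:~R j%:~R.
  rewrite (@big_supp_eq _ _ idx (map lc L)) //.
  - rewrite big_map (eq_bigr (fun w => G w.1%:~R w.2%:~R)); last by move=> w _; exact: lcF.
    by rewrite big_allpairs.
  - by rewrite map_inj_uniq.
  - move=> z Fz; rewrite -(lcK z); apply: map_f.
    move: Fz; rewrite -{1}(lcK z) lcF /= => /supp[hs ht].
    apply: allpairs_f; rewrite mem_zr -(ler_int R) intr_norm -pmulrn.
    + have := ler_normD s0 ((z.1 * p' - z.2 * q')%:~R - s0); rewrite subrKC; clear -hs ht DD nn1 nn2 k20 rho0; lra.
    + have := ler_normD t0 ((z.2 * q - z.1 * p)%:~R - t0); rewrite subrKC; clear -hs ht DD nn1 nn2 k20 rho0; lra.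
have -> : I1 f1 * I1 f2 = N%:R^-1 * I2 G by rewrite IG mulKf // gt_eqF.
rewrite SE -mulrBr normrM distrC normfV (gtr0_norm NR0).
apply: (@le_trans _ _ (N%:R^-1 * ((4 * rho + 1) * ((2 * rho + (K + K + 3)%:R) * (a ^+ K.+1 * (A1 * A2)))))).
  by rewrite ler_pM2l ?invr_gt0.
have b1 : 4 * rho + 1 <= (4 * c2 + 1) / h.
  by rewrite ler_pdivlMr // mulrDl /rho -mulrA divfK ?gt_eqF //; clear -h1; lra.
have b2 : 2 * rho + (K + K + 3)%:R <= (2 * c2 + (K + K + 3)%:R) / h.
  rewrite ler_pdivlMr // mulrDl /rho -mulrA divfK ?gt_eqF // lerD2l.
  by rewrite -[leRHS]mulr1 ler_wpM2l.
have -> : C * (A1 * A2 / (a1 * a2)) * h ^+ K.+1 =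
  N%:R^-1 * ((4 * c2 + 1) / h * ((2 * c2 + (K + K + 3)%:R) / h * (a ^+ K.+1 * (A1 * A2)))).
  rewrite /C /a exprMn.
  have -> : (a1 * a2) = h ^+ 2 * N%:R by rewrite h2 divfK // gt_eqF.
  by field; rewrite !gt_eqF.
rewrite ler_pM2l ?invr_gt0 //; apply: ler_pM => //.
- by rewrite addr_ge0 // mulr_ge0.
- apply: mulr_ge0; first by rewrite addr_ge0 // mulr_ge0.
  by apply: mulr_ge0; [exact: exprn_ge0|exact: mulr_ge0].
- by apply: ler_wpM2r b2; rewrite mulr_ge0 ?exprn_ge0 // mulr_ge0.
Qed.

(** The support holds boundedly many lattice points. Two of them have first indices at distance at
    most [2 r N / a1], so bad approximability separates their second coordinates by a multiple of
    [a1 / N]; the second side [2 r / a2] has room for only boundedly many such gaps because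
    [N <= a1 a2]. *)
Lemma lattice_high (alpha c0 r : R) : 0 < c0 -> 
  badly_approximable_by c0 alpha -> 0 < r -> exists2 C, 0 < C &
  forall (N : nat) (a1 a2 A1 A2 : R) (f1 f2 : R -> R) (y1 y2 : R) (idx : seq (int * int)),
    (0 < N)%N -> 1 <= a1 -> 1 <= a2 -> N%:R <= a1 * a2 ->
    (forall x, `|f1 x| <= A1) -> (forall x, `|f2 x| <= A2) ->
    bsupp (r / a1) f1 -> bsupp (r / a2) f2 -> uniq idx ->
    `|\sum_(z <- idx) f1 ((lat alpha N z).1 - y1) * f2 ((lat alpha N z).2 - y2)| <= C * (A1 * A2).
Proof.
move=> c0_gt0 hba r0.
pose C := 2 * r + 4 * r ^+ 2 / c0 + 1.
exists C.
  have : 0 <= 4 * r ^+ 2 / c0 by rewrite divr_ge0 ?mulr_ge0 ?sqr_ge0 // ltW.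
  by rewrite /C; lra.
move=> N a1 a2 A1 A2 f1 f2 y1 y2 idx N0 a11 a21 aN f1A f2A f1r f2r uidx.
have NR0 : (0 : R) < N%:R by rewrite ltr0n.
have a10 : 0 < a1 by lra.
have a20 : 0 < a2 by lra.
have A10 : 0 <= A1 by apply: le_trans (f1A 0).
have A20 : 0 <= A2 by apply: le_trans (f2A 0).
pose P (z : int * int) := (`|(lat alpha N z).1 - y1| <= r / a1) && (`|(lat alpha N z).2 - y2| <= r / a2).
apply: (@sum_bound_supp _ _ idx P) => //.
- exact: mulr_ge0.
- by move=> z _; rewrite normrM ler_pM.
- move=> z _; rewrite /P negb_and -!ltNge => /orP[/f1r ->|/f2r ->]; by rewrite ?mul0r ?mulr0.
(* [T^-1] lies below both possible gaps: 1 for points with equal first index, and [c0 a1 / (2 r N)]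
   otherwise. *)
pose T : R := 1 + 2 * r * N%:R / (c0 * a1).
have T0 : 0 <= 2 * r * N%:R / (c0 * a1).
  by apply: divr_ge0; rewrite !mulr_ge0 // ltW.
have T1 : 1 <= T by rewrite lerDl.
have Tgt0 : 0 < T by lra.
apply: (@le_trans _ _ ((y2 + r / a2 - (y2 - r / a2)) / T^-1 + 1)); last first.
  rewrite invrK /C lerD2r.
  have -> : (y2 + r / a2 - (y2 - r / a2)) * T = 2 * r / a2 + 4 * r ^+ 2 / c0 * (N%:R / (a1 * a2)).
    by rewrite /T; field; rewrite !gt_eqF.
  apply: lerD.
    by rewrite ler_pdivrMr // ler_peMr //; lra.
  apply: ler_piMr; first by rewrite divr_ge0 ?mulr_ge0 ?sqr_ge0 // ltW.
  by rewrite ler_pdivrMr ?mulr_gt0 // mul1r.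
apply: (@size_separated _ _ _ (fun z => (lat alpha N z).2)).
- exact: filter_uniq.
- by rewrite invr_gt0.
- have : 0 <= r / a2 by rewrite divr_ge0 // ltW.
  lra.
- by move=> z; rewrite mem_filter => /andP[/andP[_]]; rewrite ler_norml => /andP[? ?] _; apply/andP; split; lra.
move=> [n k] [n' k']; rewrite !mem_filter => /andP[/andP[z1 z2] _] /andP[/andP[w1 w2] _] zw.
rewrite /lat /= in z1 z2 w1 w2 *.
have -> : n%:~R * alpha - k%:~R - (n'%:~R * alpha - k'%:~R) = (n - n')%:~R * alpha - (k - k')%:~R.
  by rewrite !rmorphB /=; ring.
have iT : T^-1 <= 1 by rewrite invf_le1.
case: (eqVneq n n') => [E|nn].
  have kk : k - k' != 0.
    by rewrite subr_eq0; apply: contra zw => /eqP ->; rewrite E.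
  rewrite E subrr mul0r sub0r normrN -intr_norm; apply: le_trans iT _.
  by rewrite ler1z -gtz0_ge1 normr_gt0.
have d0 : n - n' != 0 by rewrite subr_eq0.
have := hba (n - n') (k - k') d0.
set e := `|(n - n')%:~R * alpha - (k - k')%:~R|.
set d := `|(n - n')%:~R|.
have d_gt0 : 0 < d by rewrite normr_gt0 intr_eq0.
have dle : d <= 2 * r * N%:R / a1.
  have -> : d = `|n%:~R / N%:R - n'%:~R / N%:R| * N%:R.
    by rewrite -mulrBl normrM normfV (gtr0_norm NR0) divfK ?gt_eqF // -rmorphB.
  rewrite mulrAC ler_pM2r //.
  have -> : n%:~R / N%:R - n'%:~R / N%:R = (n%:~R / N%:R - y1) - (n'%:~R / N%:R - y1) by ring.
  by apply: le_trans (ler_normB _ _) _; rewrite mulrDl mul1r -?mulrA; lra.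
move=> hce.
have e0 : 0 <= e by exact: normr_ge0.
have : c0 <= 2 * r * N%:R / a1 * e by apply: le_trans hce _; exact: ler_wpM2r.
move=> h.
rewrite -[T^-1]mul1r ler_pdivrMr //.
have : 1 <= 2 * r * N%:R / (c0 * a1) * e.
  rewrite -(ler_pM2l c0_gt0) mulr1; apply: le_trans h _.
  by rewrite le_eqVlt; apply/orP; left; apply/eqP; field; rewrite !gt_eqF.
by rewrite /T mulrDr mulr1 mulrC; clear -e0; lra.
Qed.

End LatticeSums.

(** * The quadrature error on a frequency block *)

Section Cutoff.
Variable R : realType.

(** Equal to 1 on [[- A, A]], to 0 outside [[- A - 1, A + 1]] and linear between. The dual weight
    has no compact support; multiplying it by a cutoff puts it into [cc2] without changing the
    pairing with [g]. *)
Definition cutoff (A x : R) : R :=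
  (`|x + (A + 1)| - `|x + A| - `|x - A| + `|x - (A + 1)|) / 2.

Lemma cc_cutoff A : 0 < A -> cc (cutoff A).
Proof.
move=> A0; split.
  have cn : continuous (fun x : R => `|x|) by exact: norm_continuous.
  have c1 c : continuous (fun x : R => `|x + c|).
    apply: (continuous_compR cn) => x; apply: cvgD; [exact: cvg_id|exact: cvg_cst].
  move=> x; apply: cvgM; last exact: cvg_cst.
  by apply: cvgD; [apply: cvgB; [apply: cvgB|]|]; exact: c1.
exists (A + 1) => x; rewrite lter_normr => /orP[h|h]; rewrite /cutoff.
  by rewrite !ger0_norm; lra.
by rewrite !ler0_norm; lra.
Qed.

Lemma cutoff1 A x : `|x| <= A -> cutoff A x = 1.
Proof.
rewrite ler_norml => /andP[h1 h2]; rewrite /cutoff (ger0_norm (x := x + (A + 1))); last lra.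
rewrite (ger0_norm (x := x + A)); last lra.
rewrite (ler0_norm (x := x - A)); last lra.
rewrite (ler0_norm (x := x - (A + 1))); last lra.
by field.
Qed.

Lemma cutoff_itv A x : 0 < A -> 0 <= cutoff A x <= 1.
Proof.
move=> A0; rewrite /cutoff.
case: (ger0P (x + (A + 1))) => ?; case: (ger0P (x + A)) => ?; case: (ger0P (x - A)) => ?;
case: (ger0P (x - (A + 1))) => ?; apply/andP; split; lra.
Qed.

Lemma cutoff_supp A x : 0 < A -> A + 1 < `|x| -> cutoff A x = 0.
Proof.
move=> A0; rewrite lter_normr => /orP[h|h]; rewrite /cutoff.
  by rewrite !ger0_norm; lra.
by rewrite !ler0_norm; lra.
Qed.

Lemma I1_cutoff A : 0 < A -> I1 (cutoff A) <= 2 * (A + 1).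
Proof.
move=> A0; apply: le_trans (ler_norm _) _.
have -> : 2 * (A + 1) = 1 * ((A + 1) - - (A + 1)) :> R by ring.
apply: I1_bound; [lra|exact: cc_cutoff| | |].
- by move=> x h; apply: cutoff_supp => //; rewrite ltr0_norm; lra.
- by move=> x h; apply: cutoff_supp => //; rewrite gtr0_norm; lra.
- by move=> x; have /andP[? ?] := cutoff_itv x A0; rewrite ger0_norm.
Qed.

End Cutoff.

Section LatticeBox.
Variable R : realType.
Implicit Types (alpha : R) (N B : nat).

(** A finite index list that contains every lattice point of a fixed box around the origin. Centring
    the second index at the floor of [n alpha] keeps its length of order [N], which the L_1-bound of
    the weight needs. *)
Definition latbox alpha N B : seq (int * int) :=
  [seq (n, Num.floor (n%:~R * alpha) - j) | n <- zr (B * N), j <- zr B].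

Lemma uniq_latbox alpha N B : uniq (latbox alpha N B).
Proof.
apply: allpairs_uniq; try exact: uniq_zr.
by move=> [n j] [n' j'] _ _ /= [-> /addrI /oppr_inj ->].
Qed.

Lemma size_latbox alpha N B : (0 < N)%N ->
  (size (latbox alpha N B) <= N * ((B + B).+1 * (B + B).+1))%N.
Proof.
move=> N0; rewrite size_allpairs !size_map !size_iota mulnA leq_pmul2r //.
nia.
Qed.

Lemma mem_latbox alpha N B n k : (0 < N)%N ->
  `|(lat alpha N (n, k)).1| <= B%:R -> `|(lat alpha N (n, k)).2| + 1 <= B%:R -> (n, k) \in latbox alpha N B.
Proof.
move=> N0; rewrite /lat /= => h1 h2.
have NR0 : (0 : R) < N%:R by rewrite ltr0n.
have -> : (n, k) = (n, Num.floor (n%:~R * alpha) - (Num.floor (n%:~R * alpha) - k)) by congr pair; ring.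
apply: (allpairs_f (fun n j => (n, Num.floor (n%:~R * alpha) - j))).
  rewrite mem_zr -(ler_int R) intr_norm -pmulrn natrM -ler_pdivrMr //.
  by move: h1; rewrite normrM normfV (gtr0_norm NR0).
rewrite mem_zr -(ler_int R) intr_norm -pmulrn rmorphB /=.
have /andP[f1 f2] := floor_itv (n%:~R * alpha); rewrite rmorphD /= in f2.
move: h2; have := ler_norm (n%:~R * alpha - k%:~R); have := ler_norm (- (n%:~R * alpha - k%:~R)).
by rewrite normrN ler_norml => ? ? ?; apply/andP; split; lra.
Qed.

End LatticeBox.

Section WeightBound.
Variable R : realType.

(* [tau] stands for [2^|m| / N]. *)
Definition block_decay (p : \bar R) (L : nat) (tau : R) : R :=
  if tau <= 1 then tau ^+ L.+1 else tau `^ (fine p^-1%E).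

(** By duality the error is the integral of [g] against the weight [G], and [Lp_weight] applies once
    [G] is bounded in sup and L_1. The order [2 (L + 1)] of the kernels turns the gain in powers of
    [sqrt tau] into [tau^(L+1)]. The radius [B] covers the cutoff ([A + 1]), the kernel ([r]) and
    the margin 1 of [mem_latbox]. *)
Lemma weight_bound (alpha c0 : R) (p : \bar R) (L : nat) (r A M M' : R) (B : nat) :
  0 < c0 -> c0 <= 1 -> badly_approximable_by c0 alpha -> (1 <= p)%E ->
  0 < r -> 0 < A -> 0 < M -> 0 < M' -> A + r + 2 <= B%:R ->
  exists2 C, 0 < C &
  forall (N : nat) (a1 a2 : R) (k l : R -> R) (g q : R -> R -> R) (b : R),
    (0 < N)%N -> 1 <= a1 -> 1 <= a2 ->
    CK (L + L).+2 a1 (a1 * M) k -> CK (L + L).+2 a2 (a2 * M) l ->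
    bsupp (r / a1) k -> bsupp (r / a2) l ->
    I1 (fun x => `|k x|) <= M' -> I1 (fun x => `|l x|) <= M' ->
    cc2 g -> cc2 q -> bsupp2 A q -> (forall x y, `|g x y| <= q x y) -> 0 <= b ->
    (Lnorm (leb2 R) p (fun z => (q z.1 z.2)%:E) <= b%:E)%E ->
    `|I2 (C1 k (C2 l g)) - N%:R^-1 * \sum_(z <- latbox alpha N B) C1 k (C2 l g) (lat alpha N z).1 (lat alpha N z).2|
     <= C * b * block_decay p L (a1 * a2 / N%:R).
Proof.
move=> c0_gt0 c01 hba p1 r0 A0 M0 M'0 BA.
have [Cl Cl0 low] := @lattice_low R alpha c0 r (L + L).+1 c0_gt0 c01 hba r0.
have [Ch Ch0 high] := @lattice_high R alpha c0 r c0_gt0 hba r0.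
pose S : R := (2 * (A + 1)) ^+ 2.
have S0 : 0 < S by rewrite exprn_gt0 // mulr_gt0 //; lra.
pose Vl := Cl * M ^+ 2 * (1 + S).
pose Vh := M' ^+ 2 + Ch * M ^+ 2 + M' ^+ 2 * S + ((B + B).+1 * (B + B).+1)%:R * M' ^+ 2.
have M20 : 0 < M ^+ 2 by rewrite exprn_gt0.
have M'20 : 0 < M' ^+ 2 by rewrite exprn_gt0.
have Vl0 : 0 < Vl by rewrite !mulr_gt0 //; lra.
have Vh0 : 0 < Vh.
  have := mulr_gt0 Ch0 M20; have := mulr_gt0 M'20 S0.
  have : 0 <= ((B + B).+1 * (B + B).+1)%:R * M' ^+ 2 by rewrite mulr_ge0 // ltW.
  rewrite /Vh; lra.
exists (2 * (Vl + Vh)); first by rewrite mulr_gt0 // addr_gt0.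
move=> N a1 a2 k l g q b N0 a11 a21 kK lK kr lr kM lM cg cq qA gq b0 hL.
have NR0 : (0 : R) < N%:R by rewrite ltr0n.
have a10 : 0 < a1 by lra.
have a20 : 0 < a2 by lra.
have ck : cc k by split; [exact: CK_continuous kK|exists (r / a1)].
have cl : cc l by split; [exact: CK_continuous lK|exists (r / a2)].
set idx := latbox alpha N B.
set pts := map (lat alpha N) idx.
have -> : \sum_(z <- idx) C1 k (C2 l g) (lat alpha N z).1 (lat alpha N z).2 =
  \sum_(z <- pts) C1 k (C2 l g) z.1 z.2 by rewrite big_map.
rewrite error_dual //.
set G := dual_weight N%:R pts k l.
have cG : cont2 G by apply: cont2_weight; [exact: ck.1|exact: cl.1].
pose W x y := cutoff A x * cutoff A y * `|G x y|.
have cX : cc (cutoff A) by exact: cc_cutoff.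
have cXX : cc2 (fun x y => cutoff A x * cutoff A y) by exact: cc2_tensor.
have cW : cc2 W.
  have := cc2M (cont2_norm cG) cXX; congr cc2; apply/funext => x; apply/funext => y.
  by rewrite mulrC.
have X0 x : 0 <= cutoff A x by have /andP[] := cutoff_itv x A0.
have X1 x : cutoff A x <= 1 by have /andP[] := cutoff_itv x A0.
have XX1 x y : cutoff A x * cutoff A y <= 1 by rewrite -[leRHS]mulr1 ler_pM.
have W0 x y : 0 <= W x y by apply: mulr_ge0 => //; exact: mulr_ge0.
have q0 x y : 0 <= q x y by apply: le_trans (gq x y).
have ISX : I2 (fun x y => cutoff A x * cutoff A y) <= S.
  by rewrite I2_tensor // /S expr2; apply: ler_pM; rewrite ?I1_cutoff // I1_ge0.
apply: (@le_trans _ _ (I2 (fun x y => W x y * q x y))).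
  apply: le_trans (I2_norm (cc2M cG cg)) _.
  apply: le_I2; [exact: cc2_norm (cc2M cG cg)|exact: cc2M cW.1 cq|move=> x y].
  rewrite normrM /W.
  case: (boolP ((A < `|x|) || (A < `|y|))) => [/qA qxy|].
    by have := gq x y; rewrite qxy normr_le0 => /eqP ->; rewrite normr0 !mulr0.
  rewrite negb_or -!leNgt => /andP[xA yA].
  by rewrite !cutoff1 // !mul1r; apply: ler_wpM2l.
set tau := a1 * a2 / N%:R.
have tau0 : 0 < tau by rewrite divr_gt0 // mulr_gt0.
(* Common end of both cases. For [tau <= 1] the sup and L_1 bounds are both of order [tau^(L+1)], so
   [t = 1]; for [tau > 1] the sup bound exceeds the L_1 bound by [t = tau], and the power
   [tau^(1/p)] remains. *)
have fin (V t D : R) : 0 < V -> 0 < t -> 0 <= D -> V * D * t `^ (fine p^-1%E) = V * block_decay p L tau ->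
   (forall x y, W x y <= V * D * t) -> I2 W <= V * D -> V <= Vl + Vh ->
   I2 (fun x y => W x y * q x y) <= 2 * (Vl + Vh) * b * block_decay p L tau.
  move=> V0 t0 D0 E Wt IW VV.
  apply: le_trans (Lp_weight p1 cW cq W0 q0 t0 b0 Wt IW hL) _.
  have -> : 2 * (V * D) * b * t `^ (fine p^-1%E) = 2 * b * (V * D * t `^ (fine p^-1%E)) by ring.
  rewrite E; have -> : 2 * (Vl + Vh) * b * block_decay p L tau = 2 * b * ((Vl + Vh) * block_decay p L tau) by ring.
  apply: ler_wpM2l; first by rewrite mulr_ge0.
  apply: ler_wpM2r => //; rewrite /block_decay; case: ifP => _; last exact: powR_ge0.
  by rewrite exprn_ge0 // ltW.
have IWle (c : R) : 0 <= c -> (forall x y, W x y <= c * (cutoff A x * cutoff A y)) -> I2 W <= c * S.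
  move=> c_ge0 h; apply: (@le_trans _ _ (I2 (fun x y => c * (cutoff A x * cutoff A y)))).
    apply: le_I2 => //; exact: cc2Z.
  by rewrite I2Z //; apply: ler_wpM2l.
have GE y1 y2 : G y1 y2 = I1 k * I1 l - N%:R^-1 * \sum_(z <- idx) k ((lat alpha N z).1 - y1) * l ((lat alpha N z).2 - y2).
  by rewrite /G /dual_weight big_map.
case: (leP tau 1) => tau1.
- have D0 : 0 <= tau ^+ L.+1 by rewrite exprn_ge0 // ltW.
  have Gle x y : `|x| <= A + 1 -> `|y| <= A + 1 -> `|G x y| <= Cl * M ^+ 2 * tau ^+ L.+1.
    move=> hx hy; rewrite GE.
    apply: le_trans (low N a1 a2 _ _ k l x y idx N0 a11 a21 _ kK lK kr lr (uniq_latbox _ _ _) _) _.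
    - by rewrite -(mul1r N%:R) -ler_pdivrMr.
    - move=> [n j]; rewrite mulf_eq0 negb_or => /andP[k0 l0].
      have r1 (a : R) : 1 <= a -> r / a <= r by move=> a1'; have a'0 := lt_le_trans ltr01 a1'; rewrite ler_pdivrMr // ler_peMr // ltW.
      have hk : `|(lat alpha N (n, j)).1 - x| <= r.
        by apply: le_trans (r1 _ a11); rewrite leNgt; apply: contra k0 => /kr ->.
      have hl : `|(lat alpha N (n, j)).2 - y| <= r.
        by apply: le_trans (r1 _ a21); rewrite leNgt; apply: contra l0 => /lr ->.
      apply: mem_latbox => //.
        by have := ler_normD ((lat alpha N (n, j)).1 - x) x; rewrite subrK; clear -BA hx hy hk hl; lra.
      by have := ler_normD ((lat alpha N (n, j)).2 - y) y; rewrite subrK; clear -BA hx hy hk hl; lra.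
    have -> : (L + L).+2 = (2 * L.+1)%N by rewrite mul2n -addnn addnS addSn.
    rewrite exprM sqr_sqrtr ?(ltW tau0) // le_eqVlt; apply/orP; left; apply/eqP; congr (_ * _).
    by field; rewrite !gt_eqF.
  have Wle x y : W x y <= Cl * M ^+ 2 * tau ^+ L.+1 * (cutoff A x * cutoff A y).
    rewrite /W mulrC.
    case: (ltP (A + 1) `|x|) => [hx|hx]; first by rewrite (cutoff_supp A0 hx) !mul0r !mulr0.
    case: (ltP (A + 1) `|y|) => [hy|hy]; first by rewrite (cutoff_supp A0 hy) !mulr0.
    by apply: ler_wpM2r; [exact: mulr_ge0|exact: Gle].
  have c_ge0 : 0 <= Cl * M ^+ 2 * tau ^+ L.+1 by rewrite !mulr_ge0 // ltW.
  apply: (fin Vl 1 (tau ^+ L.+1)) => //.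
  + by rewrite powR1 mulr1 /block_decay tau1.
  + move=> x y; rewrite mulr1; apply: le_trans (Wle x y) _.
    apply: (@le_trans _ _ (Cl * M ^+ 2 * tau ^+ L.+1)); first by rewrite ler_piMr.
    by rewrite /Vl; apply: ler_wpM2r => //; rewrite ler_peMr ?mulr_ge0 ?ltW //; lra.
  + apply: le_trans (IWle _ c_ge0 Wle) _; rewrite /Vl mulrAC; apply: ler_wpM2r => //.
    by apply: ler_wpM2l; [rewrite mulr_ge0 // ltW|lra].
  + lra.
- have tau1' : 1 <= tau by exact: ltW.
  have IkIl : `|I1 k * I1 l| <= M' ^+ 2.
    rewrite normrM expr2; apply: ler_pM => //.
      exact: le_trans (I1_norm ck) _.
    exact: le_trans (I1_norm cl) _.
  apply: (fin Vh tau 1) => //.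
  + by rewrite mulr1 /block_decay leNgt tau1.
  + move=> x y; rewrite mulr1; apply: (@le_trans _ _ `|G x y|); first by rewrite /W ler_piMl.
    rewrite GE; apply: le_trans (ler_normB _ _) _.
    have aN : N%:R <= a1 * a2 by rewrite -[N%:R]mul1r -ler_pdivlMr.
    have h1 := high N a1 a2 _ _ k l x y idx N0 a11 a21 aN (fun x => CK_bound x kK) (fun x => CK_bound x lK) kr lr (uniq_latbox _ _ _).
    apply: (@le_trans _ _ (M' ^+ 2 * tau + Ch * M ^+ 2 * tau)).
      apply: lerD; first by apply: le_trans IkIl _; rewrite ler_peMr // ltW.
      rewrite normrM normfV (gtr0_norm NR0) mulrC ler_pdivrMr //; apply: le_trans h1 _.
      rewrite /tau le_eqVlt; apply/orP; left; apply/eqP.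
      by field; rewrite gt_eqF.
    rewrite -mulrDl; apply: ler_wpM2r; first exact: ltW.
    rewrite /Vh; have := mulr_gt0 M'20 S0.
    have : 0 <= ((B + B).+1 * (B + B).+1)%:R * M' ^+ 2 by rewrite mulr_ge0 // ltW.
    lra.
  + rewrite mulr1.
    (* The L_1 bound for [tau > 1]: each translated product has L_1-norm at most [M'^2], and the
       order of [N] lattice points is cancelled by the factor [1/N]. *)
    pose H (z : int * int) x y := `|k ((lat alpha N z).1 - x)| * `|l ((lat alpha N z).2 - y)|.
    have cH z : cc2 (H z) by apply: cc2_tensor; apply: cc_norm; exact: cc_reflect.
    have cH' : cc2 (fun x y => \sum_(z <- idx) H z x y) by exact: cc2_sum.
    apply: (@le_trans _ _ (I2 (fun x y => M' ^+ 2 * (cutoff A x * cutoff A y) + N%:R^-1 * \sum_(z <- idx) H z x y))).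
      apply: le_I2 => //; first by apply: cc2D; exact: cc2Z.
      move=> x y; rewrite /W GE.
      apply: (@le_trans _ _ (cutoff A x * cutoff A y * (M' ^+ 2 + N%:R^-1 * \sum_(z <- idx) H z x y))).
        apply: ler_wpM2l; first exact: mulr_ge0.
        apply: le_trans (ler_normB _ _) _; apply: lerD => //.
        rewrite normrM normfV (gtr0_norm NR0) ler_pM2l ?invr_gt0 //.
        apply: le_trans (ler_norm_sum _ _ _) _; apply: ler_sum => z _.
        by rewrite normrM.
      rewrite mulrDr [X in X + _ <= _]mulrC; apply: lerD => //.
      apply: ler_piMl => //; rewrite mulr_ge0 ?invr_ge0 //.
      by apply: sumr_ge0 => z _; exact: mulr_ge0.
    rewrite I2D; [|exact: cc2Z|exact: cc2Z].
    rewrite I2Z // I2Z // I2_sum //.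
    have IH z : I2 (H z) <= M' ^+ 2.
      have -> : I2 (H z) = I1 (fun x => `|k x|) * I1 (fun x => `|l x|).
        rewrite -(I1_reflect (lat alpha N z).1 (cc_norm ck)) -(I1_reflect (lat alpha N z).2 (cc_norm cl)).
        by rewrite -I2_tensor //; apply: cc_norm; exact: cc_reflect.
      by rewrite expr2; apply: ler_pM => //; exact: I1_ge0.
    have : N%:R^-1 * \sum_(z <- idx) I2 (H z) <= ((B + B).+1 * (B + B).+1)%:R * M' ^+ 2.
      rewrite mulrC ler_pdivrMr //.
      apply: (@le_trans _ _ (\sum_(z <- idx) M' ^+ 2)); first by apply: ler_sum => z _.
      rewrite big_const_seq count_predT iter_addr_0 -[X in X <= _]mulr_natl.
      have -> : ((B + B).+1 * (B + B).+1)%:R * M' ^+ 2 * N%:R = (N * ((B + B).+1 * (B + B).+1))%:R * M' ^+ 2 by rewrite [in RHS]natrM; ring.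
      apply: ler_wpM2r; first exact: ltW.
      by rewrite ler_nat size_latbox.
    have := ler_wpM2l (ltW M'20) ISX; have := mulr_gt0 Ch0 M20.
    rewrite /Vh; lra.
  + lra.
Qed.

End WeightBound.

(** * Distributions and block norms *)

Section TensorTest.
Local Open Scope complex_scope.
Variable R : realType.
Implicit Types a b : R -> R.

Definition tens a b (y : R * R) : R[i] := (a y.1 * b y.2)%:C.

Lemma pderive_tens (i : bool) a b : sm a -> sm b ->
  pderive i (tens a b) = tens (if i then a else derive1 a) (if i then derive1 b else b).
Proof.
move=> sa sb; apply/funext => -[x y]; rewrite /pderive /slice /tens; case: i => /=; congr (_ +i* _).
- apply: is_derive_derive1; exact: is_deriveZR (sm_is_derive y sb).
- by rewrite derive1_cst.
- rewrite mulrC; under eq_fun do rewrite mulrC.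
  apply: is_derive_derive1; exact: is_deriveZR (sm_is_derive x sa).
- by rewrite derive1_cst.
Qed.

(** Tensor products of smooth functions are closed under partial derivatives, so an induction on the
    word suffices. *)
Lemma pderives_tens w a b : sm a -> sm b ->
  exists a' b', [/\ sm a', sm b' & pderives w (tens a b) = tens a' b'].
Proof.
move=> sa sb; elim: w => [|i w [a' [b' [sa' sb' E]]]] /=; first by exists a, b.
exists (if i then a' else derive1 a'), (if i then derive1 b' else b').
rewrite E (pderive_tens i sa' sb'); split; last by [].
  by case: i; [exact: sa'|exact: sm_derive].
by case: i; [exact: sm_derive|exact: sb'].
Qed.

Lemma smooth_tens a b : sm a -> sm b -> smooth (tens a b).
Proof.
move=> sa sb w; have [a' [b' [sa' sb' ->]]] := pderives_tens w sa sb.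
split; [split|] => /=.
- exact: (cont2_tensor (sm_continuous sa') (sm_continuous sb')).
- by move=> z; exact: cvg_cst.
move=> i [x y]; rewrite /pderivable /slice /tens; case: i => /=; split.
- by have [] := is_deriveZR (a' x) (sm_is_derive y sb').
- exact: derivable_cst.
- under eq_fun do rewrite mulrC.
  by have [] := is_deriveZR (b' y) (sm_is_derive x sa').
- exact: derivable_cst.
Qed.

Lemma supp_subset (phi : R * R -> R[i]) (K : set (R * R)) : closed K ->
  (forall z, ~ K z -> phi z = 0) -> supp phi `<=` K.
Proof.
move=> cK h; rewrite /supp; apply: (@subset_trans _ (closure K)); last first.
  by rewrite -((closure_id K).1 cK).
apply: closure_subset => z /= /eqP; apply: contraPP => nK; rewrite h //; exact.
Qed.

Lemma box_closed (x y u v : R) : closed (`[x, y]%classic `*` `[u, v]%classic : set (R * R)).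
Proof.
apply: compact_closed; first exact: norm_hausdorff.
by apply: compact_setX; exact: segment_compact.
Qed.

Lemma test_tens a b : sc a -> sc b -> test_function (tens a b).
Proof.
move=> [sa [A aA]] [sb [B bB]]; split; first exact: smooth_tens.
pose K : set (R * R) := `[- A, A]%classic `*` `[- B, B]%classic.
have cK : compact K by apply: compact_setX; exact: segment_compact.
apply: (subclosed_compact _ cK); first exact: closed_closure.
apply: supp_subset; first exact: box_closed.
move=> [x y] /= /not_andP /=; rewrite !in_itv /= -!ler_norml => h.
rewrite /tens /=; case: h => /negP; rewrite -ltNge => h.
  by rewrite aA ?mul0r.
by rewrite bB ?mulr0.
Qed.

Lemma cintegral_tens (f : R * R -> R[i]) a b : ccontinuous f -> cc a -> cc b ->
  cintegral (leb2 R) setT (fun z => f z * tens a b z) =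
  I2 (fun x y => complex.Re (f (x, y)) * (a x * b y)) +i*
  I2 (fun x y => complex.Im (f (x, y)) * (a x * b y)).
Proof.
move=> [cr ci] ca cb.
have E (g : R * R -> R) : continuous g ->
  \int[leb2 R]_z (g z * (a z.1 * b z.2)) = I2 (fun x y => g (x, y) * (a x * b y)).
  move=> cg; rewrite -I2_leb2.
    by apply: eq_Rintegral => -[x y] _.
  apply: cc2M; last exact: cc2_tensor.
  by move=> [x y]; have := cg (x, y); under [X in _ -> X @ _ --> _]eq_fun do rewrite -surjective_pairing.
rewrite /cintegral -(E _ cr) -(E _ ci); congr (_ +i* _); apply: eq_Rintegral => z _.
  by case: (f z) => u v; rewrite /tens /= !mulr0 subr0.
by case: (f z) => u v; rewrite /tens /= !mulr0 add0r.
Qed.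

(** [T] determines [f] only through pairings. A point outside the square has a neighbourhood [U] on
    which [T] vanishes; tensor products of dilates of [u] concentrated there recover the value of
    [f] in the limit. *)
Lemma represents_zero (u : R -> R) (f : R * R -> R[i]) (T : Defs.distribution R) :
  sc u -> I1 u = 1 -> ccontinuous f -> represents f T -> dsupp T `<=` @unit_square R ->
  forall z, ~ @unit_square R z -> f z = 0.
Proof.
move=> su u1 cf rf dT z nz.
have cu := sc_cc su; have [A A0 uA] := cc_bsupp cu.
have : ~ dsupp T z by move=> /dT.
rewrite /dsupp => /contrapT [U [oU vU] Uz].
have /nbhs_ballP[e /= e0 eU] : nbhs z U by exact: open_nbhs_nbhs.
case: z nz Uz eU => x y nz Uz eU.
pose e2 := e / 2; have e20 : 0 < e2 by rewrite divr_gt0.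
pose J1 := Num.bound (A / e2).
have main (g : R * R -> R) : continuous g ->
    (forall a b, sc a -> sc b -> supp (tens a b) `<=` U -> I2 (fun x y => g (x, y) * (a x * b y)) = 0) -> g (x, y) = 0.
  move=> cg gU.
  have cg2 : cont2 (fun x y => g (x, y)).
    by move=> w; have := cg w; rewrite {1}(surjective_pairing w); under [X in _ -> X @ _ --> _]eq_fun do rewrite -surjective_pairing; rewrite -?surjective_pairing.
  apply/eqP; rewrite -normr_le0; apply/ler_addgt0Pr => d d0; rewrite add0r.
  have [J0 HJ] := approximate_identity x y cu u1 cg2 d0.
  (* [J0] makes the smoothed value accurate up to [d]; [J1] makes the support of the kernel fit into
     [U]. *)
  pose J := (J0 + J1)%N.
  have := HJ J (leq_addr _ _).
  have j0 : (0 : R) < 2 ^+ J by rewrite exprn_gt0.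
  have jn0 : (2 : R) ^+ J != 0 by rewrite gt_eqF.
  have sJ (v : R) : sc (fun t => dil (2 ^+ J) u (v - t)).
    have m1 : (-1 : R) != 0 by rewrite oppr_eq0 oner_neq0.
    have := sc_affine v m1 (sc_dil jn0 su); congr sc; apply/funext => t.
    by rewrite mulN1r addrC.
  have cJ : cc (dil (2 ^+ J) u) by exact: cc_dil.
  suff -> : I2 (fun t s => dil (2 ^+ J) u t * dil (2 ^+ J) u s * g (x - t, y - s)) = 0.
    by rewrite sub0r normrN.
  (* Reflection in both variables turns the smoothed value at [(x, y)] into a pairing with a tensor
     product. *)
  have := gU _ _ (sJ x) (sJ y) _; move=> <-.
    rewrite /I2.
    have c2 : cc2 (fun t s => g (t, s) * (dil (2 ^+ J) u (x - t) * dil (2 ^+ J) u (y - s))).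
      by apply: cc2M => //; apply: cc2_tensor; exact/sc_cc/sJ.
    rewrite -(I1_reflect x (cc2_I1 c2)); apply: eq_I1 => t.
    rewrite -(I1_reflect y (cc2_l _ c2)); apply: eq_I1 => s.
    have -> : x - (x - t) = t by ring.
    have -> : y - (y - s) = s by ring.
    by rewrite mulrC.
  have Je : A / 2 ^+ J <= e2.
    rewrite ler_pdivrMr // mulrC -ler_pdivrMr //.
    apply: ltW; apply: lt_le_trans (archi_boundP (ltW (divr_gt0 A0 e20))) _.
    rewrite -/J1 -natrX ler_nat; apply: leq_trans (leq_addl J0 J1) _.
    by apply: ltnW; rewrite ltn_expl.
  apply: subset_trans eU.
  apply: (@subset_trans _ (`[x - e2, x + e2]%classic `*` `[y - e2, y + e2]%classic)).
    apply: supp_subset; first exact: box_closed.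
    move=> [t s] /= /not_andP /=; rewrite !in_itv /= => h.
    have far (v w : R) : ~ (v - e2 <= w <= v + e2) -> dil (2 ^+ J) u (v - w) = 0.
      move=> h'; rewrite /dil uA ?mulr0 //.
      rewrite normrM gtr0_norm // mulrC -ltr_pdivrMr //; apply: le_lt_trans Je _.
      by rewrite ltNge; apply/negP => h2; apply: h'; move: h2; rewrite ler_norml => /andP[? ?]; apply/andP; split; lra.
    rewrite /tens /=; case: h => /far ->; by rewrite ?mul0r ?mulr0.
  move=> [t s] [] /=; rewrite !in_itv /= => /andP[? ?] /andP[? ?].
  have e2e : e2 < e by rewrite /e2; lra.
  by split; rewrite /ball /= ltr_norml; apply/andP; split; lra.
have vanish a b : sc a -> sc b -> supp (tens a b) `<=` U ->
  I2 (fun x y => complex.Re (f (x, y)) * (a x * b y)) +i*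
  I2 (fun x y => complex.Im (f (x, y)) * (a x * b y)) = 0.
  move=> sa sb sU; have tt := test_tens sa sb.
  by rewrite -(cintegral_tens cf (sc_cc sa) (sc_cc sb)) -rf // vU.
have re0 := main _ cf.1 (fun a b sa sb sU => congr1 (@complex.Re R) (vanish a b sa sb sU)).
have im0 := main _ cf.2 (fun a b sa sb sU => congr1 (@complex.Im R) (vanish a b sa sb sU)).
by move: re0 im0 => /=; case: (f (x, y)) => a b /= -> ->.
Qed.

End TensorTest.

Section NormC.
Local Open Scope complex_scope.
Variable R : realType.

Lemma normc_ge_ReIm (z : R[i]) : `|complex.Re z| <= Normc.normc z /\ `|complex.Im z| <= Normc.normc z.
Proof.
case: z => a b /=; split.
  by rewrite -sqrtr_sqr ler_sqrt ?addr_ge0 ?sqr_ge0 // lerDl sqr_ge0.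
by rewrite -sqrtr_sqr ler_sqrt ?addr_ge0 ?sqr_ge0 // lerDr sqr_ge0.
Qed.

Lemma normc_le_ReIm (z : R[i]) : Normc.normc z <= `|complex.Re z| + `|complex.Im z|.
Proof.
case: z => a b /=.
rewrite -(@ler_pXn2r _ 2) ?nnegrE ?sqrtr_ge0 ?addr_ge0 // sqr_sqrtr ?addr_ge0 ?sqr_ge0 //.
rewrite sqrrD !real_normK ?num_real // -subr_ge0.
have -> : a ^+ 2 + `|a| * `|b| *+ 2 + b ^+ 2 - (a ^+ 2 + b ^+ 2) = 2 * (`|a| * `|b|) by ring.
by rewrite !mulr_ge0.
Qed.

End NormC.

Section Blocks.
Local Open Scope complex_scope.
Variables (R : realType) (Psi0 : R -> R) (L : nat).
Hypothesis sPsi : forall j, sc (Psi Psi0 L j).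
Variables (f : R * R -> R[i]) (T : Defs.distribution R).
Hypotheses (cf : ccontinuous f) (rf : represents f T).
Hypothesis f0 : forall z, ~ @unit_square R z -> f z = 0.

Definition fre (x y : R) : R := complex.Re (f (x, y)).
Definition fim (x y : R) : R := complex.Im (f (x, y)).

Lemma f_outside x y : (1 < `|x|) || (1 < `|y|) -> f (x, y) = 0.
Proof.
move=> h; apply: f0 => -[] /=; rewrite !in_itv /= => /andP[x0 x1] /andP[y0 y1].
by case/orP: h; rewrite ger0_norm // ltNge ?x1 ?y1.
Qed.

Lemma cont2_pair (g : R * R -> R) : continuous g -> cont2 (fun x y => g (x, y)).
Proof. by move=> cg w; have := cg w; case: w => a b; under [X in _ -> X @ _ --> _]eq_fun do rewrite -surjective_pairing; apply: cvg_trans; apply: near_eq_cvg; apply: filterE => -[]. Qed.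

Lemma bsupp2_fre : bsupp2 1 fre.
Proof. by move=> x y /f_outside; rewrite /fre => ->. Qed.

Lemma bsupp2_fim : bsupp2 1 fim.
Proof. by move=> x y /f_outside; rewrite /fim => ->. Qed.

Lemma cc2_fre : cc2 fre.
Proof. by split; [exact: cont2_pair cf.1|exists 1; exact: bsupp2_fre]. Qed.

Lemma cc2_fim : cc2 fim.
Proof. by split; [exact: cont2_pair cf.2|exists 1; exact: bsupp2_fim]. Qed.

Definition block (m : nat * nat) (x y : R) : R :=
  Normc.normc (convolution (Psi2 Psi0 L m) T (x, y)).

(** The translated and reflected kernel is a test function of tensor form, so the representation by
    [f] evaluates [T] on it. *)
Lemma convolutionE m x y : convolution (Psi2 Psi0 L m) T (x, y) =
  C1 (Psi Psi0 L m.1) (C2 (Psi Psi0 L m.2) fre) x y +i*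
  C1 (Psi Psi0 L m.1) (C2 (Psi Psi0 L m.2) fim) x y.
Proof.
have sr (j : nat) (v : R) : sc (fun t => Psi Psi0 L j (v - t)).
  have m1 : (-1 : R) != 0 by rewrite oppr_eq0 oner_neq0.
  have := sc_affine v m1 (sPsi j); congr sc; apply/funext => t.
  by rewrite mulN1r addrC.
rewrite /convolution -[X in T X]/(tens (fun t => Psi Psi0 L m.1 (x - t)) (fun t => Psi Psi0 L m.2 (y - t))).
rewrite rf; last exact: test_tens.
rewrite cintegral_tens //; try exact/sc_cc/sr.
have c1 := sc_cc (sPsi m.1); have c2 := sc_cc (sPsi m.2).
rewrite (C1C2E x y c1 c2 cc2_fre) (C1C2E x y c1 c2 cc2_fim).
by rewrite -!(eq_I2 (fun t s => mulrC _ (_ * _))).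
Qed.

Lemma block_ge m x y :
  `|C1 (Psi Psi0 L m.1) (C2 (Psi Psi0 L m.2) fre) x y| <= block m x y /\
  `|C1 (Psi Psi0 L m.1) (C2 (Psi Psi0 L m.2) fim) x y| <= block m x y.
Proof. by rewrite /block convolutionE; exact: (normc_ge_ReIm (_ +i* _)). Qed.

Lemma cont2_block m : cont2 (block m).
Proof.
have c1 := sc_cc (sPsi m.1); have c2 := sc_cc (sPsi m.2).
have -> : block m = fun x y => Num.sqrt (
  C1 (Psi Psi0 L m.1) (C2 (Psi Psi0 L m.2) fre) x y ^+ 2 +
  C1 (Psi Psi0 L m.1) (C2 (Psi Psi0 L m.2) fim) x y ^+ 2).
  by apply/funext => x; apply/funext => y; rewrite /block convolutionE.
have cr := (cc2_C1 c1 (cc2_C2 c2 cc2_fre)).1.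
have ci := (cc2_C1 c1 (cc2_C2 c2 cc2_fim)).1.
have cs := cont2D (cont2M cr cr) (cont2M ci ci).
exact: (continuous_compR (@sqrt_continuous R) cs).
Qed.

Lemma block_norm_E p m : block_norm Psi0 L p T m = Lnorm (leb2 R) p (fun z => (block m z.1 z.2)%:E).
Proof. by rewrite /block_norm; congr Lnorm; apply/funext => -[x y]. Qed.

(** [f] lives within radius 1, and each of the two partial convolutions is charged 1 in both
    variables. *)
Lemma bsupp2_block m : (forall j, bsupp 1 (Psi Psi0 L j)) -> bsupp2 3 (block m).
Proof.
move=> b1 x y h.
have E : (3 : R) = 1 + 1 + 1 by ring.
have o1 : (0 : R) < 1 by exact: ltr01.
have o2 : (0 : R) < 1 + 1 by rewrite addr_gt0.
rewrite /block convolutionE.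
rewrite (bsupp2_C1 o2 o1 (b1 m.1) (bsupp2_C2 o1 o1 (b1 m.2) bsupp2_fre)) -?E //.
rewrite (bsupp2_C1 o2 o1 (b1 m.1) (bsupp2_C2 o1 o1 (b1 m.2) bsupp2_fim)) -?E //.
by rewrite /= expr0n /= addr0 sqrtr0.
Qed.

Lemma cc2_block m : (forall j, bsupp 1 (Psi Psi0 L j)) -> cc2 (block m).
Proof. by move=> b1; split; [exact: cont2_block|exists 3; exact: bsupp2_block]. Qed.

Lemma block_ge0 m x y : 0 <= block m x y.
Proof. exact: le_trans (normr_ge0 _) (block_ge m x y).1. Qed.

End Blocks.

Section UpFacts.
Variables (R : realType) (u : R -> R).
Hypothesis up : up_function u.

Lemma up_bsupp : bsupp 1 u.
Proof.
case: up => _ su _ x x1; apply/eqP; apply: contraTT x1 => ux.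
rewrite -leNgt.
have : closure [set x | u x != 0] x by apply: subset_closure.
by rewrite su /= in_itv /= -ler_norml.
Qed.

Lemma up_sc : sc u.
Proof. by case: (up) => su _ _; split; [exact: su|exists 1; exact: up_bsupp]. Qed.

(* The transform at the frequency [0] is the integral, and every factor of the product is [1] there. *)
Lemma up_I1 : I1 u = 1.
Proof.
case: up => _ _ /(_ 0) [h _].
have E : complex.Re (fourier (fun x => (u x)%:C%C) 0) = I1 u.
  rewrite /fourier /cintegral /=; apply: eq_Rintegral => y _.
  by rewrite mulr0 mul0r cos0 sin0 /= mulr1 mul0r subr0.
rewrite -E; apply/esym; apply: (cvg_unique _ _ h); first exact: norm_hausdorff.
apply: cvg_near_cst; apply: nearW => n; rewrite big1 // => i _.
by rewrite mulr0 /sinc eqxx.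
Qed.

End UpFacts.

(** * Dyadic families of kernels *)

Section Dilations.
Variable R : realType.
Implicit Types f u : R -> R.

Lemma bsupp_dil c A f : 0 < c -> bsupp A f -> bsupp (A / c) (dil c f).
Proof.
move=> c0 fA x; rewrite ltr_pdivrMr // => h; rewrite /dil fA ?mulr0 //.
by rewrite normrM gtr0_norm // mulrC.
Qed.

Lemma bsupp_derive1n A f n : sc f -> bsupp A f -> bsupp A (derive1n n f).
Proof.
move=> sf fA; elim: n => [//|n IH]; rewrite derive1nS.
by apply: bsupp_derive => //; exact: (sc_derive1n n sf).1.
Qed.

Lemma CK_dil K a A c f : 0 < c -> CK K a A f -> CK K (c * a) (c * A) (dil c f).
Proof.
move=> c0 h; have := CK_scale c (CK_affine c 0 h).
by rewrite (gtr0_norm c0) -dilE.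
Qed.

Lemma dilD c f g : dil c (fun x => f x + g x) = fun x => dil c f x + dil c g x.
Proof. by apply/funext => x; rewrite /dil mulrDr. Qed.

Lemma I1_norm_dil c f : 0 < c -> cc f -> I1 (fun x => `|dil c f x|) = I1 (fun x => `|f x|).
Proof.
move=> c0 cf; rewrite -(I1_dil c0 (cc_norm cf)); apply: eq_I1 => x.
by rewrite /dil normrM gtr0_norm.
Qed.

(** Common shape of the kernels [Psi] and of their partners in the reproducing formula; level
    [j >= 1] carries the dilation [2^(j-1)]. *)
Definition dyadic (f0 f : R -> R) (j : nat) : R -> R :=
  if j is k.+1 then dil (2 ^+ k) f else f0.

Let pow2 k : (0 : R) < 2 ^+ k. Proof. by rewrite exprn_gt0. Qed.

Lemma sc_dyadic f0 f j : sc f0 -> sc f -> sc (dyadic f0 f j).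
Proof. by move=> s0 sf; case: j => [//|k] /=; apply: sc_dil => //; rewrite gt_eqF. Qed.

(** All bounds are expressed by [2^j], although level [j] is dilated by [2^(j-1)] only; hence the
    factor 2 in the radius. *)
Lemma dyadic_bounds f0 f K : sc f0 -> sc f -> exists r M M' : R,
  [/\ 0 < r, 0 < M & 0 < M'] /\ forall j,
  [/\ CK K (2 ^+ j) (2 ^+ j * M) (dyadic f0 f j), bsupp (r / 2 ^+ j) (dyadic f0 f j) &
      I1 (fun x => `|dyadic f0 f j x|) <= M'].
Proof.
move=> s0 sf.
have [A0 A00 h0] := sc_CK K s0; have [A1 A10 h1] := sc_CK K sf.
have c0 := sc_cc s0; have cf := sc_cc sf.
have [r0 r00 b0] := cc_bsupp c0; have [r1 r10 b1] := cc_bsupp cf.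
have i0 : 0 <= I1 (fun x => `|f0 x|) by exact: I1_ge0.
have i1 : 0 <= I1 (fun x => `|f x|) by exact: I1_ge0.
exists (r0 + 2 * r1), (A0 + A1), (I1 (fun x => `|f0 x|) + I1 (fun x => `|f x|) + 1).
split; first by split; [lra|lra|lra].
case=> [|k] /=; split.
- rewrite expr0 mul1r; apply: CK_le h0 => //; lra.
- rewrite expr0 divr1; apply: bsuppW b0; lra.
- by lra.
- apply: CK_le (CK_dil (pow2 k) h1); rewrite ?mulr1.
  + exact: ltW.
  + by rewrite exprS; have := pow2 k; lra.
  + rewrite exprS mulrAC mulrC; apply: ler_pM; [exact: ltW|exact: ltW| |].
      by have := pow2 k; lra.
    by lra.
- apply: bsuppW (bsupp_dil (pow2 k) b1).
  rewrite exprS invfM mulrA; apply: ler_wpM2r; first by rewrite invr_ge0 ltW.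
  by lra.
- by rewrite I1_norm_dil //; lra.
Qed.

Lemma Psi_dyadic u L j : Psi u L j = dyadic u (Psi1 u L) j.
Proof. by case: j. Qed.

Lemma sc_wavelet u : sc u -> sc (fun x => 2 * u (2 * x) - u x).
Proof.
move=> su; have -> : (fun x => 2 * u (2 * x) - u x) = fun x => dil 2 u x + (-1) * u x.
  by apply/funext => x; rewrite /dil mulN1r.
by apply: scD; [apply: sc_dil|apply: scZ].
Qed.

Lemma sc_Psi u L j : sc u -> sc (Psi u L j).
Proof.
move=> su; rewrite Psi_dyadic; apply: sc_dyadic => //.
by apply: sc_derive1n; exact: sc_wavelet.
Qed.

Lemma bsupp_Psi u L j : sc u -> bsupp 1 u -> bsupp 1 (Psi u L j).
Proof.
move=> su u1; rewrite Psi_dyadic; case: j => [//|k] /=.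
have h : bsupp 1 (Psi1 u L).
  apply: bsupp_derive1n (sc_wavelet su) _ => x x1; rewrite !u1 ?mulr0 ?subr0 //.
  by rewrite normrM ger0_norm //; lra.
apply: bsuppW (bsupp_dil (pow2 k) h).
by rewrite div1r invf_le1 // exprn_ege1 // ler1n.
Qed.

(** Telescoping: passing from [J] to [J + 1] adds the dilate by [2^J] of [dil 2 zeta - zeta], and
    dilation commutes with convolution. *)
Lemma reproducing_sum u L lam0 lam zeta : sc u -> sc lam0 -> sc lam -> sc zeta ->
  zeta = conv lam0 u ->
  (fun x => dil 2 zeta x - zeta x) = conv lam (derive1n L (fun x => 2 * u (2 * x) - u x)) ->
  forall J, dil (2 ^+ J) zeta =
    fun x => \sum_(0 <= j < J.+1) conv (dyadic lam0 lam j) (Psi u L j) x.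
Proof.
move=> su s0 sl sz e0 e1; elim=> [|J IH]; apply/funext => x.
  by rewrite big_nat1 /= -[conv _ _]e0 /dil expr0 !mul1r.
rewrite big_nat_recr //= -[X in _ = X + _](congr1 (@^~ x) IH) exprSr -dil_dil.
have -> : dil 2 zeta = fun x => zeta x + conv lam (Psi1 u L) x.
  by apply/funext => y; rewrite /Psi1 -e1; ring.
rewrite dilD; congr (_ + _).
rewrite -(dil_conv (pow2 J)) //; first exact: sc_cc.
by apply/sc_cc/sc_derive1n/sc_wavelet.
Qed.

End Dilations.

(** * Summation over the blocks *)

(** The distance of [k] and [c]: one of the two truncated differences is 0. *)
Definition ndist (k c : nat) : nat := (k - c + (c - k))%N.

Lemma ndist_le k c : (k <= c)%N -> ndist k c = (c - k)%N.
Proof. by rewrite /ndist; lia. Qed.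

Lemma ndist_ge k c : (c <= k)%N -> ndist k c = (k - c)%N.
Proof. by rewrite /ndist; lia. Qed.

Section GeometricSums.
Variable R : realType.
Variable rho : R.
Hypotheses (r0 : 0 < rho) (r1 : rho < 1).

Let S := (1 - rho)^-1.
Let S0 : 0 < S. Proof. by rewrite invr_gt0 subr_gt0. Qed.
Let S1 : 1 + rho * S = S.
Proof. have n0 : 1 - rho != 0 by rewrite gt_eqF // subr_gt0.
by rewrite /S; field. Qed.

Lemma sum_geometric J : \sum_(k < J) rho ^+ k <= S.
Proof.
elim: J => [|J IH]; first by rewrite big_ord0 ltW.
rewrite big_ord_recl expr0 -S1 lerD2l.
under eq_bigr do rewrite lift0 exprS.
by rewrite -mulr_sumr ler_wpM2l // ltW.
Qed.

Lemma sum_dist_center c J : \sum_(k < J) rho ^+ ndist k c <= 2 * S.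
Proof.
suff h : \sum_(k < J) rho ^+ ndist k c <= \sum_(k < c) rho ^+ k.+1 + S.
  apply: le_trans h _; rewrite mulr_natl mulr2n lerD2r.
  apply: le_trans (sum_geometric c); apply: ler_sum => k _.
  by rewrite exprS ler_piMl ?exprn_ge0 // ltW.
elim: c J => [|c IH] J.
  rewrite big_ord0 add0r; apply: le_trans (sum_geometric J).
  by apply: ler_sum => k _; rewrite /ndist subn0 sub0n addn0.
case: J => [|J].
  rewrite big_ord0; apply: addr_ge0; last exact: ltW.
  by apply: sumr_ge0 => i _; rewrite exprn_ge0 // ltW.
rewrite big_ord_recl /= /ndist sub0n subn0 add0n big_ord_recr /=.
under eq_bigr => i _ do rewrite -[bump 0 i]/i.+1 !subSS.
by have := IH J; rewrite /ndist; lra.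
Qed.

Lemma sum_tail c J : \sum_(k < J) rho ^+ (k - c) <= c%:R + S.
Proof.
elim: c J => [|c IH] J.
  rewrite add0r; apply: le_trans (sum_geometric J).
  by apply: ler_sum => k _; rewrite subn0.
case: J => [|J]; first by rewrite big_ord0; apply: addr_ge0 => //; exact: ltW.
rewrite big_ord_recl /= sub0n expr0.
under eq_bigr => i _ do rewrite -[bump 0 i]/i.+1 subSS.
by have := IH J; rewrite -natr1; lra.
Qed.

(** Rows [j <= c] meet the diagonal [j + k = c] and contribute a two-sided geometric series each;
    later rows decay geometrically. The number [c + 1] of full rows is the source of the
    logarithm. *)
Lemma sum_dist_diagonal c J :
  \sum_(j < J) \sum_(k < J) rho ^+ ndist (j + k) c <= 2 * S ^+ 2 * c.+1%:R.
Proof.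
have inner (j : nat) : \sum_(k < J) rho ^+ ndist (j + k) c <= rho ^+ (j - c) * (2 * S).
  have [jc|cj] := leqP j c.
    have -> : (j - c = 0)%N by lia.
    rewrite expr0 mul1r; apply: le_trans (sum_dist_center (c - j) J).
    by apply: ler_sum => k _; rewrite (_ : ndist (j + k) c = ndist k (c - j)) // /ndist; lia.
  apply: (@le_trans _ _ (rho ^+ (j - c) * \sum_(k < J) rho ^+ k)).
    rewrite mulr_sumr; apply: ler_sum => k _; rewrite -exprD.
    by rewrite (_ : ndist (j + k) c = (j - c + k)%N) // /ndist; lia.
  apply: ler_wpM2l; first by rewrite exprn_ge0 // ltW.
  by have := sum_geometric J; move: S0; lra.
apply: (@le_trans _ _ (\sum_(j < J) rho ^+ (j - c) * (2 * S))).
  by apply: ler_sum => j _; exact: inner.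
rewrite -mulr_suml; have -> : 2 * S ^+ 2 * c.+1%:R = (c.+1%:R * S) * (2 * S) by ring.
apply: ler_wpM2r; first by rewrite mulr_ge0 // ltW.
apply: le_trans (sum_tail c J) _.
have S11 : 1 <= S by move: S1 (mulr_ge0 (ltW r0) (ltW S0)); lra.
rewrite -natr1 mulrDl mul1r lerD2r.
by apply: ler_peMr.
Qed.

End GeometricSums.

(** * Hoelder's inequality over the blocks and decay of the weights *)

Section BesovCoefficients.
Variables (R : realType) (u : R -> R) (L : nat) (s : R) (p : \bar R).

(** The same splitting as in [Lp_young], at the threshold [a = b]. *)
Lemma young_powR (a b t : R) : 1 <= t -> 0 < b -> 0 <= a -> a <= b `^ (1 - t) * a `^ t + b.
Proof.
move=> t1 b0 a0; have [ab|ba] := leP a b.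
  by rewrite -[a]add0r lerD // mulr_ge0 // powR_ge0.
have a1 : 0 < a by exact: lt_trans ba.
rewrite -[X in X <= _]addr0 lerD //; last exact: ltW.
have -> : b `^ (1 - t) = (b `^ (t - 1))^-1 by rewrite -powRN opprB.
rewrite mulrC ler_pdivlMr ?powR_gt0 // -(@mulr_powRB1 _ a t) //; last by move: t1; lra.
apply: ler_wpM2l => //; apply: ge0_ler_powR; rewrite ?nnegrE ?subr_ge0 //; exact: ltW.
Qed.

Lemma esum_seq_le (a : nat * nat -> \bar R) (ms : seq (nat * nat)) : uniq ms ->
  (\sum_(m <- ms) a m <= \esum_(m in [set: nat * nat]) a m)%E.
Proof.
move=> ums; apply: esum_ge; exists [set` ms].
  by split => //; exact: finite_seq.
by rewrite -fsbig_seq.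
Qed.

(** The coefficients [a m] are the weighted block norms, a family in the unit ball of l_theta. The
    last clause replaces Hoelder's inequality against weights that are at most [S] and effectively
    [n] in number. *)
Lemma besov_coefficients (theta : \bar R) (T : Defs.distribution R) :
  (1 <= theta)%E -> (besov_norm u L s p theta T <= 1)%E ->
  exists a : nat * nat -> R, [/\ forall m, 0 <= a m,
   forall m, block_norm u L p T m = (2 `^ (- (s * (m.1 + m.2)%:R)) * a m)%:E &
   forall (ms : seq (nat * nat)) (w : nat * nat -> R) (S n : R), uniq ms -> 0 <= S -> 1 <= n ->
     (forall m, 0 <= w m <= S) -> \sum_(m <- ms) w m <= S * n ->
     \sum_(m <- ms) a m * w m <= 2 * S * n `^ (1 - fine theta^-1%E)].
Proof.
have p2 (x : R) : 0 < 2 `^ x by rewrite powR_gt0.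
have bn0 m : (0 <= block_norm u L p T m)%E by exact: Lnorm_ge0.
pose a m := 2 `^ (s * (m.1 + m.2)%:R) * fine (block_norm u L p T m).
have a0 m : 0 <= a m by rewrite mulr_ge0 ?fine_ge0 // ltW.
have ba m : block_norm u L p T m \is a fin_num ->
    block_norm u L p T m = (2 `^ (- (s * (m.1 + m.2)%:R)) * a m)%:E.
  by move=> h; rewrite /a mulrA powRN mulVf ?gt_eqF // mul1r fineK.
case: theta => [t||] //.
  rewrite lee_fin => t1; rewrite /besov_norm => h.
  have t0 : 0 < t by lra.
  have h1 : (\esum_(m in [set: nat * nat]) ((2 `^ (s * (m.1 + m.2)%:R * t))%:E * block_norm u L p T m `^ t) <= 1)%E.
    set X := esum _ _ in h *.
    have X0 : (0 <= X)%E by apply: esum_ge0 => m _; apply: mule_ge0; [rewrite lee_fin; exact: ltW|exact: poweR_ge0].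
    have := @gt0_ler_poweR _ t (ltW t0) (X `^ t^-1)%E 1%E _ _ h.
    rewrite poweR1r -poweRrM mulVf ?gt_eqF // poweRe1 //; apply.
      by rewrite in_itv /= poweR_ge0 leey.
    by rewrite in_itv /= lee01 leey.
  have fin m : block_norm u L p T m \is a fin_num.
    have := le_trans (esum_seq_le (fun m => ((2 `^ (s * (m.1 + m.2)%:R * t))%:E * block_norm u L p T m `^ t)%E) (ms := [:: m]) erefl) h1.
    rewrite big_seq1 => h2.
    rewrite ge0_fin_numE //; case E : (block_norm u L p T m) (bn0 m) h2 => [x||] // _.
      by rewrite ltry.
    by rewrite poweRyr ?gt_eqF // gt0_muley ?lte_fin // leye_eq.
  have aE m : ((2 `^ (s * (m.1 + m.2)%:R * t))%:E * block_norm u L p T m `^ t)%E = (a m `^ t)%:E.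
    rewrite -(fineK (fin m)) poweR_EFin -EFinM powRrM -powRM //.
    by rewrite fine_ge0.
  exists a; split=> [//|m|ms w S n ums S0 n1 wS hw]; first by apply: ba.
  have sa : \sum_(m <- ms) a m `^ t <= 1.
    rewrite -lee_fin -sumEFin; apply: le_trans h1.
    by under eq_bigr do rewrite -aE; apply: (@esum_seq_le (fun m => ((2 `^ (s * (m.1 + m.2)%:R * t))%:E * block_norm u L p T m `^ t)%E)).
  rewrite inve_EFin //=.
  (* With this threshold [b^(1 - t)] and [b n] both equal [n^(1 - 1/t)], so the two parts are
     balanced. *)
  pose b := n `^ (- t^-1); have n0 : 0 < n by lra.
  have b0 : 0 < b by rewrite powR_gt0.
  apply: (@le_trans _ _ (b `^ (1 - t) * S * \sum_(m <- ms) a m `^ t + b * \sum_(m <- ms) w m)).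
    rewrite !mulr_sumr -big_split /=; apply: ler_sum => m _.
    have /andP[w0 w1] := wS m.
    apply: (@le_trans _ _ ((b `^ (1 - t) * a m `^ t + b) * w m)).
      by apply: ler_wpM2r => //; exact: young_powR.
    rewrite mulrDl lerD2r mulrAC; apply: ler_wpM2r; first exact: powR_ge0.
    by apply: ler_wpM2l => //; exact: powR_ge0.
  have -> : b `^ (1 - t) = n `^ (1 - t^-1).
    by rewrite /b -powRrM; congr (_ `^ _); rewrite mulrBr mulr1 mulNr mulVf ?gt_eqF //; ring.
  have bn : b * n = n `^ (1 - t^-1).
    by rewrite /b addrC powRD ?powRr1 ?(gt_eqF n0) ?implybT // ltW.
  rewrite -(mulrA 2) mulr_natl mulr2n; apply: lerD.
    rewrite [S * _]mulrC; apply: ler_piMr => //.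
    by rewrite mulr_ge0 // powR_ge0.
  rewrite -bn mulrCA; apply: ler_wpM2l; first exact: ltW.
  exact: hw.
move=> _; rewrite /besov_norm => h.
have h1 m : ((2 `^ (s * (m.1 + m.2)%:R))%:E * block_norm u L p T m <= 1)%E.
  by apply: le_trans h; apply: ereal_sup_ubound; exists m.
have fin m : block_norm u L p T m \is a fin_num.
  rewrite ge0_fin_numE //; case E : (block_norm u L p T m) (bn0 m) (h1 m) => [x||] // _.
    by rewrite ltry.
  by rewrite gt0_muley ?lte_fin // leye_eq.
exists a; split=> [//|m|ms w S n ums S0 n1 wS hw]; first by apply: ba.
rewrite invey /= subr0 powRr1; last by lra.
have a1 m : a m <= 1 by rewrite -lee_fin /a EFinM fineK.
apply: (@le_trans _ _ (\sum_(m <- ms) w m)).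
  by apply: ler_sum => m _; apply: ler_piMl => //; case/andP: (wS m).
apply: le_trans hw _; rewrite -mulrA mulr_natl mulr2n lerDl mulr_ge0 //; lra.
Qed.

End BesovCoefficients.

Section DecayWeights.
Variable R : realType.

Lemma powR_nat_exp (x e : R) k : 0 <= x -> (x ^+ k) `^ e = (x `^ e) ^+ k.
Proof. by move=> x0; rewrite -powR_mulrn // -powRrM mulrC powRrM powR_mulrn // powR_ge0. Qed.

(* [rho = 2^-eps] where [eps] is the smaller of the two gaps [L + 1 - s] and [s - 1/p]. *)
Lemma decay_weight (s : R) (p : \bar R) (L : nat) : fine (p^-1)%E < s -> s < L.+1%:R ->
  exists rho C : R, [/\ 0 < rho, rho < 1, 0 < C & forall N n k : nat, (2 ^ n <= N < 2 ^ n.+1)%N ->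
    0 <= 2 `^ (- (s * k%:R)) * block_decay p L (2 ^+ k / N%:R) <= C * N%:R `^ (- s) * rho ^+ ndist k n].
Proof.
move=> ps sL; set e1 := fine _ in ps.
pose eps : R := Num.min (L.+1%:R - s) (s - e1).
have e0 : 0 < eps by rewrite lt_min !subr_gt0 ps sL.
have eL : eps <= L.+1%:R - s by rewrite ge_min lexx.
have ep : eps <= s - e1 by rewrite ge_min lexx orbT.
pose rho : R := 2 `^ (- eps); have r0 : 0 < rho by rewrite powR_gt0.
have r1 : rho < 1.
  rewrite /rho powRN invf_lt1 ?powR_gt0 //.
  rewrite -[X in X < _](congr1 (@^~ eps) (@powR1 R)); apply: gt0_ltr_powR; rewrite ?nnegrE //.
  by rewrite ltr1n.
(* The constant [rho^-1] pays for rounding [N] to a power of 2: for [k > n] only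
   [tau >= 2^(k - n - 1)] is available. *)
exists rho, (rho^-1); split=> //; first by rewrite invr_gt0.
move=> N n k /andP[nN Nn].
have N0 : (0 : R) < N%:R by rewrite ltr0n; apply: leq_trans nN; rewrite expn_gt0.
have pk : (0 : R) < 2 ^+ k by rewrite exprn_gt0.
pose tau : R := 2 ^+ k / N%:R; have t0 : 0 < tau by rewrite divr_gt0.
apply/andP; split.
  apply: mulr_ge0; first exact: powR_ge0.
  rewrite /block_decay; case: ifP => _; first by rewrite exprn_ge0 // ltW.
  exact: powR_ge0.
have -> : 2 `^ (- (s * k%:R)) = N%:R `^ (- s) * tau `^ (- s) :> R.
  rewrite -powRM ?ltW // /tau [N%:R * _]mulrC divfK ?gt_eqF // powR_nat_exp // -powR_mulrn ?powR_ge0 //.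
  by rewrite -powRrM mulNr.
rewrite [_ * N%:R `^ _]mulrC -!mulrA; apply: ler_wpM2l; first exact: powR_ge0.
have tD (a b : R) : tau `^ a * tau `^ b = tau `^ (a + b) by rewrite powRD // (gt_eqF t0) implybT.
have rE j : rho ^+ j = (2 ^+ j) `^ (- eps) by rewrite powR_nat_exp.
rewrite /block_decay -/tau; case: ifP => [t1|/negbT]; last rewrite -ltNge => t1.
  rewrite -powR_mulrn ?(ltW t0) // tD.
  have kn : (k <= n)%N.
    rewrite -ltnS -(@ltn_exp2l 2) //; apply: leq_ltn_trans Nn.
    by rewrite -(ler_nat R) natrX; move: t1; rewrite /tau ler_pdivrMr // mul1r.
  apply: (@le_trans _ _ (tau `^ eps)).
    rewrite (_ : - s + L.+1%:R = eps + (L.+1%:R - s - eps)); last by ring.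
    rewrite -tD; apply: ler_piMr; first exact: powR_ge0.
    rewrite -[X in _ <= X](congr1 (@^~ (L.+1%:R - s - eps)) (@powR1 R)).
    by apply: ge0_ler_powR; rewrite ?nnegrE ?subr_ge0 // ltW.
  apply: (@le_trans _ _ (rho ^+ ndist k n)); last first.
    by apply: ler_peMl; [rewrite exprn_ge0 // ltW|rewrite invf_ge1 // ltW].
  rewrite ndist_le //.
  have p2 : (0 : R) < 2 ^+ (n - k) by rewrite exprn_gt0.
  rewrite rE -[- eps]mulN1r powRrM powR_inv1 ?(ltW p2) //.
  apply: ge0_ler_powR; rewrite ?nnegrE ?invr_ge0 ?(ltW e0) ?(ltW p2) ?(ltW t0) //.
  rewrite /tau ler_pdivrMr // mulrC ler_pdivlMr // -exprD addnC subnK //.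
  by rewrite -natrX ler_nat.
rewrite tD.
have nk : (n < k)%N.
  rewrite -(@ltn_exp2l 2) //; apply: leq_ltn_trans nN _.
  by rewrite -(ltr_nat R) natrX; move: t1; rewrite /tau ltr_pdivlMr // mul1r.
apply: (@le_trans _ _ (tau `^ (- eps))).
  by apply: ler_powR; [exact: ltW|rewrite -/e1; move: ep; lra].
have -> : rho^-1 * rho ^+ ndist k n = rho ^+ (k - n.+1).
  rewrite ndist_ge; last exact: ltnW.
  by rewrite -(subSS n k) subSn // exprS mulKf // gt_eqF.
have p2 : (0 : R) < 2 ^+ (k - n.+1) by rewrite exprn_gt0.
rewrite rE !powRN lef_pV2 ?posrE ?powR_gt0 //.
apply: ge0_ler_powR; rewrite ?nnegrE ?(ltW e0) ?(ltW p2) ?(ltW t0) //.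
rewrite /tau ler_pdivlMr //; apply: (@le_trans _ _ (2 ^+ (k - n.+1) * 2 ^+ n.+1)).
  by apply: ler_wpM2l; [exact: ltW|rewrite -natrX ler_nat ltnW].
by rewrite -exprD subnK.
Qed.

End DecayWeights.

(** * Upper bound *)

Section LatticeError.
Variable R : realType.

Definition lattice_error (alpha : R) (N B : nat) (h : R -> R -> R) : R :=
  I2 h - N%:R^-1 * \sum_(z <- latbox alpha N B) h (lat alpha N z).1 (lat alpha N z).2.

Lemma lattice_error_sum alpha N B (T : Type) (ms : seq T) (G : T -> R -> R -> R) :
  (forall m, cc2 (G m)) ->
  lattice_error alpha N B (fun x y => \sum_(m <- ms) G m x y) =
  \sum_(m <- ms) lattice_error alpha N B (G m).
Proof.
move=> cG; rewrite /lattice_error I2_sum // sumrB; congr (_ - _).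
by rewrite exchange_big /= mulr_sumr.
Qed.

Lemma C1C2_shift (k l : R -> R) h x y : cc k -> cc l -> cont2 h ->
  C1 k (C2 l h) x y = I2 (fun t s => k t * l s * h (x - t) (y - s)).
Proof.
move=> ck cl ch; rewrite /C1 /C2 /conv /I2; apply: eq_I1 => t.
have cs : continuous (fun s => h (x - t) (y - s)).
  apply: (cont2_comp ch); first by move=> ?; exact: cvg_cst.
  by move=> z; apply: cvgB; [exact: cvg_cst|exact: cvg_id].
rewrite -I1Zr; last exact: ccM.
by apply: eq_I1 => s; rewrite mulrC [h _ _ * _]mulrC mulrA.
Qed.

Lemma approximate_identity_seq (z : R -> R) h (pts : seq (R * R)) (e : R) :
  cc z -> I1 z = 1 -> cont2 h -> 0 < e ->
  exists J, forall w, w \in pts ->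
    `|C1 (dil (2 ^+ J) z) (C2 (dil (2 ^+ J) z) h) w.1 w.2 - h w.1 w.2| <= e.
Proof.
move=> cz z1 ch e0.
suff [J HJ] : exists J0, forall J, (J0 <= J)%N -> forall w, w \in pts ->
    `|C1 (dil (2 ^+ J) z) (C2 (dil (2 ^+ J) z) h) w.1 w.2 - h w.1 w.2| <= e.
  by exists J; apply: HJ.
elim: pts => [|w pts [J1 H1]]; first by exists 0%N.
have [J2 H2] := approximate_identity w.1 w.2 cz z1 ch e0.
exists (maxn J1 J2) => J; rewrite geq_max => /andP[h1 h2] v.
have cd : cc (dil (2 ^+ J) z) by apply: cc_dil => //; rewrite gt_eqF // exprn_gt0.
rewrite inE => /predU1P[->|/(H1 J h1) //].
by rewrite (C1C2_shift _ _ cd cd ch); exact: H2.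
Qed.

(** Smoothing with a kernel of integral 1 preserves the integral exactly, so only the values at the
    finitely many points of the box have to converge. *)
Lemma lattice_error_limit alpha N B (z : R -> R) h (V : R) : (0 < N)%N ->
  cc z -> I1 z = 1 -> cc2 h ->
  (forall J, `|lattice_error alpha N B (C1 (dil (2 ^+ J) z) (C2 (dil (2 ^+ J) z) h))| <= V) ->
  `|lattice_error alpha N B h| <= V.
Proof.
move=> N0 cz z1 ch HV; apply/ler_addgt0Pr => e e0.
pose pts := [seq lat alpha N z | z <- latbox alpha N B].
pose e' := e / (size pts).+1%:R.
have e'0 : 0 < e' by rewrite divr_gt0.
have [J HJ] := approximate_identity_seq pts cz z1 ch.1 e'0.
have j0 : (0 : R) < 2 ^+ J by rewrite exprn_gt0.
have cd : cc (dil (2 ^+ J) z) by apply: cc_dil => //; rewrite gt_eqF.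
set k := C1 _ _ in HJ.
have HVJ := HV J; rewrite -/k in HVJ.
have E : lattice_error alpha N B h = lattice_error alpha N B k +
    N%:R^-1 * \sum_(w <- pts) (k w.1 w.2 - h w.1 w.2).
  have Ik : I2 k = I2 h.
    rewrite I2_C1 ?I2_C2 //; last exact: cc2_C2.
    by rewrite I1_dil // z1 !mul1r.
  rewrite /lattice_error Ik sumrB /pts !big_map; ring.
rewrite E; apply: le_trans (ler_normD _ _) _; apply: lerD => //.
rewrite normrM gtr0_norm ?invr_gt0 ?ltr0n //.
apply: (@le_trans _ _ `|\sum_(w <- pts) (k w.1 w.2 - h w.1 w.2)|).
  by apply: ler_piMl => //; rewrite invf_le1 ?ltr0n // ler1n.
apply: le_trans (ler_norm_sum _ _ _) _.
apply: (@le_trans _ _ (\sum_(w <- pts) e')).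
  by rewrite big_seq [X in _ <= X]big_seq; apply: ler_sum => w /HJ.
rewrite big_const_seq count_predT iter_addr_0 -[e' *+ _]mulr_natr /e' -mulrA; apply: ler_piMr; first exact: ltW.
by rewrite mulrC ler_pdivrMr // mul1r ler_nat.
Qed.

Lemma right_limit0 (g : R -> R) : continuous g -> (forall x, 1 < x -> g x = 0) -> g 1 = 0.
Proof.
move=> cg g0; have h := cvg_at_right_filter (cg 1).
apply: (cvg_unique _ h); first exact: norm_hausdorff.
apply: cvg_near_cst; near=> x; apply: g0; near: x; exact: nbhs_right_gt.
Unshelve. all: by end_near. Qed.

(** By continuity [h] also vanishes for [x = 1] and for [y = 1]. In the half-open square remain
    exactly the indices [0 <= n < N] with [k] the floor of [n alpha]. *)
Lemma latbox_sum alpha N B (h : R -> R -> R) : (0 < N)%N -> (2 <= B)%N -> cont2 h ->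
  (forall x y, h x y != 0 -> 0 <= x <= 1 /\ 0 <= y <= 1) ->
  \sum_(z <- latbox alpha N B) h (lat alpha N z).1 (lat alpha N z).2 =
  \sum_(n < N) h (kronecker_set alpha n).1 (kronecker_set alpha n).2.
Proof.
move=> N0 B2 ch h0.
have B2R : (2 : R) <= B%:R by rewrite ler_nat.
have NR : (0 : R) < N%:R by rewrite ltr0n.
have h1 x y : h x y != 0 -> 0 <= x < 1 /\ 0 <= y < 1.
  move=> hn; have [/andP[x0 x1] /andP[y0 y1]] := h0 x y hn.
  rewrite x0 y0 /= !lt_neqAle x1 y1 !andbT; split; apply: contraNneq hn => e; apply/eqP; rewrite e.
    apply: (@right_limit0 (h^~ y) (@cont2_r _ h y ch)) => t t1; apply/eqP/negPn/negP => /h0[/andP[_ ]].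
    by rewrite leNgt t1.
  apply: (@right_limit0 (h x) (@cont2_l _ h x ch)) => t t1; apply/eqP/negPn/negP => /h0[_ /andP[_ ]].
  by rewrite leNgt t1.
pose pts : seq (int * int) := [seq (n%:Z, Num.floor (n%:R * alpha)) | n <- iota 0 N].
rewrite (@big_supp_eq _ _ _ pts (fun z => h (lat alpha N z).1 (lat alpha N z).2) (uniq_latbox alpha N B)).
- rewrite big_map -[N in iota 0 N]subn0 -/(index_iota 0 N) big_mkord; apply: eq_bigr => n _.
  by rewrite /lat /kronecker_set /Defs.frac /=.
- by rewrite map_inj_uniq ?iota_uniq // => m n [].
- move=> [n k] /h1[/andP[x0 x1] /andP[y0 y1]]; apply: mem_latbox => //.
    by rewrite ger0_norm //; apply: ltW; apply: lt_le_trans x1 _; lra.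
  by rewrite ger0_norm //; lra.
move=> [n k] /h1 /= [/andP[x0 x1] /andP[y0 y1]].
have n0 : (0 <= n)%R by move: x0; rewrite pmulr_lge0 ?invr_gt0 // ler0z.
have nN : n < N%:Z by move: x1; rewrite ltr_pdivrMr // mul1r -(ltr_int R).
apply/mapP; exists `|n|%N; first by rewrite mem_iota; lia.
have En : n = `|n|%N%:Z by rewrite gez0_abs.
rewrite -En; congr (_, _); apply/esym.
have -> : `|n|%N%:R = n%:~R :> R by rewrite {2}En.
apply: Num.Theory.floor_def; apply/andP; split; first by move: y0; rewrite subr_ge0.
by rewrite intrD; move: y1; lra.
Qed.

End LatticeError.

Section Exponents.
Variable R : realType.

Lemma inve_bounds (t : \bar R) : (1 <= t)%E -> 0 <= fine t^-1%E <= 1.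
Proof.
case: t => [t||] //; last by rewrite invey /= lexx ler01.
rewrite lee_fin => t1; rewrite inve_EFin //= invr_ge0 invf_le1; last by lra.
by apply/andP; split; [lra|].
Qed.

Lemma fine_inve_lt (p : \bar R) (s : R) : (1 <= p)%E -> (p^-1 < s%:E)%E -> fine (p^-1)%E < s.
Proof.
case: p => [t||] //; first by rewrite lee_fin => t1; rewrite inve_EFin.
Qed.

Lemma log2_bounds (N n : nat) : (2 <= N)%N -> (2 ^ n <= N < 2 ^ n.+1)%N ->
  [/\ 1 <= log2 N%:R :> R, n%:R <= log2 N%:R :> R & log2 N%:R <= n.+1%:R :> R].
Proof.
move=> N2 /andP[nN Nn].
have l2 : 0 < ln (2 : R) by rewrite ln_gt0 // ltr1n.
have N0 : (0 : R) < N%:R by rewrite ltr0n; lia.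
have lX k : ln ((2 : R) ^+ k) = k%:R * ln 2.
  by rewrite -powR_mulrn // ln_powR.
rewrite /log2; split.
- by rewrite ler_pdivlMr // mul1r ler_ln ?posrE // ler_nat.
- rewrite ler_pdivlMr // -lX ler_ln ?posrE ?exprn_gt0 //.
  by rewrite -natrX ler_nat.
rewrite ler_pdivrMr // -lX ler_ln ?posrE ?exprn_gt0 //.
by rewrite -natrX ler_nat ltnW.
Qed.

End Exponents.

Section UpperBound.
Variable R : realType.

(** Partial convolutions in different variables commute, so each analysing kernel can be joined with
    its partner in the same variable; [reproducing_sum] then applies in each variable. *)
Lemma lattice_error_reproduced alpha N B (u : R -> R) (L : nat) lam0 lam zeta h J :
  sc u -> sc lam0 -> sc lam -> sc zeta -> zeta = conv lam0 u ->
  (fun x => dil 2 zeta x - zeta x) = conv lam (derive1n L (fun x => 2 * u (2 * x) - u x)) ->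
  cc2 h ->
  lattice_error alpha N B (C1 (dil (2 ^+ J) zeta) (C2 (dil (2 ^+ J) zeta) h)) =
  \sum_(i < J.+1) \sum_(j < J.+1) lattice_error alpha N B
    (C1 (dyadic lam0 lam i) (C2 (dyadic lam0 lam j) (C1 (Psi u L i) (C2 (Psi u L j) h)))).
Proof.
move=> su s0 sl sz e0 e1 ch.
have rep := reproducing_sum su s0 sl sz e0 e1 J.
have cP i : cc (Psi u L i) by exact/sc_cc/sc_Psi.
have cL i : cc (dyadic lam0 lam i) by exact/sc_cc/sc_dyadic.
have cLP i : cc (conv (dyadic lam0 lam i) (Psi u L i)) by exact: cc_conv.
pose G i j := C1 (dyadic lam0 lam i) (C2 (dyadic lam0 lam j) (C1 (Psi u L i) (C2 (Psi u L j) h))).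
have cG i j : cc2 (G i j) by apply: cc2_C1 => //; apply: cc2_C2 => //; apply: cc2_C1 => //; exact: cc2_C2.
have GE i j : G i j = C1 (conv (dyadic lam0 lam i) (Psi u L i)) (C2 (conv (dyadic lam0 lam j) (Psi u L j)) h).
  have c2 := cc2_C2 (cP j) ch.
  rewrite (convC (cL i) (cP i)) (convC (cL j) (cP j)).
  rewrite /G -(C1C2 (cP i) (cL j) c2) (C1_conv (cL i) (cP i) (cc2_C2 (cL j) c2)) (C2_conv (cL j) (cP j) ch).
  by [].
have -> : C1 (dil (2 ^+ J) zeta) (C2 (dil (2 ^+ J) zeta) h) =
    fun x y => \sum_(i < J.+1) \sum_(j < J.+1) G i j x y.
  apply/funext => x; apply/funext => y.
  have -> : dil (2 ^+ J) zeta = fun x => \sum_(i < J.+1) conv (dyadic lam0 lam i) (Psi u L i) x.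
    by rewrite rep; apply/funext => t; rewrite big_mkord.
  set z := (fun x => _).
  have cz : cc z by exact: cc_sum.
  rewrite [LHS]C1_sum //; last exact: cc2_C2.
  apply: eq_bigr => i _.
  have -> : C2 z h = fun x y => \sum_(j < J.+1) C2 (conv (dyadic lam0 lam j) (Psi u L j)) h x y.
    by apply/funext => t; apply/funext => v; rewrite [LHS]C2_sum.
  rewrite {1}/C1 /conv.
  under eq_I1 do rewrite mulr_suml.
  rewrite I1_sum; first by apply: eq_bigr => j _; rewrite GE.
  move=> j; have cj := @cc2_r _ _ y (cc2_C2 (cLP j) ch).
  exact: (cc_conv_integrand x cj (cLP i)).
rewrite [LHS]lattice_error_sum; last by move=> i; exact: cc2_sum.
by apply: eq_bigr => i _; rewrite lattice_error_sum.
Qed.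

Lemma sum_complex (I : Type) (r : seq I) (F : I -> R[i]) :
  \sum_(k <- r) F k = ((\sum_(k <- r) complex.Re (F k)) +i* (\sum_(k <- r) complex.Im (F k)))%C.
Proof. by elim/big_rec3: _ => // k x y z _ ->; case: (F k). Qed.

Lemma natc_scale (N : nat) (a b : R) :
  N%:R^-1 * (a +i* b)%C = ((N%:R^-1 * a) +i* (N%:R^-1 * b))%C.
Proof.
have -> : (N%:R^-1 : R[i]) = (N%:R^-1)%:C%C by rewrite fmorphV rmorph_nat.
by simpc.
Qed.

Lemma powR_double (l e : R) : 0 <= l -> 0 <= e <= 1 -> (2 * l) `^ e <= 2 * l `^ e.
Proof.
move=> l0 /andP[e0 e1]; rewrite powRM //; apply: ler_wpM2r; first exact: powR_ge0.
by apply: ler1_powR => //; rewrite ler1n.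
Qed.

Lemma upper_bound (alpha : R) (p theta : \bar R) (s : R) (u : R -> R) (L : nat) :
  badly_approximable alpha -> (1 <= p)%E -> (1 <= theta)%E -> (p^-1 < s%:E)%E ->
  up_function u -> s < L.+1%:R ->
  exists2 C : R, 0 < C & forall N : nat, (2 <= N)%N ->
    (wce (@kronecker_set R alpha N) (besov0_ball u L s p theta)
      <= (C * (log2 N%:R `^ (1 - fine (theta^-1)%E) / N%:R `^ s))%:E)%E.
Proof.
move=> /badly_approximableP[c0 [c00 c01 bad]] p1 t1 ps up sL.
have su := up_sc up; have u1 := up_I1 up; have bu := up_bsupp up.
have ps' := fine_inve_lt p1 ps.
have [lam0 [lam [zeta [[s0 sl sz] [z1 e0 e1]]]]] := reproducing L su u1.
have [r [M [M' [[r0 M0 M'0] HL]]]] := dyadic_bounds (L + L).+2 s0 sl.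
(* 3 is the radius of the blocks and [r] that of the kernels; the two successors make [2 <= B], as
   [latbox_sum] requires, hold by computation. *)
pose B := (Num.bound (3 + r + 2)).+2.
have HB : 3 + r + 2 <= B%:R.
  apply: (@le_trans _ _ (Num.bound (3 + r + 2))%:R); last by rewrite ler_nat leqW.
  by apply: ltW; apply: archi_boundP; move: r0; lra.
have [C1w C1w0 HW] := weight_bound L c00 c01 bad p1 r0 (ltr0n _ 3) M0 M'0 HB.
have [rho [C2w [rho0 rho1 C2w0 HD]]] := decay_weight ps' sL.
pose G := 2 * (1 - rho)^-1 ^+ 2.
have G1 : 1 <= G.
  have : 1 <= (1 - rho)^-1 by rewrite invf_ge1 ?subr_gt0 //; move: rho0; lra.
  rewrite /G expr2; set v := _^-1 => v1; clear -v1; nra.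
have G0 : 0 < G := lt_le_trans ltr01 G1.
have sPsi j : sc (Psi u L j) by exact: sc_Psi.
have bPsi j : bsupp 1 (Psi u L j) by exact: bsupp_Psi.
have [th0 th1] : 0 <= 1 - fine theta^-1%E /\ 1 - fine theta^-1%E <= 1.
  by have := inve_bounds t1; clear => /andP[? ?]; split; lra.
(* Three factors 2: real and imaginary part, the splitting in [besov_coefficients], and
   [n + 1 <= 2 log2 N]. *)
exists (8 * C1w * C2w * G).
  exact: mulr_gt0 (mulr_gt0 (mulr_gt0 (ltr0n _ 8) C1w0) C2w0) G0.
move=> N N2; apply: ge_ereal_sup => _ [f [cf [T [[_ dT] rT nT]]] <-].
rewrite lee_fin.
have N0 : (0 < N)%N by exact: ltnW.
have NR : (0 : R) < N%:R by rewrite ltr0n.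
have f0 := represents_zero su u1 cf rT dT.
have [n Hn] : exists n, (2 ^ n <= N < 2 ^ n.+1)%N.
  by exists (trunc_log 2 N); exact: trunc_log_bounds.
have [l1 ln _] := log2_bounds R N2 Hn.
have [a [a0 aE aS]] := besov_coefficients t1 nT.
pose S := C2w * N%:R `^ (- s) * G.
have Ns0 : 0 < N%:R `^ (- s) by rewrite powR_gt0.
have S0 : 0 < S by exact: mulr_gt0 (mulr_gt0 C2w0 Ns0) G0.
pose V := C1w * (2 * S * n.+1%:R `^ (1 - fine theta^-1%E)).
(* Used for the real and for the imaginary part of [f]; the convolutions of either are dominated by
   the modulus [block], whose norm is what the Besov norm controls. *)
have main h : cc2 h -> bsupp2 1 h ->
    (forall m x y, `|C1 (Psi u L m.1) (C2 (Psi u L m.2) h) x y| <= block u L T m x y) ->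
    `|lattice_error alpha N B h| <= V.
  move=> ch bh hb.
  apply: (lattice_error_limit N0 (sc_cc sz) z1 ch) => J.
  rewrite (lattice_error_reproduced alpha N B J su s0 sl sz e0 e1 ch).
  pose w (m : nat * nat) := 2 `^ (- (s * (m.1 + m.2)%:R)) * block_decay p L (2 ^+ (m.1 + m.2) / N%:R).
  have term (i j : nat) : `|lattice_error alpha N B
    (C1 (dyadic lam0 lam i) (C2 (dyadic lam0 lam j) (C1 (Psi u L i) (C2 (Psi u L j) h))))| <=
      C1w * (a (i, j) * w (i, j)).
    have [k1 k2 k3] := HL i; have [q1 q2 q3] := HL j.
    have one k : (1 : R) <= 2 ^+ k by rewrite exprn_ege1 // ler1n.
    have cg : cc2 (C1 (Psi u L i) (C2 (Psi u L j) h)).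
      by apply: cc2_C1; [exact: sc_cc|apply: cc2_C2 => //; exact: sc_cc].
    have := HW N _ _ _ _ _ (block u L T (i, j)) (2 `^ (- (s * (i + j)%:R)) * a (i, j)) N0 (one i) (one j)
      k1 q1 k2 q2 k3 q3 cg (cc2_block sPsi cf rT f0 (i, j) bPsi)
      (bsupp2_block sPsi cf rT f0 (i, j) bPsi) (hb (i, j)).
    rewrite /w /= -exprD => H; apply: le_trans (H _ _) _.
    - by rewrite mulr_ge0 // powR_ge0.
    - by rewrite -block_norm_E aE.
    - by rewrite -!mulrA; apply: ler_wpM2l; [exact: ltW|rewrite mulrCA].
  apply: le_trans (ler_norm_sum _ _ _) _.
  apply: (@le_trans _ _ (\sum_(i < J.+1) \sum_(j < J.+1) C1w * (a (val i, val j) * w (val i, val j)))).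
    apply: ler_sum => i _; apply: le_trans (ler_norm_sum _ _ _) _.
    by apply: ler_sum => j _; exact: term.
  pose ms := [seq (i, j) | i <- index_iota 0 J.+1, j <- index_iota 0 J.+1].
  have toms (F : nat * nat -> R) : \sum_(m <- ms) F m = \sum_(i < J.+1) \sum_(j < J.+1) F (val i, val j).
    rewrite /ms big_allpairs big_mkord; apply: eq_bigr => i _.
    by rewrite big_mkord.
  rewrite -(toms (fun m => C1w * (a m * w m))) -mulr_sumr /V.
  apply: ler_wpM2l; first exact: ltW.
  apply: (aS ms w S n.+1%:R).
  - by apply: allpairs_uniq; [exact: iota_uniq|exact: iota_uniq|move=> [? ?] [? ?]].
  - exact: ltW.
  - by rewrite ler1n.
  - move=> m; have /andP[w0 wle] := HD N n (m.1 + m.2)%N Hn; rewrite /w w0 /=.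
    apply: le_trans wle _; apply: ler_pM => //; first by rewrite mulr_ge0 // ltW.
      by rewrite exprn_ge0 // ltW.
    by apply: le_trans G1; rewrite exprn_ile1 // ltW.
  rewrite (toms w); apply: (@le_trans _ _ (C2w * N%:R `^ (- s) * \sum_(i < J.+1) \sum_(j < J.+1) rho ^+ ndist (i + j) n)).
    rewrite mulr_sumr; apply: ler_sum => i _; rewrite mulr_sumr; apply: ler_sum => j _.
    by have /andP[_] := HD N n (i + j)%N Hn.
  rewrite -[X in _ <= X]mulrA; apply: ler_wpM2l; first exact: ltW (mulr_gt0 C2w0 Ns0).
  exact: sum_dist_diagonal.
have B2 : (2 <= B)%N by [].
have hsq (g : R[i] -> R) : g 0 = 0 -> forall x y, g (f (x, y)) != 0 -> 0 <= x <= 1 /\ 0 <= y <= 1.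
  move=> g0 x y gn; have : @unit_square R (x, y).
    by apply: contrapT => /f0 E; move: gn; rewrite E g0 eqxx.
  by case; rewrite /= !in_itv /=.
have sumE g : g 0 = 0 -> cont2 (fun x y => g (f (x, y))) ->
    \sum_(z <- latbox alpha N B) g (f ((lat alpha N z).1, (lat alpha N z).2)) =
    \sum_(k < N) g (f (kronecker_set alpha k)).
  move=> g0 cg; have := latbox_sum alpha N0 B2 cg (hsq g g0); move=> ->.
  by apply: eq_bigr => k _; rewrite -surjective_pairing.
have cre := cc2_fre cf f0; have cim := cc2_fim cf f0.
have Ere := sumE (@complex.Re R) erefl cre.1.
have Eim := sumE (@complex.Im R) erefl cim.1.
have Mre := main _ cre (bsupp2_fre f0) (fun m x y => (block_ge sPsi cf rT f0 m x y).1).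
have Mim := main _ cim (bsupp2_fim f0) (fun m x y => (block_ge sPsi cf rT f0 m x y).2).
have QE : cintegral (leb2 R) (@unit_square R) f - N%:R^-1 * \sum_(k < N) f (kronecker_set alpha k) =
   ((lattice_error alpha N B (fre f)) +i* (lattice_error alpha N B (fim f)))%C.
  have IE g : g 0 = 0 -> cc2 (fun x y => g (f (x, y))) ->
      \int[leb2 R]_(x in @unit_square R) g (f x) = I2 (fun x y => g (f (x, y))).
    move=> g0 cg; rewrite Rintegral_mkcond -(I2_leb2 cg); apply: eq_Rintegral => -[x y] _.
    rewrite patchE; case: ifPn => // /negP nz /=.
    by rewrite f0 ?g0 // => h; apply: nz; rewrite inE.
  rewrite /cintegral (IE _ erefl cre) (IE _ erefl cim) sum_complex natc_scale.
  by rewrite /lattice_error -Ere -Eim.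
apply: (@le_trans _ _ (2 * V)).
  rewrite /quadrature_error QE; apply: le_trans (normc_le_ReIm _) _ => /=.
  by rewrite mulr_natl mulr2n; apply: lerD.
rewrite /V /S powRN.
have : n.+1%:R `^ (1 - fine theta^-1%E) <= 2 * log2 N%:R `^ (1 - fine theta^-1%E).
  have := @powR_double (log2 N%:R) (1 - fine theta^-1%E).
  rewrite th0 th1 => H; apply: le_trans (H (le_trans ler01 l1) isT).
  apply: ge0_ler_powR; rewrite ?nnegrE //; first by clear -l1; lra.
  by rewrite -natr1; clear -l1 ln; lra.
have Nss : 0 < N%:R `^ s by rewrite powR_gt0.
move=> H.
set X := log2 _ `^ _ in H *; set Y := _.+1%:R `^ _ in H *.
have K0 : 0 < 4 * C1w * C2w * G / N%:R `^ s 
  by apply: divr_gt0 => //; exact: mulr_gt0 (mulr_gt0 (mulr_gt0 (ltr0n _ 4) C1w0) C2w0) G0.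
have -> : 2 * (C1w * (2 * (C2w / N%:R `^ s * G) * Y)) = (4 * C1w * C2w * G / N%:R `^ s) * Y.
  by field; rewrite gt_eqF.
have -> : 8 * C1w * C2w * G * (X / N%:R `^ s) = (4 * C1w * C2w * G / N%:R `^ s) * (2 * X).
  by field; rewrite gt_eqF.
by rewrite ler_pM2l.
Qed.

End UpperBound.

(** * Lower bound *)

Section Bumps.
Variable R : realType.
Implicit Types u v f g : R -> R.

Lemma derive1n_affine n a b f : sc f ->
  derive1n n (fun x => f (a * x + b)) = fun x => a ^+ n * derive1n n f (a * x + b).
Proof.
move=> sf; elim: n => [|n IH]; first by apply/funext => x; rewrite expr0 mul1r.
rewrite derive1nS IH; apply/funext => x; apply: is_derive_derive1.
rewrite exprSr -mulrA; apply: is_deriveZR; apply: is_derive_affine.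
by rewrite derive1nS; apply: sm_is_derive; exact: (sc_derive1n n sf).1.
Qed.

Lemma derive1n_dil n c f : sc f ->
  derive1n n (dil c f) = fun x => c ^+ n * dil c (derive1n n f) x.
Proof.
move=> sf; elim: n => [|n IH]; first by apply/funext => x; rewrite expr0 mul1r.
rewrite derive1nS IH; apply/funext => x; apply: is_derive_derive1.
rewrite exprSr -mulrA; apply: is_deriveZR.
rewrite /dil mulrCA; apply: is_deriveZR.
have := @is_derive_affine _ (derive1n n f) c 0 x (derive1n n.+1 f (c * x)).
rewrite addr0 (_ : (fun x0 => derive1n n f (c * x0 + 0)) = (fun x0 => derive1n n f (c * x0))); last first.
  by apply/funext => y; rewrite addr0.
apply.
by rewrite derive1nS; apply: sm_is_derive; exact: (sc_derive1n n sf).1.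
Qed.

Lemma derive1n_convC n f g : sc f -> sc g -> conv (derive1n n f) g = conv f (derive1n n g).
Proof.
move=> sf sg; elim: n f sf g sg => [//|n IH] f sf g sg.
rewrite derive1nS (derive_convC (sc_derive1n n sf) sg) (IH _ sf _ (sc_derive sg)).
by rewrite -derive1Sn.
Qed.

(** The affine map carries the dyadic interval from [k 2^-m] to [(k + 1) 2^-m] onto [[-1, 1]], where
    [v] is supported. *)
Definition bump v (m k : nat) x : R := v (2 * (2 ^+ m * x - k%:R) - 1).

Lemma bumpE v m k : bump v m k = fun x => v (2 ^+ m.+1 * x + (- (2 * k%:R + 1))).
Proof. by apply/funext => x; rewrite /bump exprS; congr v; ring. Qed.

Let pow2 k : (0 : R) < 2 ^+ k. Proof. by rewrite exprn_gt0. Qed.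

Lemma sc_bump v m k : sc v -> sc (bump v m k).
Proof. by move=> sv; rewrite bumpE; apply: sc_affine; rewrite ?gt_eqF. Qed.

Lemma I1_bump v m k : cc v -> I1 (bump v m k) = I1 v / 2 ^+ m.+1.
Proof.
by move=> cv; rewrite bumpE I1_affine ?gt_eqF // gtr0_norm // mulrC.
Qed.

(** Continuity gives [v 1 = 0], which excludes the right end. The cells become half-open, hence
    disjoint, and [truncn] identifies them. *)
Lemma bump_neq0 v m k x : continuous v -> bsupp 1 v -> bump v m k x != 0 ->
  k%:R <= 2 ^+ m * x < k%:R + 1.
Proof.
move=> cv bv h.
have v1 : v 1 = 0.
  by apply: (right_limit0 cv) => t t1; apply: bv; rewrite gtr0_norm // (lt_trans _ t1).
rewrite ltNge; apply/andP; split.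
  rewrite leNgt; apply: contra h => h; apply/eqP; apply: bv.
  by rewrite ltr0_norm; lra.
apply: contra h; rewrite le_eqVlt => /predU1P[h|h]; apply/eqP; rewrite /bump.
  by rewrite -h [2 * _ - 1](_ : _ = 1) //; ring.
by apply: bv; rewrite gtr0_norm; lra.
Qed.

Lemma sum_bump v A m K x : continuous v -> bsupp 1 v -> (forall t, `|v t| <= A) ->
  \sum_(k < K) `|bump v m k x| <= A.
Proof.
move=> cv bv vA.
case: (pickP (fun k : 'I_K => bump v m k x != 0)) => [k0 h0|h]; last first.
  rewrite big1; first exact: le_trans (normr_ge0 _) (vA 0).
  by move=> k _; have := h k => /negbT; rewrite negbK => /eqP ->; rewrite normr0.
rewrite (bigD1 k0) //= big1 ?addr0; first exact: vA.
move=> k kk; apply/eqP; rewrite normr_eq0; apply: contraNT kk => hk.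
have /andP[a1 a2] := bump_neq0 cv bv h0; have /andP[b1 b2] := bump_neq0 cv bv hk.
have : (k0 < k.+1)%N by rewrite -(ltr_nat R) -natr1; apply: le_lt_trans b2.
have : (k < k0.+1)%N by rewrite -(ltr_nat R) -natr1; apply: le_lt_trans a2.
by rewrite !ltnS => h1 h2; apply/eqP/val_inj/eqP; rewrite eqn_leq h1.
Qed.

(** Since the bumps of one level have disjoint cells, summing over all of them inside the integral
    costs no more than a single one. *)
Lemma sum_conv_bump v g A m K x : sc v -> bsupp 1 v -> (forall t, `|v t| <= A) -> cc g ->
  \sum_(k < K) `|conv (bump v m k) g x| <= A * I1 (fun y => `|g y|).
Proof.
move=> sv bv vA cg.
have cb k : cc (bump v m k) by exact/sc_cc/sc_bump.
have ci k : cc (fun y => bump v m k (x - y) * g y) by exact: cc_conv_integrand.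
apply: (@le_trans _ _ (\sum_(k < K) I1 (fun y => `|bump v m k (x - y) * g y|))).
  by apply: ler_sum => k _; apply: I1_norm.
rewrite -I1_sum; last by move=> k; exact: cc_norm.
rewrite -I1Z; last exact: cc_norm.
apply: le_I1; [by apply: cc_sum => k; exact: cc_norm|by apply: ccZ; exact: cc_norm|move=> y].
under eq_bigr do rewrite normrM.
rewrite -mulr_suml; apply: ler_wpM2r => //.
by apply: sum_bump => //; exact: (sc_cc sv).1.
Qed.

Lemma I1_wavelet u : cc u -> I1 (fun x => 2 * u (2 * x) - u x) = 0.
Proof.
move=> cu; rewrite I1B //; first by rewrite -[X in X - _]/(I1 (dil 2 u)) I1_dil // subrr.
by apply: (@cc_dil _ 2).
Qed.

(* For [j > m] one moves [L + 1] derivatives from the wavelet, the [(L + 1)]-st derivative of a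
   compactly supported function, to the bump. *)
Lemma sum_conv_bump_Psi u L : sc u -> bsupp 1 u ->
  exists2 D, 0 < D & forall m j K x,
    \sum_(k < K) `|conv (bump u m k) (Psi u L j) x| <= D * (2 ^- L.+1) ^+ (j - m).
Proof.
move=> su bu; have cu := sc_cc su; have sw := sc_wavelet su.
have [V sV VE] := sc_antiderivative sw (I1_wavelet cu).
pose U := derive1n L.+1 u.
have sU : sc U by exact: sc_derive1n.
have bU : bsupp 1 U by exact: bsupp_derive1n.
have [A A0 uA] := cc_bounded cu; have [A' A'0 UA] := cc_bounded (sc_cc sU).
have [r [M [M' [[r0 M0 M'0] HL]]]] := dyadic_bounds 0 su (sc_derive1n L sw).
have V0 : 0 <= I1 (fun y => `|V y|) by apply: I1_ge0.
(* The power of 4 comes from [2^(m+1) / 2^j = 4 / 2^(j + 1 - m)]: bumps of level [m] have slope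
   [2^(m+1)], and [Psi] of level [j + 1] is dilated by [2^j]. *)
pose D2 := (2 ^+ 2) ^+ L.+1 * (A' * I1 (fun y => `|V y|)).
have D20 : 0 <= D2 by rewrite /D2 !mulr_ge0 ?exprn_ge0 // ltW.
exists (A * M' + D2); first by apply: ltr_pwDl => //; exact: mulr_gt0.
move=> m j K x; have [jm|mj] := leqP j m.
  have -> : (j - m = 0)%N by apply/eqP; rewrite subn_eq0.
  rewrite expr0 mulr1; apply: le_trans (sum_conv_bump m K x su bu uA (sc_cc (sc_Psi L j su))) _.
  rewrite -[X in X <= _]addr0; apply: lerD => //; apply: ler_wpM2l; first exact: ltW.
  by rewrite Psi_dyadic; have [_ _] := HL j.
case: j mj => [//|j]; rewrite ltnS => mj.
have j0 := pow2 j; have jn : (2 : R) ^+ j != 0 by rewrite gt_eqF.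
(* [V] is an antiderivative of the wavelet, so the [(L+1)]-st derivative of its dilate by [2^j] is
   [(2^j)^(L+1)] times [Psi]. Moving the derivatives to the bump gives [(2^(m+1))^(L+1)] and turns
   [u] into [U]. *)
have E k : conv (bump u m k) (Psi u L j.+1) x =
   (2 ^+ m.+1 / 2 ^+ j) ^+ L.+1 * conv (bump U m k) (dil (2 ^+ j) V) x.
  have -> : Psi u L j.+1 = fun x => (2 ^+ j) ^- L.+1 * derive1n L.+1 (dil (2 ^+ j) V) x.
    apply/funext => y; rewrite derive1n_dil // mulKf ?expf_neq0 //.
    by rewrite derive1Sn VE.
  rewrite convZr; try (by exact/sc_cc/sc_bump); try (by exact/sc_cc/sc_derive1n/sc_dil).
  rewrite -derive1n_convC; [|exact: sc_bump|exact: sc_dil].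
  have -> : derive1n L.+1 (bump u m k) = fun y => (2 ^+ m.+1) ^+ L.+1 * bump U m k y.
    by rewrite !bumpE derive1n_affine.
  rewrite convZl; try (by exact/sc_cc/sc_bump); try (by exact/sc_cc/sc_dil).
  by rewrite mulrA expr_div_n; congr (_ * _); rewrite mulrC.
under eq_bigr do rewrite E normrM.
rewrite -mulr_sumr ger0_norm; last by rewrite exprn_ge0 // divr_ge0 // ltW.
have := sum_conv_bump m K x sU bU UA (sc_cc (sc_dil jn sV)).
rewrite I1_norm_dil //; last exact: sc_cc.
move=> H; apply: le_trans (ler_wpM2l _ H) _.
  by rewrite exprn_ge0 // divr_ge0 // ltW.
rewrite mulrDl; rewrite -[X in X <= _]add0r; apply: lerD.
  by rewrite !mulr_ge0 ?exprn_ge0 // ?invr_ge0 ?exprn_ge0 // ltW.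
rewrite /D2 [X in _ <= X]mulrAC; apply: ler_wpM2r.
  by rewrite mulr_ge0 // ltW.
have -> : 2 ^+ m.+1 / 2 ^+ j = 2 ^+ 2 * 2^-1 ^+ (j.+1 - m) :> R.
  rewrite -{1}(subnKC mj) (subSn mj) exprS exprD [2^-1 ^+ _]exprS exprVn expr2.
  by field; rewrite !gt_eqF.
by rewrite exprMn -exprVn [X in _ * X <= _]exprAC.
Qed.

End Bumps.

(** * The distribution of a continuous function and the Besov unit ball *)

Section RegularDistribution.
Local Open Scope complex_scope.
Variable R : realType.
Variable F : R -> R -> R.
Hypothesis cF : cc2 F.

Definition complexify (z : R * R) : R[i] := (F z.1 z.2)%:C.

Definition regular_distribution : Defs.distribution R :=
  fun phi => cintegral (leb2 R) setT (fun z => complexify z * phi z).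

Lemma ccontinuous_complexify : ccontinuous complexify.
Proof. by split; [exact: cF.1|move=> z; exact: cvg_cst]. Qed.

Lemma cc2_pairing (g : R * R -> R) : continuous g -> cc2 (fun x y => g (x, y) * F x y).
Proof. by move=> cg; apply: cc2M => //; exact: cont2_pair. Qed.

Lemma regular_distributionE phi : ccontinuous phi ->
  regular_distribution phi =
  I2 (fun x y => complex.Re (phi (x, y)) * F x y) +i*
  I2 (fun x y => complex.Im (phi (x, y)) * F x y).
Proof.
move=> [cr ci]; have := I2_leb2 (cc2_pairing cr); have := I2_leb2 (cc2_pairing ci).
move=> <- <-; rewrite /regular_distribution /cintegral; congr (_ +i* _); apply: eq_Rintegral => -[x y] _ /=.
  by rewrite /complexify; case: (phi (x, y)) => a b /=; rewrite mul0r subr0 mulrC.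
by rewrite /complexify; case: (phi (x, y)) => a b /=; rewrite mul0r addr0 mulrC.
Qed.

(** The seminorm of order 0 suffices: the pairing is at most the L_1-norm of [F] times the sup of
    the test function, once for the real and once for the imaginary part. *)
Lemma tempered_regular : tempered regular_distribution.
Proof.
split=> [a phi psi [sphi _] [spsi _]|].
  have [[cr ci] _] := sphi [::]; have [[dr di] _] := spsi [::].
  have crr := cc2_pairing cr; have cii := cc2_pairing ci.
  have drr := cc2_pairing dr; have dii := cc2_pairing di.
  have E1 z : complex.Re (a * phi z + psi z) =
     complex.Re a * complex.Re (phi z) - complex.Im a * complex.Im (phi z) + complex.Re (psi z).
    by case: (a) (phi z) (psi z) => [? ?] [? ?] [? ?].
  have E2 z : complex.Im (a * phi z + psi z) =
     complex.Re a * complex.Im (phi z) + complex.Im a * complex.Re (phi z) + complex.Im (psi z).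
    by case: (a) (phi z) (psi z) => [? ?] [? ?] [? ?].
  have cM (c : R) (g : R * R -> R) : continuous g -> continuous (fun z => c * g z).
    by move=> cg z; apply: cvgM; [exact: cvg_cst|exact: cg].
  have cE : ccontinuous (fun z => a * phi z + psi z).
    split; [under eq_fun do rewrite E1|under eq_fun do rewrite E2] => z.
      by apply: cvgD; [apply: cvgB|exact: dr]; apply: cM.
    by apply: cvgD; [apply: cvgD|exact: di]; apply: cM.
  rewrite !regular_distributionE //.
  have -> : I2 (fun x y => complex.Re (a * phi (x, y) + psi (x, y)) * F x y) =
    complex.Re a * I2 (fun x y => complex.Re (phi (x, y)) * F x y) -
    complex.Im a * I2 (fun x y => complex.Im (phi (x, y)) * F x y) +
    I2 (fun x y => complex.Re (psi (x, y)) * F x y).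
    rewrite -!I2Z // -I2B; [|exact: cc2Z|exact: cc2Z].
    rewrite -I2D; [|by apply: cc2B; exact: cc2Z|exact: drr].
    by apply: eq_I2 => x y; rewrite E1; ring.
  have -> : I2 (fun x y => complex.Im (a * phi (x, y) + psi (x, y)) * F x y) =
    complex.Re a * I2 (fun x y => complex.Im (phi (x, y)) * F x y) +
    complex.Im a * I2 (fun x y => complex.Re (phi (x, y)) * F x y) +
    I2 (fun x y => complex.Im (psi (x, y)) * F x y).
    rewrite -!I2Z // -I2D; [|exact: cc2Z|exact: cc2Z].
    rewrite -I2D; [|by apply: cc2D; exact: cc2Z|exact: dii].
    by apply: eq_I2 => x y; rewrite E2; ring.
  by case: (a) => a1 a2.
exists 0%N, (2 * I2 (fun x y => `|F x y|)) => phi M [sphi _] HM.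
have [[cr ci] _] := sphi [::].
have bM z : Normc.normc (phi z) <= M.
  have := HM 0%N 0%N [::] z isT isT isT.
  by rewrite /weighted_derive !expr0 mul1r rmorph1 mul1r.
have half (g : R * R -> R) : continuous g -> (forall z, `|g z| <= M) ->
    `|I2 (fun x y => g (x, y) * F x y)| <= I2 (fun x y => `|F x y|) * M.
  move=> cg gM; apply: le_trans (I2_norm (cc2_pairing cg)) _.
  rewrite mulrC -I2Z; last exact: cc2_norm.
  apply: le_I2; [exact/cc2_norm/cc2_pairing|apply: cc2Z; exact: cc2_norm|move=> x y].
  by rewrite normrM; apply: ler_wpM2r.
rewrite regular_distributionE //; apply: le_trans (normc_le_ReIm _) _ => /=.
rewrite -mulrA mulr_natl mulr2n; apply: lerD.
  by apply: (half _ cr) => z; apply: le_trans (bM z); exact: (normc_ge_ReIm _).1.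
by apply: (half _ ci) => z; apply: le_trans (bM z); exact: (normc_ge_ReIm _).2.
Qed.

Lemma dsupp_regular : (forall z, ~ @unit_square R z -> F z.1 z.2 = 0) ->
  dsupp regular_distribution `<=` @unit_square R.
Proof.
move=> F0 z; apply: contraPP => nz; apply; exists (~` @unit_square R) => //; split.
  by apply: closed_openC; exact: box_closed.
move=> phi _ sU; rewrite /regular_distribution.
have -> : (fun z => complexify z * phi z) = fun _ => 0.
  apply/funext => w; have [/eqP ->|pw] := boolP (phi w == 0); first by rewrite mulr0.
  rewrite /complexify F0 ?mul0r //; apply: sU; exact: subset_closure.
by rewrite /cintegral /= !Rintegral_cst //= !mul0r.
Qed.

Lemma represents_regular : represents complexify regular_distribution.
Proof. by []. Qed.

End RegularDistribution.

Section BesovUnitBall.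
Variables (R : realType) (u : R -> R) (L : nat) (s : R) (p : \bar R).

(** As [c m / Q] and [1 / Q] are at most 1, their [t]-th powers are no larger than themselves. This
    reduces the sum of [t]-th powers to the plain sum of the [c m], with the same profile [c] for
    all [theta]. *)
Lemma besov_norm_le1 (theta : \bar R) (T : Defs.distribution R) (c : nat * nat -> R) (Q Z : R) :
  (1 <= theta)%E -> 1 <= Q -> 1 <= Z -> (forall m, 0 <= c m <= Q) ->
  (forall ms : seq (nat * nat), uniq ms -> \sum_(m <- ms) c m <= Q ^+ 2 * Z) ->
  (forall m, ((2 `^ (s * (m.1 + m.2)%:R))%:E * block_norm u L p T m <=
     (c m / (Q ^+ 2 * Z `^ fine theta^-1%E))%:E)%E) ->
  (besov_norm u L s p theta T <= 1)%E.
Proof.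
move=> t1 Q1 Z1 cQ cS H; rewrite /besov_norm.
have Q0 : 0 < Q by lra.
have Z0 : 0 < Z by lra.
case: theta t1 H => [t||] // t1 H; last first.
  apply: ge_ereal_sup => _ [m _ <-]; apply: le_trans (H m) _.
  rewrite invey /= powRr0 mulr1 lee_fin ler_pdivrMr ?exprn_gt0 // mul1r.
  have /andP[_ h] := cQ m; apply: le_trans h _.
  by rewrite expr2; apply: ler_peMl => //; exact: ltW.
rewrite lee_fin in t1; have t0 : 0 < t by lra.
have bn0 m : (0 <= block_norm u L p T m)%E by exact: Lnorm_ge0.
have term m : ((2 `^ (s * (m.1 + m.2)%:R * t))%:E * block_norm u L p T m `^ t <=
    (c m / (Q ^+ 2 * Z))%:E)%E.
  have /andP[c0 cm] := cQ m.
  have p2 : 0 < 2 `^ (s * (m.1 + m.2)%:R) :> R by rewrite powR_gt0.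
  have fin : block_norm u L p T m \is a fin_num.
    rewrite ge0_fin_numE //; case E : (block_norm u L p T m) (bn0 m) (H m) => [x||] // _.
      by rewrite ltry.
    by rewrite gt0_muley ?lte_fin // leye_eq.
  have := H m; rewrite inve_EFin //= -(fineK fin) poweR_EFin -!EFinM !lee_fin.
  set b := fine _ => h; have b0 : 0 <= b by rewrite fine_ge0.
  rewrite powRrM -powRM ?(ltW p2) //.
  have x0 : 0 <= 2 `^ (s * (m.1 + m.2)%:R) * b by rewrite mulr_ge0 // ltW.
  have Zt0 : 0 < Z `^ t^-1 by rewrite powR_gt0.
  apply: (@le_trans _ _ ((c m / (Q ^+ 2 * Z `^ t^-1)) `^ t)).
    apply: ge0_ler_powR; rewrite ?nnegrE ?(ltW t0) //.
    by rewrite divr_ge0 // mulr_ge0 ?exprn_ge0 ?(ltW Q0) ?(ltW Zt0).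
  have -> : c m / (Q ^+ 2 * Z `^ t^-1) = (c m / Q) * ((Q * Z `^ t^-1)^-1).
    by field; rewrite !gt_eqF.
  have q0 : 0 <= c m / Q by rewrite divr_ge0 // ltW.
  have q1 : c m / Q <= 1 by rewrite ler_pdivrMr // mul1r.
  rewrite powRM //; last by rewrite invr_ge0 mulr_ge0 // ltW.
  have -> : c m / (Q ^+ 2 * Z) = (c m / Q) * (Q * Z)^-1 by field; rewrite !gt_eqF.
  have pw x : 0 <= x -> x <= 1 -> x `^ t <= x.
    move=> x0' x1; rewrite -{2}(powRr1 x0'); have [->|xn] := eqVneq x 0.
      by rewrite powR0 ?gt_eqF // powR_ge0.
    have xp : 0 < x by rewrite lt_neqAle eq_sym xn.
    have -> : t = 1 + (t - 1) by ring.
    rewrite powRD; last by rewrite xn implybT.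
    apply: ler_piMr; first exact: powR_ge0.
    rewrite -[X in _ <= X](congr1 (@^~ (t - 1)) (@powR1 R)).
    by apply: ge0_ler_powR; rewrite ?nnegrE ?subr_ge0.
  apply: ler_pM; rewrite ?powR_ge0 //; first exact: pw.
  rewrite !invfM powRM ?invr_ge0 ?(ltW Q0) ?(ltW Zt0) //.
  have -> : (Z `^ t^-1)^-1 `^ t = Z^-1.
    by rewrite -powRN -powRrM mulNr mulVf ?gt_eqF // powR_inv1 // ltW.
  apply: ler_wpM2r; first by rewrite invr_ge0 ltW.
  by apply: pw; rewrite ?invr_ge0 ?invf_le1 ?(ltW Q0).
have -> : 1%E = (1 `^ t^-1)%E :> \bar R by rewrite poweR1r.
apply: gt0_ler_poweR; rewrite ?invr_ge0 ?(ltW t0) //.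
- rewrite in_itv /= leey andbT; apply: esum_ge0 => m _; apply: mule_ge0; [rewrite lee_fin; exact: powR_ge0|exact: poweR_ge0].
- by rewrite in_itv /= leey lee01.
apply: ge_ereal_sup => _ [A [fA _] <-].
rewrite fsbig_finite //=.
apply: le_trans; first by apply: lee_sum => m _; exact: term.
rewrite sumEFin lee_fin -mulr_suml ler_pdivrMr; last by rewrite mulr_gt0 // exprn_gt0.
by rewrite mul1r; apply: cS; exact: finmap.fset_uniq.
Qed.

End BesovUnitBall.

(** * The fooling function and the lower estimate *)

Section FoolingFunction.
Variables (R : realType) (u : R -> R).
Hypotheses (su : sc u) (u1 : I1 u = 1) (bu : bsupp 1 u).
Variables (N n : nat) (P : 'I_N -> R * R).

Let cu := sc_cc su.
Let pow2 k : (0 : R) < 2 ^+ k. Proof. by rewrite exprn_gt0. Qed.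

Definition hit_cells m : seq (nat * nat) :=
  [seq (Num.truncn (2 ^+ m * (P i).1), Num.truncn (2 ^+ (n - m) * (P i).2)) | i <- enum 'I_N].

Definition free_cells m : seq (nat * nat) :=
  [seq k <- [seq (a, b) | a <- iota 0 (2 ^ m), b <- iota 0 (2 ^ (n - m))] | k \notin hit_cells m].

Definition fooling x y : R :=
  \sum_(m < n.+1) \sum_(k <- free_cells m) bump u m k.1 x * bump u (n - m) k.2 y.

(** Each point occupies one cell of a given shape, so at most [N] of the [2^n] cells are hit. *)
Lemma size_free_cells m : (m <= n)%N -> (2 ^ n <= size (free_cells m) + N)%N.
Proof.
move=> mn; set bx := [seq (a, b) | a <- iota 0 (2 ^ m), b <- iota 0 (2 ^ (n - m))].
have -> : (2 ^ n)%N = size bx by rewrite size_allpairs !size_iota -expnD subnKC.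
rewrite -(count_predC (fun k => k \notin hit_cells m) bx) /free_cells size_filter leq_add2l.
rewrite -size_filter -[N in (_ <= N)%N]card_ord cardE -(size_map (fun i => (Num.truncn (2 ^+ m * (P i).1), Num.truncn (2 ^+ (n - m) * (P i).2)))).
apply: uniq_leq_size.
  by apply: filter_uniq; apply: allpairs_uniq; [exact: iota_uniq|exact: iota_uniq|move=> [? ?] [? ?]].
by move=> k; rewrite mem_filter /= negbK => /andP[].
Qed.

Lemma mem_free_cells m k : k \in free_cells m ->
  [/\ (k.1 < 2 ^ m)%N, (k.2 < 2 ^ (n - m))%N & k \notin hit_cells m].
Proof.
rewrite mem_filter => /andP[h /allpairsP[[a b] [/= ha hb E]]]; rewrite E in h *.
by split; [move: ha; rewrite mem_iota|move: hb; rewrite mem_iota|exact: h].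
Qed.

Let cc2_term m (k : nat * nat) : cc2 (fun x y => bump u m k.1 x * bump u (n - m) k.2 y).
Proof. by apply: cc2_tensor; exact/sc_cc/sc_bump. Qed.

Lemma cc2_fooling : cc2 fooling.
Proof. by apply: cc2_sum => m; apply: cc2_sum => k. Qed.

Lemma bump_itv m k x : (k < 2 ^ m)%N -> bump u m k x != 0 -> 0 <= x <= 1.
Proof.
move=> km /(bump_neq0 cu.1 bu)/andP[h1 h2].
have x0 : 0 <= x by rewrite -(pmulr_rge0 _ (pow2 m)); apply: le_trans h1.
rewrite x0 /= -(ler_pM2l (pow2 m)) mulr1; apply: ltW; apply: lt_le_trans h2 _.
by rewrite natr1 -natrX ler_nat.
Qed.

Lemma fooling_outside z : ~ @unit_square R z -> fooling z.1 z.2 = 0.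
Proof.
move=> nz; rewrite /fooling big1 // => m _; rewrite big_seq big1 // => k /mem_free_cells[k1 k2 _].
apply/eqP/negPn/negP; rewrite mulf_eq0 negb_or => /andP[/(bump_itv k1) h1 /(bump_itv k2) h2].
by apply: nz; split; rewrite /= in_itv.
Qed.

Lemma fooling_points i : fooling (P i).1 (P i).2 = 0.
Proof.
rewrite /fooling big1 // => m _; rewrite big_seq big1 // => k /mem_free_cells[_ _ kh].
apply/eqP/negPn/negP; rewrite mulf_eq0 negb_or => /andP[/(bump_neq0 cu.1 bu) h1 /(bump_neq0 cu.1 bu) h2].
move: kh; apply/negP/negPn/mapP; exists i; first by rewrite mem_enum.
by move: h1 h2; rewrite !natr1 => h1 h2; rewrite (truncn_def h1) (truncn_def h2) -surjective_pairing.
Qed.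

(** Each of the [n + 1] shapes keeps at least [2^(n-1)] free cells, and a bump on such a cell has
    integral [2^-(n+2)]; their product is [1/8]. *)
Lemma I2_fooling : (N.*2 <= 2 ^ n)%N -> n.+1%:R / 8 <= I2 fooling.
Proof.
move=> Nn; rewrite /fooling I2_sum; last by move=> m; exact: cc2_sum.
apply: (@le_trans _ _ (\sum_(m < n.+1) (8^-1 : R))).
  by rewrite sumr_const card_ord -[X in _ <= X]mulr_natl.
apply: ler_sum => m _; have mn : (m <= n)%N by rewrite -ltnS.
rewrite I2_sum //.
rewrite (eq_bigr (fun=> (2 ^+ n.+2)^-1)); last first.
  move=> k _; rewrite I2_tensor; try by exact/sc_cc/sc_bump.
  rewrite !I1_bump // u1 !mul1r -invfM -exprD; congr (_ ^- _).
  by rewrite addSn addnS subnKC.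
rewrite big_const_seq count_predT iter_addr_0 -[X in _ <= X]mulr_natr ler_pdivlMl //.
rewrite !exprS -(ler_pM2l (_ : 0 < 2)) //.
have := size_free_cells mn; move: Nn; set sz := size _.
rewrite -muln2 => h1 h2.
have : (2 ^ n <= sz * 2)%N by lia.
rewrite -(ler_nat R) natrX natrM => h; lra.
Qed.

Lemma conv_fooling L i j x y :
  C1 (Psi u L i) (C2 (Psi u L j) fooling) x y =
  \sum_(m < n.+1) \sum_(k <- free_cells m)
     conv (bump u m k.1) (Psi u L i) x * conv (bump u (n - m) k.2) (Psi u L j) y.
Proof.
have cP l : cc (Psi u L l) by exact/sc_cc/sc_Psi.
have cb m k : cc (bump u m k) by exact/sc_cc/sc_bump.
have cI m k l z : cc (fun t => Psi u L l (z - t) * bump u m k t) by exact: cc_conv_integrand.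
rewrite C1C2E //; last exact: cc2_fooling.
transitivity (I2 (fun t v => \sum_(m < n.+1) \sum_(k <- free_cells m)
   (Psi u L i (x - t) * bump u m k.1 t) * (Psi u L j (y - v) * bump u (n - m) k.2 v))).
  apply: eq_I2 => t v; rewrite /fooling mulr_sumr; apply: eq_bigr => m _.
  by rewrite mulr_sumr; apply: eq_bigr => k _; ring.
have ct m (k : nat * nat) : cc2 (fun t v => (Psi u L i (x - t) * bump u m k.1 t) * (Psi u L j (y - v) * bump u (n - m) k.2 v)).
  by apply: cc2_tensor.
rewrite I2_sum; last by move=> m; exact: cc2_sum.
apply: eq_bigr => m _; rewrite I2_sum //; apply: eq_bigr => k _.
rewrite I2_tensor // -[I1 _]/(conv (Psi u L i) (bump u m k.1) x).
by rewrite -[I1 _]/(conv (Psi u L j) (bump u (n - m) k.2) y) !(convC (cP _)).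
Qed.

(** After absolute values, adding the hit cells only enlarges the sum; over the full grid it factors
    into one sum per variable, to which the bound on the line applies. *)
Lemma conv_fooling_le L D i j x y : 0 <= D ->
  (forall m j K x, \sum_(k < K) `|conv (bump u m k) (Psi u L j) x| <= D * (2 ^- L.+1) ^+ (j - m)) ->
  `|C1 (Psi u L i) (C2 (Psi u L j) fooling) x y| <=
  D ^+ 2 * \sum_(m < n.+1) (2 ^- L.+1) ^+ (i - m) * (2 ^- L.+1) ^+ (j - (n - m)).
Proof.
move=> D0 HD; rewrite conv_fooling mulr_sumr; apply: le_trans (ler_norm_sum _ _ _) _.
apply: ler_sum => m _.
pose f1 (k : nat) := `|conv (bump u m k) (Psi u L i) x|.
pose f2 (k : nat) := `|conv (bump u (n - m) k) (Psi u L j) y|.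
apply: (@le_trans _ _ ((\sum_(a < 2 ^ m) f1 a) * (\sum_(b < 2 ^ (n - m)) f2 b))).
  apply: le_trans (ler_norm_sum _ _ _) _.
  rewrite -!(big_mkord xpredT) mulr_suml.
  under [X in _ <= X]eq_bigr do rewrite mulr_sumr.
  have -> : \sum_(0 <= a < 2 ^ m) \sum_(0 <= b < 2 ^ (n - m)) f1 a * f2 b =
      \sum_(k <- [seq (a, b) | a <- iota 0 (2 ^ m), b <- iota 0 (2 ^ (n - m))]) f1 k.1 * f2 k.2.
    by rewrite big_allpairs /index_iota !subn0.
  rewrite /free_cells big_filter.
  rewrite [X in _ <= X](bigID (fun k => k \notin hit_cells m)) /= -[X in X <= _]addr0.
  apply: lerD; first by apply: ler_sum => k _; rewrite normrM.
  by apply: sumr_ge0 => k _; apply: mulr_ge0; exact: normr_ge0.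
rewrite expr2 mulrACA; apply: ler_pM.
- by apply: sumr_ge0 => k _; exact: normr_ge0.
- by apply: sumr_ge0 => k _; exact: normr_ge0.
- exact: HD.
- exact: HD.
Qed.

End FoolingFunction.

Section FoolingSums.
Variables (R : realType) (s : R) (L : nat).
Hypotheses (s0 : 0 < s) (sL : s < L.+1%:R).

(** For [i <= m] the weight [2^(s i)] falls off by [2^-s] per step below [m]; for [i > m] the
    cancellation [2^-(L+1)] outweighs the growth [2^s]. [rho] is the larger of the two ratios. *)
Lemma decay_ratio : exists rho : R, [/\ 0 < rho, rho < 1 &
  forall i m : nat, 2 `^ (s * i%:R) * (2 ^- L.+1) ^+ (i - m) <= 2 `^ (s * m%:R) * rho ^+ ndist i m].
Proof.
pose r1 : R := 2 `^ (- s); pose r2 : R := 2 `^ (s - L.+1%:R).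
have lt1 (e : R) : e < 0 -> 2 `^ e < 1.
  move=> e0; rewrite -[e]opprK powRN invf_lt1 ?powR_gt0 //.
  rewrite -[X in X < _](congr1 (@^~ (- e)) (@powR1 R)).
  by apply: gt0_ltr_powR; rewrite ?nnegrE ?oppr_gt0 // ltr1n.
have p1 : 0 < r1 by rewrite powR_gt0.
have p2 : 0 < r2 by rewrite powR_gt0.
have pe (a b : R) : 2 `^ (a + b) = 2 `^ a * 2 `^ b :> R by rewrite powRD // pnatr_eq0 implybT.
have pn (a : R) k : (2 `^ a) ^+ k = 2 `^ (a * k%:R) by rewrite -powR_mulrn ?powR_ge0 // -powRrM.
exists (Num.max r1 r2); split.
- by rewrite lt_max p1.
- by rewrite gt_max !lt1 // ?oppr_lt0 // subr_lt0.
move=> i m; have [im|mi] := leqP i m.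
  have -> : (i - m = 0)%N by apply/eqP; rewrite subn_eq0.
  rewrite expr0 mulr1 ndist_le //.
  have -> : 2 `^ (s * i%:R) = 2 `^ (s * m%:R) * r1 ^+ (m - i) :> R.
    by rewrite pn -pe natrB //; congr (_ `^ _); ring.
  apply: ler_wpM2l; first exact: powR_ge0.
  by apply: lerXn2r; rewrite ?nnegrE ?le_max ?lexx ?(ltW p1).
have mi' := ltnW mi; rewrite ndist_ge //.
have -> : 2 `^ (s * i%:R) * (2 ^- L.+1) ^+ (i - m) = 2 `^ (s * m%:R) * r2 ^+ (i - m) :> R.
  rewrite -[2 ^- L.+1](_ : 2 `^ (- L.+1%:R) = _); last by rewrite powRN powR_mulrn.
  by rewrite !pn -!pe natrB //; congr (_ `^ _); ring.
apply: ler_wpM2l; first exact: powR_ge0.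
by apply: lerXn2r; rewrite ?nnegrE ?le_max ?lexx ?orbT ?(ltW p2) ?(ltW p1).
Qed.

End FoolingSums.

Section DiagonalSums.
Variables (R : realType) (rho : R).
Hypotheses (r0 : 0 < rho) (r1 : rho < 1).
Let Q := 2 * (1 - rho)^-1.

(** Up to normalisation, a majorant for the weighted norm of block [k] of the fooling function: the
    shapes [(m, n - m)] contribute with geometric decay in the distance to [k]. *)
Definition diagonal_sum (n : nat) (k : nat * nat) : R :=
  \sum_(m < n.+1) rho ^+ ndist k.1 m * rho ^+ ndist k.2 (n - m).

Let pe j : 0 <= rho ^+ j. Proof. by rewrite exprn_ge0 // ltW. Qed.

Lemma diagonal_sum_bounds n k : 0 <= diagonal_sum n k <= Q.
Proof.
apply/andP; split; first by apply: sumr_ge0 => m _; rewrite mulr_ge0.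
apply: le_trans (sum_dist_center r0 r1 k.1 n.+1); apply: ler_sum => m _.
have -> : ndist m k.1 = ndist k.1 m by rewrite /ndist addnC.
by apply: ler_piMr => //; rewrite exprn_ile1 // ltW.
Qed.

(** Enlarge [ms] to a square and sum over [k] first: each of the [n + 1] shapes then contributes a
    product of two two-sided geometric series, at most [Q^2]. *)
Lemma sum_diagonal_sum n (ms : seq (nat * nat)) : uniq ms ->
  \sum_(k <- ms) diagonal_sum n k <= Q ^+ 2 * n.+1%:R.
Proof.
move=> ums; pose J := (\max_(k <- ms) maxn k.1 k.2).+1.
pose bx := [seq (a, b) | a <- index_iota 0 J, b <- index_iota 0 J].
have sub k : k \in ms -> k \in bx.
  move=> kms; have : (maxn k.1 k.2 < J)%N by rewrite ltnS; exact: (@leq_bigmax_seq _ ms predT (fun k => maxn k.1 k.2) k kms isT).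
  by rewrite gtn_max => /andP[h1 h2]; apply/allpairsP; exists k; split; rewrite ?mem_index_iota //; case: (k).
have ubx : uniq bx by apply: allpairs_uniq; [exact: iota_uniq|exact: iota_uniq|move=> [? ?] [? ?]].
apply: (@le_trans _ _ (\sum_(k <- bx) diagonal_sum n k)).
  rewrite [X in _ <= X](bigID (mem ms) predT) /= -[X in X <= _]addr0; apply: lerD; last first.
    by apply: sumr_ge0 => k _; have /andP[] := diagonal_sum_bounds n k.
  rewrite -[X in _ <= X]big_filter le_eqVlt (@perm_big _ _ _ _ ms [seq k <- bx | k \in ms]) ?eqxx //.
  apply: uniq_perm ums (filter_uniq _ ubx) _ => k.
  by rewrite mem_filter andb_idr //; exact: sub.
rewrite /bx big_allpairs big_mkord.
under eq_bigr do rewrite big_mkord.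
rewrite /diagonal_sum; under eq_bigr do rewrite exchange_big /=.
rewrite exchange_big /=; apply: (@le_trans _ _ (\sum_(m < n.+1) Q ^+ 2)); last first.
  by rewrite sumr_const card_ord -[X in X <= _]mulr_natr.
apply: ler_sum => m _; rewrite -big_distrlr /= expr2; apply: ler_pM.
- exact: sumr_ge0.
- exact: sumr_ge0.
- exact: sum_dist_center.
- exact: sum_dist_center.
Qed.

End DiagonalSums.

Section LowerBound.
Variable R : realType.

Lemma block_regular_le (u : R -> R) L (F : R -> R -> R) m x y : sc u -> cc2 F ->
  (forall z, ~ @unit_square R z -> F z.1 z.2 = 0) ->
  block u L (regular_distribution F) m x y <= `|C1 (Psi u L m.1) (C2 (Psi u L m.2) F) x y|.
Proof.
move=> su cF F0.
have sP j := sc_Psi L j su; have c1 := sc_cc (sP m.1); have c2 := sc_cc (sP m.2).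
have f0 z : ~ @unit_square R z -> complexify F z = 0.
  by move=> nz; rewrite /complexify F0.
rewrite /block (convolutionE sP (ccontinuous_complexify cF) (represents_regular F) f0).
apply: le_trans (normc_le_ReIm _) _ => /=.
rewrite [X in _ + `|X|](_ : _ = 0) ?normr0 ?addr0 //.
have cim := cc2_fim (ccontinuous_complexify cF) f0.
rewrite (C1C2E x y c1 c2 cim) /fim /= /I2.
under eq_I1 => t do under eq_I1 => v do rewrite mulr0.
by under eq_I1 do rewrite I10; rewrite I10.
Qed.

Lemma C1C2Z (k l : R -> R) (c : R) h x y : cc k -> cc l -> cc2 h ->
  C1 k (C2 l (fun x y => c * h x y)) x y = c * C1 k (C2 l h) x y.
Proof.
move=> ck cl ch; rewrite !C1C2E //; last exact: cc2Z.
rewrite -I2Z; first by apply: eq_I2 => t v; ring.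
by apply: cc2M ch; apply: cont2_tensor; apply: (cc_reflect _ _).1.
Qed.

Lemma lower_bound (alpha : R) (p theta : \bar R) (s : R) (u : R -> R) (L : nat) :
  (1 <= p)%E -> (1 <= theta)%E -> (p^-1 < s%:E)%E ->
  up_function u -> s < L.+1%:R ->
  exists2 c : R, 0 < c & forall N : nat, (2 <= N)%N ->
    ((c * (log2 N%:R `^ (1 - fine (theta^-1)%E) / N%:R `^ s))%:E <=
     wce (@kronecker_set R alpha N) (besov0_ball u L s p theta))%E.
Proof.
move=> p1 t1 ps up sL.
have su := up_sc up; have u1 := up_I1 up; have bu := up_bsupp up.
have s0 : 0 < s.
  by apply: le_lt_trans (fine_inve_lt p1 ps); have /andP[] := inve_bounds p1.
have [D D0 HD] := sum_conv_bump_Psi L su bu.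
have [rho [r0 r1 Hrho]] := decay_ratio s0 sL.
pose Q : R := 2 * (1 - rho)^-1.
have Q1 : 1 <= Q.
  have : 1 <= (1 - rho)^-1 by rewrite invf_ge1 ?subr_gt0 //; clear -r0; lra.
  by rewrite /Q; set v := _^-1 => v1; clear -v1; lra.
have Q0 : 0 < Q := lt_le_trans ltr01 Q1.
have [th0 th1] : 0 <= fine theta^-1%E /\ fine theta^-1%E <= 1.
  by have /andP[] := inve_bounds t1.
set th := fine theta^-1%E in th0 th1 *.
(* 36 is [(2 * 3)^2], the measure bound in [Lnorm_bound] for blocks of radius 3; [D^2] bounds the
   convolutions in the two variables, and [Q^2] is the normalisation in [besov_norm_le1]. *)
pose H := 36 * D ^+ 2 * Q ^+ 2.
have H0 : 0 < H by exact: mulr_gt0 (mulr_gt0 (ltr0n _ 36) (exprn_gt0 2 D0)) (exprn_gt0 2 Q0).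
have F4 : 0 < 4 `^ s :> R by rewrite powR_gt0.
exists (8^-1 / (H * 4 `^ s)).
  by apply: divr_gt0; [rewrite invr_gt0|exact: mulr_gt0].
move=> N N2.
have N0 : (0 < N)%N by exact: ltnW.
have NR : (0 : R) < N%:R by rewrite ltr0n.
have Hn := trunc_log_bounds (isT : (1 < 2)%N) N0.
(* Two levels above the logarithm, so that [2 N <= 2^n <= 4 N]: enough free cells, and [2^(s n)] is
   still at most [4^s N^s]. *)
set n0 := trunc_log 2 N in Hn; pose n := n0.+2.
have [l1 _ ln] := log2_bounds R N2 Hn.
have /andP[nN Nn] := Hn.
have Nn2 : (N.*2 <= 2 ^ n)%N.
  by rewrite /n expnS -muln2 mulnC leq_mul2l /=; exact: ltnW.
have n4 : (2 ^ n <= 4 * N)%N by rewrite /n !expnS mulnA leq_mul2l.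
pose Z : R := n.+1%:R; have Z1 : 1 <= Z by rewrite ler1n.
have Z0 : 0 < Z by rewrite ltr0n.
have Zt0 : 0 < Z `^ th by rewrite powR_gt0.
pose E : R := 2 `^ (s * n%:R); have E0 : 0 < E by rewrite powR_gt0.
(* Normalises the fooling function into the unit ball: [E] is the weight [2^(s n)] on the diagonal
   and [Z] the number of shapes. *)
pose kappa : R := (H * E * Z `^ th)^-1.
have HEZ : 0 < H * E * Z `^ th by exact: mulr_gt0 (mulr_gt0 H0 E0) Zt0.
have k0 : 0 < kappa by rewrite invr_gt0.
pose P := @kronecker_set R alpha N.
pose F x y := kappa * fooling u n P x y.
have cf := cc2_fooling su n P.
have cF : cc2 F by exact: cc2Z.
have F0 z : ~ @unit_square R z -> F z.1 z.2 = 0.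
  by move=> nz; rewrite /F fooling_outside // mulr0.
have sP j := sc_Psi L j su.
have bP j := bsupp_Psi L j su bu.
have f0 z : ~ @unit_square R z -> complexify F z = 0.
  by move=> nz; rewrite /complexify F0.
pose T := regular_distribution F.
have cC := ccontinuous_complexify cF.
have blk m x y : block u L T m x y <= kappa * (D ^+ 2 *
    \sum_(i < n.+1) (2 ^- L.+1) ^+ (m.1 - i) * (2 ^- L.+1) ^+ (m.2 - (n - i))).
  apply: le_trans (block_regular_le L m x y su cF F0) _.
  rewrite C1C2Z; [|exact/sc_cc|exact/sc_cc|exact: cf].
  rewrite normrM (gtr0_norm k0); apply: ler_wpM2l; first exact: ltW.
  exact: (conv_fooling_le su n P m.1 m.2 x y (ltW D0) HD).
have nT : (besov_norm u L s p theta T <= 1)%E.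
  apply: (@besov_norm_le1 _ u L s p theta T (diagonal_sum rho n) Q Z) => //.
  - exact: diagonal_sum_bounds.
  - by move=> ms ums; exact: sum_diagonal_sum.
  move=> m; rewrite -/th.
  have cB := cc2_block sP cC (represents_regular F) f0 m bP.
  have bB := bsupp2_block sP cC (represents_regular F) f0 m bP.
  have := Lnorm_bound p1 cB (block_ge0 sP cC (represents_regular F) f0 m) (blk m) (ler1n _ 3) bB.
  rewrite -block_norm_E => hb.
  apply: (@le_trans _ _ ((2 `^ (s * (m.1 + m.2)%:R))%:E * (kappa * (D ^+ 2 * (\sum_(i < n.+1) (2 ^- L.+1) ^+ (m.1 - i) * (2 ^- L.+1) ^+ (m.2 - (n - i)))) * (2 * 3) ^+ 2)%:E)%E).
    by apply: lee_wpmul2l => //; rewrite lee_fin powR_ge0.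
  rewrite -EFinM lee_fin.
  have -> : diagonal_sum rho n m / (Q ^+ 2 * Z `^ th) = kappa * (D ^+ 2 * 36) * (E * diagonal_sum rho n m).
    rewrite /kappa /H; field.
    by rewrite !gt_eqF.
  rewrite [X in X <= _](_ : _ = kappa * (D ^+ 2 * 36) * (2 `^ (s * (m.1 + m.2)%:R) *
     \sum_(i < n.+1) (2 ^- L.+1) ^+ (m.1 - i) * (2 ^- L.+1) ^+ (m.2 - (n - i)))); last by ring.
  apply: ler_wpM2l.
    by apply: mulr_ge0; [exact: ltW|apply: mulr_ge0 => //; apply: exprn_ge0; exact: ltW].
  rewrite /diagonal_sum !mulr_sumr; apply: ler_sum => i _.
  have ni : (i <= n)%N by rewrite -ltnS.
  have pD (a b : R) : 2 `^ (a + b) = 2 `^ a * 2 `^ b :> R by rewrite powRD // pnatr_eq0 implybT.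
  (* On the diagonal the weight splits between the two variables, so [decay_ratio] can be applied in
     each of them separately. *)
  have EE : E = 2 `^ (s * (i : nat)%:R) * 2 `^ (s * (n - i)%:R).
    by rewrite -pD -mulrDr -natrD subnKC.
  rewrite natrD mulrDr pD mulrACA EE [X in _ <= X]mulrACA.
  by apply: ler_pM; rewrite ?Hrho // mulr_ge0 ?powR_ge0 // exprn_ge0 // invr_ge0 exprn_ge0.
have inball : besov0_ball u L s p theta (complexify F).
  split=> //; exists T; split=> //; split.
    by split; [exact: tempered_regular|apply: le_lt_trans nT _; rewrite ltry].
  exact: dsupp_regular.
apply: (@le_trans _ _ (quadrature_error P (complexify F))%:E); last first.
  by apply: ereal_sup_ubound; exists (complexify F).
rewrite lee_fin /quadrature_error.
have -> : \sum_(i < N) complexify F (P i) = 0.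
  by rewrite big1 // => i _; rewrite /complexify /F fooling_points // mulr0.
rewrite mulr0 subr0.
have IF := I2_fooling su u1 P Nn2.
have -> : cintegral (leb2 R) (@unit_square R) (complexify F) = (I2 F)%:C%C.
  rewrite /cintegral; congr (_ +i* _)%C; last first.
    by rewrite /Rintegral /= integral0.
  rewrite Rintegral_mkcond -(I2_leb2 cF); apply: eq_Rintegral => z _.
  rewrite patchE; case: ifPn => // /negP nz /=.
  by rewrite F0 // => h; apply: nz; rewrite inE.
apply: le_trans (normc_ge_ReIm _).1 => /=.
rewrite [I2 F]I2Z //; apply: le_trans (ler_norm _).
apply: (@le_trans _ _ (kappa * (Z / 8))); last by apply: ler_wpM2l => //; exact: ltW.
have Nss : 0 < N%:R `^ s by rewrite powR_gt0.
have EN : E <= 4 `^ s * N%:R `^ s.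
  rewrite /E mulrC powRrM powR_mulrn // -powRM //.
  apply: ge0_ler_powR; rewrite ?nnegrE ?(ltW s0) //.
  by rewrite -natrX -natrM ler_nat.
have ZE : Z = Z `^ (1 - th) * Z `^ th.
  by rewrite -powRD ?subrK ?powRr1 ?(ltW Z0) ?(gt_eqF Z0) ?implybT.
have lZ : log2 N%:R `^ (1 - th) <= Z `^ (1 - th).
  apply: ge0_ler_powR; rewrite ?nnegrE ?subr_ge0 ?(le_trans ler01 l1) //.
  by apply: le_trans ln _; rewrite ler_nat /n; apply: leqW; exact: leqnSn.
rewrite {1}ZE /kappa.
have -> : (H * E * Z `^ th)^-1 * (Z `^ (1 - th) * Z `^ th / 8) = Z `^ (1 - th) / (8 * H * E).
  by field; rewrite !gt_eqF.
set l := log2 _ `^ _ in lZ *.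
have -> : 8^-1 / (H * 4 `^ s) * (l / N%:R `^ s) = l / (8 * H * (4 `^ s * N%:R `^ s)).
  by field; rewrite !gt_eqF.
have H8 : 0 < 8 * H by exact: mulr_gt0.
apply: ler_pM => //; first exact: powR_ge0.
  by rewrite invr_ge0 ltW // mulr_gt0 // mulr_gt0.
rewrite lef_pV2 ?posrE; [|exact: mulr_gt0 H8 (mulr_gt0 F4 Nss)|exact: mulr_gt0].
by rewrite ler_pM2l.
Qed.

End LowerBound.

Theorem theorem17 (R : realType) (alpha : R) (p theta : \bar R) (s : R)
    (Psi0 : R -> R) (L : nat) :
  badly_approximable alpha ->
  (1 <= p)%E -> (1 <= theta)%E -> (p^-1 < s%:E)%E ->
  up_function Psi0 -> s < L.+1%:R ->
  exists c C : R, [/\ 0 < c, c <= C &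
    forall N : nat, (2 <= N)%N ->
      let rate : R :=
        log2 N%:R `^ (1 - fine (theta^-1)%E) / N%:R `^ s in
      ((c * rate)%:E <= wce (@kronecker_set R alpha N)
                            (besov0_ball Psi0 L s p theta))%E /\
      (wce (@kronecker_set R alpha N) (besov0_ball Psi0 L s p theta)
         <= (C * rate)%:E)%E].
Proof.
move=> bad p1 t1 ps up sL.
have [c c0 Hc] := lower_bound alpha p1 t1 ps up sL.
have [C C0 HC] := upper_bound bad p1 t1 ps up sL.
exists c, C; split=> [//||N N2 /=]; last by split; [exact: Hc|exact: HC].
(* [c <= C] is read off at [N = 2], where the rate is positive because [log2 2 = 1]. *)
have := le_trans (Hc 2%N isT) (HC 2%N isT); rewrite lee_fin ler_pM2r //.
apply: divr_gt0; rewrite ?powR_gt0 //.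
by rewrite /log2 divff ?ltr01 // gt_eqF // ln_gt0 // ltr1n.
Qed.
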